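(* If $T$ is a two-dimensional complex torus and $f:T\dashrightarrow\mathbb P^1$ is a meromorphic map, then the number of linear fibers of $f$, when finite, is at most six.
   Context: A fiber of a meromorphic map from a two-dimensional complex torus onto a curve is called linear if it is set-theoretically equal to a union of subtori, where a subtorus here means a one-dimensional subtorus or a translate of one. *)

(* Defs.v *)
From HB Require Import structures.
From mathcomp Require Import all_boot all_order all_algebra.
From mathcomp Require Import all_classical all_reals all_analysis.
From mathcomp Require Import complex.

Set Implicit Arguments.
Unset Strict Implicit.
Unset Printing Implicit Defensive.

Import Order.TTheory GRing.Theory Num.Theory numFieldNormedType.Exports.

Local Open Scope ring_scope.
Local Open Scope classical_set_scope.
Local Open Scope quotient_scope.

(* The complex numbers, kept behind a name so that their topology and norm are
   inferred from the numClosedFieldType structure; in particular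
   [differentiable] below means complex differentiable, that is, holomorphic. *)
Definition C (R : realType) : numClosedFieldType := complex R.

Section Tori.
Context {R : realType} {n : nat}.

(* The rows of the matrix are 2n vectors of C^n linearly independent over R. *)
Definition period_matrix (B : 'M[C R]_(n + n, n)) : Prop :=
  forall u : 'rV[R]_(n + n),
    map_mx (real_complex R : R -> C R) u *m B = 0 -> u = 0.

Definition Zspan (B : 'M[C R]_(n + n, n)) : {pred 'rV[C R]_n} :=
  [pred x | `[< exists u : 'rV[int]_(n + n), x = map_mx intr u *m B >]].

Lemma Zspan_zmod_closed (B : 'M[C R]_(n + n, n)) : zmod_closed (Zspan B).
Proof.
split; first by apply/asboolP; exists 0; rewrite map_mx0 mul0mx.
move=> _ _ /asboolP[u ->] /asboolP[v ->]; apply/asboolP; exists (u - v).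
by rewrite map_mxB mulmxBl.
Qed.

HB.instance Definition _ (B : 'M[C R]_(n + n, n)) :=
  GRing.isZmodClosed.Build 'rV[C R]_n (Zspan B) (Zspan_zmod_closed B).

Definition is_lattice (L : set 'rV[C R]_n) : Prop :=
  exists B : 'M[C R]_(n + n, n), period_matrix B /\ L = [set` Zspan B].

(* The group C^n / Zspan B with the quotient topology; it is a complex torus of
   dimension n when B is a period matrix. *)
Definition torus (B : 'M[C R]_(n + n, n)) : Type :=
  ring_quotient.Quotient.quot (Zspan B).

HB.instance Definition _ (B : 'M[C R]_(n + n, n)) :=
  ZmodQuotient.copy (torus B) (ring_quotient.Quotient.quot (Zspan B)).

(* Copying the topological structure of [quotient_topology (torus B)] is not
   possible: its choiceType structure is not that of the group. *)
HB.instance Definition _ (B : 'M[C R]_(n + n, n)) :=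
  let Q := quotient_topology (torus B) in
  @isOpenTopological.Build (torus B)
    (fun U => open (\pi_(torus B) @^-1` U))
    (@openT Q) (@openI Q)
    (fun I U Uo => @bigcup_open Q I setT U (fun i _ => Uo i)).

End Tori.

(* The projective line, as the set of lines of C^2 through the origin. *)
Definition P1 (R : realType) : Type :=
  {L : {vspace 'rV[C R]_2} | \dim L == 1%N}.

(* [homog w] is the point [w_0 : w_1] of P^1, and None when w = 0. *)
Definition homog (R : realType) (w : 'rV[C R]_2) : option (P1 R) :=
  insub <[w]>%VS.

Section MeromorphicMaps.
Context {R : realType} {B : 'M[C R]_(2 + 2, 2)}.

(* A meromorphic map to P^1 is written locally [F_0 : F_1], with F_0 and F_1
   holomorphic and without common factor, that is, on a surface, with isolated
   common zeros. These common zeros are the indeterminacy points of the map,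
   where f takes the value None. *)
Definition meromorphic (f : torus B -> option (P1 R)) : Prop :=
  forall p : 'rV[C R]_2, exists F : 'rV[C R]_2 -> 'rV[C R]_2,
    \forall x \near p,
      [/\ differentiable F x, F x = 0 -> x = p
        & f (\pi_(torus B) x) = homog (F x)].

(* The closure adds the indeterminacy points, which lie in every fiber. *)
Definition fiber (f : torus B -> option (P1 R)) (c : P1 R) : set (torus B) :=
  closure (f @^-1` [set Some c]).

(* The image in the torus of a complex line C v in which the lattice induces a
   lattice; these are the compact complex subgroups of dimension one which are
   connected. *)
Definition subtorus1 (S : set (torus B)) : Prop :=
  exists v : 'rV[C R]_2,
    [/\ v != 0, is_lattice [set z : 'rV[C R]_1 | z *m v \in Zspan B]
      & S = [set \pi_(torus B) (z *m v) | z in [set: 'rV[C R]_1]]].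

Definition translated_subtorus1 (S : set (torus B)) : Prop :=
  exists p : torus B, exists2 V, subtorus1 V & S = [set p + x | x in V].

Definition linear_subset (A : set (torus B)) : Prop :=
  exists2 F : set (set (torus B)),
    F `<=` translated_subtorus1 & A = \bigcup_(S in F) S.

End MeromorphicMaps.

(* Main.v *)
Require Import Defs.
From HB Require Import structures.
From mathcomp Require Import all_boot all_order all_algebra.
From mathcomp Require Import all_classical all_reals all_analysis.
From mathcomp Require Import complex.
From mathcomp Require Import ring lra.

Set Implicit Arguments.
Unset Strict Implicit.
Unset Printing Implicit Defensive.

Import Order.TTheory GRing.Theory Num.Theory numFieldNormedType.Exports.

Local Open Scope ring_scope.
Local Open Scope classical_set_scope.

(** The map [f] is studied through its lift to the plane.  Near each point it is the
    quotient of two functions [F_0] and [F_1] without common factor, and the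
    fiber over [c = [a : b]] lifts to the zero set of [lam c F = a F_1 - b F_0],
    the indeterminacy points being the isolated common zeros of all these
    functions.  Assume that the linear fibers are finitely many but at least
    seven; a contradiction is reached as follows.

    Write [w_d = F_0 D_d F_1 - F_1 D_d F_0] for the Wronskian in the direction
    [d]; it vanishes where [d] is tangent to the fiber.  With [w_1, w_2] the
    Wronskians in the coordinate directions, the inflection
      [I(F) = w_2 ^+ 2 D_1 w_1 - w_1 w_2 (D_2 w_1 + D_1 w_2) + w_1 ^+ 2 D_2 w_2]
    vanishes where the fiber is not curved.  It has two properties.

    - It is homogeneous of degree 6: [I(u F) = u ^+ 6 I(F)]
      ([inflection_homog]).
    - It is divisible by the equation of each line contained in a fiber, with the
      multiplicity of that line in the fiber ([inflection_ldvd]).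

    The functions [lam c_i F] of seven linear fibers vanish on unions of lines,
    hence factor locally into linear forms and units ([zero_lines_factor]).  Lines
    of different fibers are different, so that the product [P(F)] of the seven
    functions divides [I(F)] locally ([inflection_divisible]).  For every [c] the
    quotient [lam c F * I(F) / P(F)] is therefore holomorphic, and it has degree
    [1 + 6 - 7 = 0]: it does not depend on the choice of [F].  It is an entire
    periodic function, thus constant ([periodic_constant]), and the constant is 0
    if [c] is the value of [f] at a point where [P(F)] does not vanish.  Hence [I(F) = 0]
    ([Infl_zero]).

    Now every fiber is made of pieces of lines: at a point where [w_v <> 0], the
    slope [s] of the tangent with respect to [v] satisfies a differential
    equation forcing it to be constant along the tangent ([slope_constant]), so
    that [f] is constant along the whole tangent line.  One of the linear fibers
    is not empty ([value_attained]) and contains a line of direction [v] whose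
    image is a translated subtorus.  If [w_v] were not identically 0, the tangent
    line at a general point would not be parallel to that line; it would meet it
    at a point where [f] has two values, that is, at an indeterminacy point, and
    this point would be locally constant because such points are isolated.  The
    same holds for a parallel line, image of the first one by a period, so that
    the tangent line itself would be locally constant, which is absurd
    ([Wron_zero]).  Hence [w_v = 0], so that all fibers are unions of translates of
    one subtorus ([all_linear]): all points of the projective line have linear
    fibers, and there are infinitely many of them.

    The function theory is developed from Goursat's lemma.  A continuous function
    that is holomorphic but at one point has a primitive ([primitive]), which
    gives Cauchy's formula with means over roots of unity in place of integrals
    ([cauchy_formula]).  Means of holomorphic functions depending on parameters
    are holomorphic ([mean_differentiable]); the holomorphy of derivatives, the
    order of a zero, the identity theorem, division by linear forms, Liouville's
    theorem and the persistence of zeros follow. *)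

(** * The complex numbers *)

Lemma continuous_atP (K : numFieldType) (T : topologicalType)
    (V : normedModType K) (f : T -> V) (x : T) :
  {for x, continuous f} <->
  forall e : K, 0 < e -> \forall y \near x, `|f x - f y| < e.
Proof. exact: (@cvgrPdist_lt K V T (nbhs x) _ f (f x)). Qed.

Section ComplexBasics.
Context {R : realType}.
Implicit Types (z w : C R) (x y : R).

Definition rc x : C R := real_complex R x.
Definition re z : R := complex.Re z.
Definition im z : R := complex.Im z.
Definition ci : C R := 'i%C.

Lemma rcD : {morph rc : x y / x + y}. Proof. exact: rmorphD. Qed.
Lemma rcM : {morph rc : x y / x * y}. Proof. exact: rmorphM. Qed.
Lemma rcB : {morph rc : x y / x - y}. Proof. exact: rmorphB. Qed.
Lemma rcV : {morph rc : x / x^-1}. Proof. exact: fmorphV. Qed.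
Lemma rc0 : rc 0 = 0. Proof. by []. Qed.
Lemma rc1 : rc 1 = 1. Proof. by []. Qed.
Lemma rcX n : {morph rc : x / x ^+ n}. Proof. exact: rmorphXn. Qed.
Lemma rc_nat n : rc n%:R = n%:R. Proof. exact: rmorph_nat. Qed.
Lemma rc_inj : injective rc. Proof. by move=> x y []. Qed.
Lemma ler_rc x y : (rc x <= rc y) = (x <= y). Proof. exact: lecR. Qed.
Lemma ltr_rc x y : (rc x < rc y) = (x < y). Proof. exact: ltcR. Qed.
Lemma normr_rc x : `|rc x| = rc `|x|.
Proof. by rewrite normc_def /= expr0n /= addr0 sqrtr_sqr. Qed.

Lemma re_rc x : re (rc x) = x. Proof. by []. Qed.
Lemma im_rc x : im (rc x) = 0. Proof. by []. Qed.
Lemma reD z w : re (z + w) = re z + re w. Proof. by case: z; case: w. Qed.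
Lemma imD z w : im (z + w) = im z + im w. Proof. by case: z; case: w. Qed.
Lemma reN z : re (- z) = - re z. Proof. by case: z. Qed.
Lemma imN z : im (- z) = - im z. Proof. by case: z. Qed.
Lemma reB z w : re (z - w) = re z - re w. Proof. by rewrite reD reN. Qed.
Lemma imB z w : im (z - w) = im z - im w. Proof. by rewrite imD imN. Qed.
Lemma reMrc x z : re (rc x * z) = x * re z.
Proof. by case: z => a b; rewrite /re/= mul0r subr0. Qed.
Lemma imMrc x z : im (rc x * z) = x * im z.
Proof. by case: z => a b; rewrite /im/= mul0r addr0. Qed.
Lemma reMci z : re (ci * z) = - im z.
Proof. by case: z => a b; rewrite /re/im/= mul0r mul1r sub0r. Qed.
Lemma imMci z : im (ci * z) = re z.
Proof. by case: z => a b; rewrite /re/im/= mul0r mul1r add0r. Qed.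
Lemma rcE z : z = rc (re z) + ci * rc (im z). Proof. exact: complexE. Qed.
Lemma norm_ci : `|ci| = 1.
Proof. by rewrite normc_def /= expr0n expr1n /= add0r sqrtr1. Qed.
Lemma le_re z : rc `|re z| <= `|z|. Proof. exact: normc_ge_Re. Qed.
Lemma le_im z : rc `|im z| <= `|z|.
Proof. by have := le_re (ci * z); rewrite reMci normrM norm_ci mul1r normrN. Qed.
Lemma le_reim z : `|z| <= rc `|re z| + rc `|im z|.
Proof.
rewrite {1}(rcE z); apply: le_trans (ler_normD _ _) _.
by rewrite normrM norm_ci mul1r !normr_rc.
Qed.

Lemma ge0_rcE z : 0 <= z -> z = rc (re z).
Proof. by move=> /ger0_Im z0; rewrite {1}(rcE z) [im z]z0 rc0 mulr0 addr0. Qed.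
Lemma gt0_re z : 0 < z -> 0 < re z.
Proof. by move=> z0; rewrite -ltr_rc -ge0_rcE// ltW. Qed.
Lemma normE z : `|z| = rc (re `|z|). Proof. exact: ge0_rcE. Qed.

Lemma continuous_rc : continuous rc.
Proof.
move=> x; apply/continuous_atP => e e0; apply/nbhs_ballP.
exists (re e) => /=; first exact: gt0_re.
by move=> y; rewrite /ball/= -rcB normr_rc -ltr_rc -ge0_rcE// ltW.
Qed.
Lemma continuous_re : continuous re.
Proof.
move=> x; apply/continuous_atP => e e0; apply/nbhs_ballP.
exists (rc e) => /=; first by rewrite -rc0 ltr_rc.
by move=> y; rewrite /ball/= -reB -ltr_rc; exact: le_lt_trans (le_re _).
Qed.
Lemma continuous_im : continuous im.
Proof.
move=> x; apply/continuous_atP => e e0; apply/nbhs_ballP.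
exists (rc e) => /=; first by rewrite -rc0 ltr_rc.
by move=> y; rewrite /ball/= -imB -ltr_rc; exact: le_lt_trans (le_im _).
Qed.

Definition cbox (B : R) : set (C R) := [set z | `|re z| <= B /\ `|im z| <= B].

Lemma cbox_compact B : compact (cbox B).
Proof.
have -> : cbox B =
   (fun p : R * R => rc p.1 + ci * rc p.2) @` (`[- B, B] `*` `[- B, B]).
  apply/seteqP; split; [move=> z [h1 h2]|move=> _ [[a b]/= [] + + <-]].
    exists (re z, im z) => /=; last by rewrite -rcE.
    by rewrite !in_itv/= -!ler_norml.
  rewrite !in_itv/= -!ler_norml => ha hb; split.
    by rewrite reD reMci re_rc im_rc oppr0 addr0.
  by rewrite imD imMci re_rc im_rc add0r.
have fc : continuous (fun p : R * R => rc p.1 + ci * rc p.2).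
  move=> p; apply: (@cvgD _ (C R)).
    by apply: (@continuous_comp _ _ _ fst rc); [exact: cvg_fst|exact: continuous_rc].
  apply: (@cvgM (C R)); first exact: cvg_cst.
  by apply: (@continuous_comp _ _ _ snd rc); [exact: cvg_snd|exact: continuous_rc].
apply: continuous_compact; first exact: continuous_subspaceT.
by apply: compact_setX; exact: segment_compact.
Qed.

Lemma normr_continuousC : continuous (fun z : C R => `|z|).
Proof. by move=> z; exact: cvg_norm cvg_id. Qed.

Lemma closed_normC_le (b : C R) : closed [set z : C R | `|z| <= b].
Proof.
have [b0|/negP nb] := boolP (0 <= b); last first.
  suff -> : [set z : C R | `|z| <= b] = set0 by exact: closed0.
  by apply/seteqP; split => // z /= zb; apply: nb; exact: le_trans zb.
have -> : [set z : C R | `|z| <= b] = (fun z => re `|z|) @^-1` [set x | x <= re b].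
  by apply/seteqP; split => z /=; rewrite -ler_rc -normE -ge0_rcE.
apply: closed_comp; last exact: closed_le.
move=> z _; apply: (@continuous_comp _ _ _ (fun z : C R => `|z|)).
  exact: normr_continuousC.
exact: continuous_re.
Qed.

Lemma cdisc_compact (b : C R) : compact [set z : C R | `|z| <= b].
Proof.
have [b0|/negP nb] := boolP (0 <= b); last first.
  suff -> : [set z : C R | `|z| <= b] = set0 by exact: compact0.
  by apply/seteqP; split => // z /= zb; apply: nb; exact: le_trans zb.
apply: (@subclosed_compact _ _ (cbox (re b))); [exact: closed_normC_le|exact: cbox_compact|].
move=> z /= zb; rewrite /cbox /= -!ler_rc -ge0_rcE//.
by split; apply: le_trans zb; [exact: le_re|exact: le_im].
Qed.

Lemma nbhs_ballC (z r : C R) : 0 < r -> nbhs z (ball z r).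
Proof. by move=> r0; apply/nbhs_ballP; exists r. Qed.

(** The Heine-Cantor theorem, with the second point allowed outside of the disc. *)
Lemma unif_cont_disc (g : C R -> C R) (b e : C R) :
  (forall z, `|z| <= b -> {for z, continuous g}) -> 0 < e ->
  exists2 d : C R, 0 < d & forall z w, `|z| <= b -> `|w - z| < d -> `|g w - g z| <= e.
Proof.
move=> gc e0.
have /compact_near_coveringP/near_covering_withinP := @cdisc_compact b.
move=> /(_ _ (nbhs (0:C R)) (fun d z => forall w, `|w - z| < `|d| -> `|g w - g z| <= e)).
case=> [z zb|d /= d0 hd].
- have /continuous_atP := gc z zb => /(_ _ (divr_gt0 e0 (ltr0Sn _ 1))) /nbhs_ballP[r /= r0 hr].
  have r2 : 0 < r / 2 by rewrite divr_gt0.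
  exists (ball z (r/2), ball (0:C R) (r/2)); first by split; exact: nbhs_ballC.
  move=> [z' d] [/= hz' hd] _ w wz'.
  move: hd hz'; rewrite /ball /= sub0r normrN => hd hz'.
  rewrite (splitr e) -[X in `|X|](subrKA (g z)) (le_trans (ler_normD _ _))//.
  apply: lerD.
    rewrite distrC; apply/ltW/hr; rewrite /ball/= -(subrKA z').
    rewrite (le_lt_trans (ler_normD _ _))// (splitr r) ltrD//.
    by rewrite distrC; exact: lt_trans wz' hd.
  apply/ltW/hr; rewrite /ball/=; apply: lt_trans hz' _.
  by rewrite [ltRHS](splitr r) ltrDl.
have d0' : 0 < d / 2 by rewrite divr_gt0.
exists (d/2) => // z w zb wz; apply: (hd (d/2)) => //.
  by rewrite /ball/= sub0r normrN (gtr0_norm d0') [ltRHS](splitr d) ltrDl.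
by rewrite (gtr0_norm d0').
Qed.
End ComplexBasics.
Arguments rc {R} x : simpl never.
Arguments re {R} z : simpl never.
Arguments im {R} z : simpl never.
Arguments ci {R} : simpl never.

(** * Primitives of continuous functions of a real variable, and bisection *)

Section Anti.
Context {R : realType}.

Lemma real_antiderivative (f : R -> R) (K : R) : continuous f ->
  exists F : R -> R, forall x, x \in `]- K, K[%R -> is_derive x (1:R) F (f x).
Proof.
move=> fc; have [K0|K0] := leP K 0.
  exists f => x; rewrite in_itv/= => /andP[h1 h2].
  by exfalso; have := lt_trans h1 h2; rewrite ltNge => /negP; apply; lra.
exists (fun x : R => (\int[lebesgue_measure]_(t in [set` Interval (BLeft (- K)) (BRight x)]) f t)%R).
move=> x; rewrite in_itv/= => /andP[h1 h2].
have int : lebesgue_measure.-integrable [set` Interval (BLeft (- K)) (BRight K)] (EFin \o f).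
  apply: continuous_compact_integrable; first exact: segment_compact.
  exact: continuous_subspaceT.
have := @continuous_FTC1 R f (BLeft (- K)) x K h2 int.
rewrite /= lte_fin => /(_ h1 (fc x)) [d1 d2].
by have := derivableP d1; rewrite -derive1E d2.
Qed.

(** [U] is a primitive of [g] on the interval of radius [K], expressed by
    comparison with the primitives of affine functions: this form passes from
    real to complex values without integrals of complex functions. *)
Definition ap_prim (K : R) (g U : R -> C R) :=
  forall (a b : R) (c1 c2 : C R) (e : R), `|a| < K -> `|b| < K ->
  (forall x, Num.min a b <= x <= Num.max a b ->
     `|g x - (c1 + c2 * rc x)| <= rc e) ->
  `|U b - U a - (c1 * rc (b - a) + c2 * (rc b ^+ 2 - rc a ^+ 2) / 2)|
     <= rc (2 * e * `|b - a|).

(** The mean value theorem for the difference of the primitive of [f] and of the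
    primitive of the affine function. *)
Lemma real_prim (f : R -> R) (K : R) : continuous f ->
  exists F : R -> R,
  forall (a b c1 c2 e : R), `|a| < K -> `|b| < K ->
  (forall x, Num.min a b <= x <= Num.max a b -> `|f x - (c1 + c2 * x)| <= e) ->
  `|F b - F a - (c1 * (b - a) + c2 * (b ^+ 2 - a ^+ 2) / 2)| <= e * `|b - a|.
Proof.
move=> fc; have [F hF] := real_antiderivative K fc.
exists F; suff H : forall (a b c1 c2 e : R), `|a| < K -> `|b| < K -> a <= b ->
  (forall x, a <= x <= b -> `|f x - (c1 + c2 * x)| <= e) ->
  `|F b - F a - (c1 * (b - a) + c2 * (b ^+ 2 - a ^+ 2) / 2)| <= e * `|b - a|.
  move=> a b c1 c2 e aK bK h; have [ab|ba] := leP a b.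
    by apply: H => // x; move: (h x); rewrite min_l// max_r.
  rewrite [`|b - a|]distrC -(normrN (F b - F a - _)) (_ : - (F b - _ - _) =
    F a - F b - (c1 * (a - b) + c2 * (a ^+ 2 - b ^+ 2) / 2)); last by field.
  apply: H => //; first exact: ltW.
  by move=> x; move: (h x); rewrite min_r ?max_l// ltW.
move=> a b c1 c2 e; rewrite !ltr_norml => /andP[a1 a2] /andP[b1 b2] ab h.
pose G x := F x - (c1 * x + c2 * x ^+ 2 / 2).
have dG x : x \in `]- K, K[%R -> is_derive x (1:R) G (f x - (c1 + c2 * x)).
  move=> /hF dF; rewrite /G.
  apply: is_derive_eq; rewrite /GRing.scale /=. by field.
have Gc : {within `[a, b], continuous G}.
  apply: derivable_within_continuous => x; rewrite in_itv/= => /andP[x1 x2].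
  by apply: (@ex_derive _ _ _ _ _ _ _ (dG x _)); rewrite in_itv/=; apply/andP; split; lra.
pose dg x := f x - (c1 + c2 * x).
have dG' x : x \in `]a, b[%R -> is_derive x (1:R) G (dg x).
  by rewrite in_itv/= => /andP[x1 x2]; apply: dG; rewrite in_itv/=; apply/andP; split; lra.
have [c hc] := MVT_segment ab dG' Gc.
move=> e1; rewrite (_ : _ - _ - _ = G b - G a); last by rewrite /G; field.
rewrite e1 normrM ler_wpM2r//; apply: h; by move: hc; rewrite in_itv.
Qed.

Lemma complex_prim (g : R -> C R) (K : R) : continuous g ->
  exists U : R -> C R, ap_prim K g U.
Proof.
move=> gc.
have c1 : continuous (re \o g) by move=> x; apply: continuous_comp; [exact: gc|exact: continuous_re].
have c2 : continuous (im \o g) by move=> x; apply: continuous_comp; [exact: gc|exact: continuous_im].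
have [F1 h1] := real_prim K c1; have [F2 h2] := real_prim K c2.
exists (fun x => rc (F1 x) + ci * rc (F2 x)) => a b k1 k2 e aK bK h.
have lin u v : `|rc u + ci * rc v| <= rc (`|u| + `|v| : R).
  by rewrite rcD -!normr_rc; apply: le_trans (ler_normD _ _) _; rewrite normrM norm_ci mul1r.
rewrite (_ : _ - _ - _ =
   rc (F1 b - F1 a - (re k1 * (b - a) + re k2 * (b ^+ 2 - a ^+ 2) / 2)) +
   ci * rc (F2 b - F2 a - (im k1 * (b - a) + im k2 * (b ^+ 2 - a ^+ 2) / 2))); last first.
  rewrite {1}(rcE k1) {1}(rcE k2) !(rcB, rcD, rcM, rcX, rcV, rc_nat); by field.
rewrite (_ : 2 * e * `|b - a| = e * `|b - a| + e * `|b - a|); last by ring.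
apply: le_trans (lin _ _) _; rewrite ler_rc; apply: lerD.
  apply: h1 => // x /h; rewrite -ler_rc; apply: le_trans; apply: le_trans (le_re _).
  by rewrite reB reD [k2 * _]mulrC reMrc mulrC.
apply: h2 => // x /h; rewrite -ler_rc; apply: le_trans; apply: le_trans (le_im _).
by rewrite imB imD [k2 * _]mulrC imMrc mulrC.
Qed.
End Anti.

Section Bisection.
Context {R : realType}.

Lemma bisect_sup (u : nat -> R) (d : R) : 0 < d ->
  (forall n, u n <= u n.+1 /\ u n.+1 + d / 2 ^+ n.+1 <= u n + d / 2 ^+ n) ->
  exists x, forall n, u n <= x <= u n + d / 2 ^+ n.
Proof.
move=> d0 h.
have mono : forall n k, u n <= u (n + k)%N /\ u (n + k)%N + d / 2 ^+ (n + k) <= u n + d / 2 ^+ n.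
  move=> n; elim=> [|k [IH1 IH2]]; first by rewrite addn0; split.
  rewrite addnS; have [h1 h2] := h (n + k)%N.
  by split; [exact: le_trans IH1 h1|exact: le_trans h2 IH2].
have ub n m : u m <= u n + d / 2 ^+ n.
  have p k : 0 <= d / 2 ^+ k by rewrite divr_ge0// ?exprn_ge0// ltW.
  case: (leqP n m) => [/subnKC <-|/ltnW /subnKC e].
    by have [_ +] := mono n (m - n)%N; apply: le_trans; rewrite lerDl.
  have [h1 _] := mono m (n - m)%N; rewrite e in h1.
  by apply: le_trans h1 _; rewrite lerDl.
pose E := range u.
have sE : has_sup E by split; [exists (u 0%N), 0%N|exists (u 0%N + d / 2 ^+ 0) => _ [m _ <-]; exact: ub].
exists (sup E) => n; apply/andP; split.
  by apply: sup_upper_bound => //; exists n.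
by apply: ge_sup; [case: sE|move=> _ [m _ <-]; exact: ub].
Qed.

Variable m : R -> R -> R -> C R.
Hypothesis madd : forall s t d, m s t d =
  m s t (d/2) + m (s + d/2) t (d/2) + m s (t + d/2) (d/2) + m (s + d/2) (t + d/2) (d/2).

(** An additive function of squares which is [o(area)] at every point vanishes:
    otherwise the defect [|m| > e * area] is inherited by one of the quarters of each
    square, and the nested squares shrink to a point where it cannot hold. *)
Lemma bisection (s0 t0 d0 : R) : 0 < d0 ->
  (forall s t e, s0 <= s <= s0 + d0 -> t0 <= t <= t0 + d0 -> 0 < e ->
    exists2 eta, 0 < eta & forall s' t' d, 0 < d < eta -> s0 <= s' -> s' <= s <= s' + d ->
     s' + d <= s0 + d0 -> t0 <= t' ->
     t' <= t <= t' + d -> t' + d <= t0 + d0 -> `|m s' t' d| <= rc (e * d ^+ 2)) ->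
  m s0 t0 d0 = 0.
Proof.
move=> d0p H; apply/eqP/negPn/negP => m0.
have n0 : 0 < re `|m s0 t0 d0| by apply: gt0_re; rewrite normr_gt0.
pose e := re `|m s0 t0 d0| / d0 ^+ 2 / 2.
have e0 : 0 < e by rewrite !divr_gt0// exprn_gt0.
pose big s t d := rc (e * d ^+ 2) < `|m s t d|.
have big0 : big s0 t0 d0.
  rewrite /big normE ltr_rc /e mulrAC divfK ?expf_neq0 ?gt_eqF//.
  by move: n0; lra.
have child s t d : big s t d -> exists st : R * R, [/\ (st.1 = s \/ st.1 = s + d/2),
    (st.2 = t \/ st.2 = t + d/2) & big st.1 st.2 (d/2)].
  move=> b; apply: contrapT => nc.
  have nb : forall s' t', (s' = s \/ s' = s + d/2) -> (t' = t \/ t' = t + d/2) ->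
      `|m s' t' (d/2)| <= rc (e * (d/2)^+2).
    move=> s' t' hs ht; rewrite normE ler_rc leNgt -ltr_rc -normE; apply/negP => bb.
    by apply: nc; exists (s', t').
  move: b; rewrite /big madd normE ltr_rc ltNge -ler_rc -normE => /negP; apply.
  have -> : rc (e * d ^+ 2) = rc (e * (d/2)^+2) + rc (e * (d/2)^+2) + rc (e * (d/2)^+2) + rc (e * (d/2)^+2).
    by rewrite -!rcD; congr rc; field.
  by do 3 (apply: le_trans (ler_normD _ _) _; apply: lerD; [|apply: nb; tauto]);
    apply: nb; tauto.
pose next (p : R * R) d : R * R := xget p [set st : R * R |
   [/\ (st.1 = p.1 \/ st.1 = p.1 + d/2),
    (st.2 = p.2 \/ st.2 = p.2 + d/2) & big st.1 st.2 (d/2)]].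
have nextP p d : big p.1 p.2 d -> [/\ ((next p d).1 = p.1 \/ (next p d).1 = p.1 + d/2),
    ((next p d).2 = p.2 \/ (next p d).2 = p.2 + d/2) & big (next p d).1 (next p d).2 (d/2)].
  by move=> b; have [st hst] := child _ _ _ b; rewrite /next; case: xgetP => [y _ //|/(_ st)]; case.
pose w := fix w n : R * R := if n is n'.+1 then next (w n') (d0 / 2 ^+ n') else (s0, t0).
have dS n : d0 / 2 ^+ n.+1 = d0 / 2 ^+ n / 2.
  by rewrite exprS; field.
have wbig n : big (w n).1 (w n).2 (d0 / 2 ^+ n) /\
   ((w n.+1).1 = (w n).1 \/ (w n.+1).1 = (w n).1 + d0 / 2 ^+ n / 2) /\
   ((w n.+1).2 = (w n).2 \/ (w n.+1).2 = (w n).2 + d0 / 2 ^+ n / 2).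
  elim: n => [|n [b [h1 h2]]].
    have b0 : big (w 0%N).1 (w 0%N).2 (d0 / 2 ^+ 0) by rewrite expr0 divr1.
    by split => //; have [] := nextP (w 0%N) _ b0.
  have [_ _ bS] := nextP (w n) _ b.
  have bS' : big (w n.+1).1 (w n.+1).2 (d0 / 2 ^+ n.+1) by rewrite dS.
  by split => //; have [] := nextP (w n.+1) _ bS'.
have dp n : 0 < d0 / 2 ^+ n by rewrite divr_gt0// exprn_gt0.
have [s hs] : exists x, forall n, (w n).1 <= x <= (w n).1 + d0 / 2 ^+ n.
  apply: bisect_sup => // n; have [_ [h _]] := wbig n; have := dp n; rewrite dS.
  by move: (w n).1 (w n).2 (d0 / 2 ^+ n) h => u v q [] -> *; split; lra.
have [t ht] : exists x, forall n, (w n).2 <= x <= (w n).2 + d0 / 2 ^+ n.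
  apply: bisect_sup => // n; have [_ [_ h]] := wbig n; have := dp n; rewrite dS.
  by move: (w n).1 (w n).2 (d0 / 2 ^+ n) h => u v q [] -> *; split; lra.
have w0 n : s0 <= (w n).1 /\ (w n).1 + d0 / 2 ^+ n <= s0 + d0 /\
            t0 <= (w n).2 /\ (w n).2 + d0 / 2 ^+ n <= t0 + d0.
  elim: n => [|n [h1 [h2 [h3 h4]]]]; first by rewrite expr0 divr1 /=; lra.
  have [_ [k1 k2]] := wbig n; have := dp n; rewrite dS.
  move: h1 h2 h3 h4; move: (w n).1 (w n).2 (d0 / 2 ^+ n) k1 k2 => u v q k1 k2 *.
  by case: k1 => ->; case: k2 => ->; repeat split; lra.
have hs0 : s0 <= s <= s0 + d0 by have := hs 0%N; rewrite expr0 divr1.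
have ht0 : t0 <= t <= t0 + d0 by have := ht 0%N; rewrite expr0 divr1.
have [eta eta0 heta] := H s t e hs0 ht0 e0.
have [n hn] : exists n, d0 / 2 ^+ n < eta.
  have [n hn] : exists n, d0 / eta < n%:R.
    by exists (Num.truncn (d0 / eta)).+1; exact: truncnS_gt.
  exists n; rewrite ltr_pdivrMr ?exprn_gt0// mulrC -ltr_pdivrMr//.
  by apply: lt_trans hn _; rewrite -natrX ltr_nat ltn_expl.
have [b _] := wbig n; have [h1 [h2 [h3 h4]]] := w0 n.
move: b; rewrite /big normE ltr_rc ltNge -ler_rc -normE => /negP; apply.
by apply: heta; rewrite ?dp.
Qed.
End Bisection.

(** * Goursat's lemma and primitives on a box *)

Section DiffEps.
Context {K : numFieldType} {V W : normedModType K}.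

Lemma differentiable_eps (f : V -> W) (x : V) : differentiable f x ->
  forall e : K, 0 < e -> exists2 d : K, 0 < d &
    forall h, `|h| < d -> `|f (x + h) - f x - 'd f x h| <= e * `|h|.
Proof.
move=> df e e0; have /eqaddoP/(_ e e0)/nbhs_ballP[d /= d0 hd] := diff_locally df.
exists d => // h hdl.
have /hd : ball 0 d h by rewrite -ball_normE /ball_ /= sub0r normrN.
by rewrite -[X in `|X| <= _ -> _]/(f (h + x) - (f x + 'd f x h)) [h + x]addrC opprD addrA.
Qed.

(** Differentiability is only a matter of estimates, which are simpler to
    establish than the asymptotic equivalence of the definition. *)
Lemma eps_differentiable (f : V -> W) (x : V) (L : {linear V -> W}) : continuous L ->
  (forall e : K, 0 < e -> exists2 d : K, 0 < d &
    forall h, `|h| < d -> `|f (x + h) - f x - L h| <= e * `|h|) ->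
  differentiable f x /\ 'd f x = L :> (V -> W).
Proof.
move=> Lc h.
have E : f \o shift x = cst (f x) + L +o_ 0 id.
  apply/eqaddoP => e e0; have [d d0 hd] := h e e0; apply/nbhs_norm0P; exists d => // y yd.
  rewrite -[X in `|X| <= _]/(f (y + x) - (f x + L y)) [y + x]addrC opprD addrA.
  exact: hd.
have dE := diff_unique Lc E.
by split; rewrite ?dE//; apply/diff_locallyP; rewrite dE.
Qed.
End DiffEps.

Lemma eq_norm_le (K : numDomainType) (V : normedZmodType K) (a b : V) :
  a = b -> `|a| <= `|b|.
Proof. by move->. Qed.

Section Goursat.
Context {R : realType}.
Variables (g : C R -> C R) (K : R).
Hypothesis gc : continuous g.

Definition pt (x y : R) : C R := rc x + ci * rc y.
Lemma re_pt x y : re (pt x y) = x.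
Proof. by rewrite /pt reD reMci im_rc oppr0 addr0. Qed.
Lemma im_pt x y : im (pt x y) = y.
Proof. by rewrite /pt imD imMci re_rc im_rc add0r. Qed.
Lemma ptE z : z = pt (re z) (im z). Proof. exact: rcE. Qed.
(** Primitives on all horizontal and on all vertical segments. *)
Lemma prim_ex : exists U V : R -> R -> C R,
  (forall y, ap_prim K (fun x => g (pt x y)) (U y)) /\
  (forall x, ap_prim K (fun y => g (pt x y)) (V x)).
Proof.
have cU y : continuous (fun x => g (pt x y)).
  move=> x; apply: (@continuous_comp _ _ _ (pt ^~ y) g); last exact: gc.
  by apply: (@cvgD _ (C R)); [exact: continuous_rc|exact: cvg_cst].
have cV x : continuous (fun y => g (pt x y)).
  move=> y; apply: (@continuous_comp _ _ _ (pt x) g); last exact: gc.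
  apply: (@cvgD _ (C R)); first exact: cvg_cst.
  by apply: (@cvgM (C R)); [exact: cvg_cst|exact: continuous_rc].
have [U hU] := choice (fun y => complex_prim K (cU y)).
have [V hV] := choice (fun x => complex_prim K (cV x)).
by exists U, V.
Qed.

Variables U V : R -> R -> C R.
Hypothesis hU : forall y, ap_prim K (fun x => g (pt x y)) (U y).
Hypothesis hV : forall x, ap_prim K (fun y => g (pt x y)) (V x).

(** The integral of [g] along the boundary of a rectangle. *)
Definition contour (a b c d : R) : C R :=
  (U c b - U c a) + ci * (V b d - V b c) - (U d b - U d a) - ci * (V a d - V a c).

(** An affine function has integral 0 along a rectangle, so that [g] counts only by its
    distance to an affine function. *)
Lemma contour_le (a b c d : R) (A B : C R) (e : R) :
  `|a| < K -> `|b| < K -> `|c| < K -> `|d| < K ->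
  (forall x y, Num.min a b <= x <= Num.max a b ->
     Num.min c d <= y <= Num.max c d ->
     `|g (pt x y) - (A + B * pt x y)| <= rc e) ->
  `|contour a b c d| <= rc (4 * e * (`|b - a| + `|d - c|)).
Proof.
move=> aK bK cK dK h.
have in1 (s t : R) : Num.min s t <= s <= Num.max s t.
  by rewrite ge_min le_max lexx.
have in2 (s t : R) : Num.min s t <= t <= Num.max s t.
  by rewrite ge_min le_max lexx !orbT.
have hh y : Num.min c d <= y <= Num.max c d ->
    `|U y b - U y a - ((A + B * ci * rc y) * rc (b - a) + B * (rc b ^+ 2 - rc a ^+ 2) / 2)|
    <= rc (2 * e * `|b - a|).
  move=> hy; apply: hU => // x hx; apply: le_trans (h _ _ hx hy); rewrite /pt.
  by apply: eq_norm_le; ring.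
have hv x : Num.min a b <= x <= Num.max a b ->
    `|V x d - V x c - ((A + B * rc x) * rc (d - c) + (B * ci) * (rc d ^+ 2 - rc c ^+ 2) / 2)|
    <= rc (2 * e * `|d - c|).
  move=> hx; apply: hV => // y hy; apply: le_trans (h _ _ hx hy); rewrite /pt.
  by apply: eq_norm_le; ring.
have h1 := hh c (in1 _ _); have h2 := hh d (in2 _ _).
have h3 := hv a (in1 _ _); have h4 := hv b (in2 _ _).
rewrite /contour.
set U1 := U c b - U c a in h1 *; set U2 := U d b - U d a in h2 *.
set V1 := V a d - V a c in h3 *; set V2 := V b d - V b c in h4 *.
rewrite (_ : U1 + ci * V2 - U2 - ci * V1 =
 (U1 - ((A + B * ci * rc c) * rc (b - a) + B * (rc b ^+ 2 - rc a ^+ 2) / 2))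
 - (U2 - ((A + B * ci * rc d) * rc (b - a) + B * (rc b ^+ 2 - rc a ^+ 2) / 2))
 + (ci * (V2 - ((A + B * rc b) * rc (d - c) + (B * ci) * (rc d ^+ 2 - rc c ^+ 2) / 2))
 - ci * (V1 - ((A + B * rc a) * rc (d - c) + (B * ci) * (rc d ^+ 2 - rc c ^+ 2) / 2)))); last first.
  by rewrite !rcB; ring.
apply: le_trans (ler_normD _ _) _.
rewrite (_ : 4 * e * (`|b - a| + `|d - c|) = (2 * e * `|b - a| + 2 * e * `|b - a|) +
   (2 * e * `|d - c| + 2 * e * `|d - c|)); last by ring.
rewrite (rcD (_ + _)); apply: lerD; rewrite (rcD (2 * e * _)); apply: le_trans (ler_normB _ _) _.
  exact: lerD.
by rewrite !normrM norm_ci !mul1r lerD.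
Qed.

Lemma affine_between (a L s d u x : R) : 0 <= d -> s <= u <= s + d ->
  Num.min (a + s * L) (a + (s + d) * L) <= x <= Num.max (a + s * L) (a + (s + d) * L) ->
  `|x - (a + u * L)| <= d * `|L|.
Proof.
move=> d0 /andP[u1 u2]; rewrite ler_norml; have [L0|L0] := leP 0 L.
  have h1 := ler_wpM2r L0 u1; have h2 := ler_wpM2r L0 u2.
  have dL : 0 <= d * L by exact: mulr_ge0.
  have e : (s + d) * L = s * L + d * L by ring.
  rewrite e in h2 *; rewrite (ger0_norm L0) min_l ?max_r//; lra.
have L1 := ltW L0.
have h1 := ler_wnM2r L1 u1; have h2 := ler_wnM2r L1 u2.
have dL : d * L <= 0 by exact: mulr_ge0_le0.
have e : (s + d) * L = s * L + d * L by ring.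
rewrite e in h2 *; rewrite (ltr0_norm L0) min_r ?max_l//; lra.
Qed.

Lemma affine_lt (a L s : R) : `|a| < K -> `|a + L| < K -> 0 <= s <= 1 -> `|a + s * L| < K.
Proof.
rewrite !ltr_norml => /andP[h1 h2] /andP[h3 h4] /andP[s0 s1].
have [->|sn] := eqVneq s 1; first by rewrite mul1r; apply/andP; split.
have t0 : 0 < 1 - s by rewrite subr_gt0 lt_neqAle sn.
have e : a + s * L = (1 - s) * a + s * (a + L) by ring.
have eK : K = (1 - s) * K + s * K by ring.
have k1 : (1 - s) * a < (1 - s) * K by rewrite ltr_pM2l.
have k2 : (1 - s) * (- K) < (1 - s) * a by rewrite ltr_pM2l.
have k3 : s * (a + L) <= s * K by rewrite ler_wpM2l// ltW.
have k4 : s * (- K) <= s * (a + L) by rewrite ler_wpM2l// ltW.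
by rewrite e {1 2}eK; apply/andP; split; [rewrite opprD -!mulrN|]; lra.
Qed.

Section Rect.
Variables (x0 y0 L H : R).
Hypotheses (hx0 : `|x0| < K) (hx1 : `|x0 + L| < K) (hy0 : `|y0| < K) (hy1 : `|y0 + H| < K).

(** Rectangles are parametrized by subsquares of the unit square, so that bisection
    keeps their proportions. *)
Definition square (s t d : R) := contour (x0 + s * L) (x0 + (s + d) * L) (y0 + t * H) (y0 + (t + d) * H).

Lemma square_le (s t d u v e : R) (A B : C R) : 0 <= s -> s + d <= 1 -> 0 <= t -> t + d <= 1 ->
  0 <= d ->  s <= u <= s + d -> t <= v <= t + d ->
  (forall z : C R, `|z - pt (x0 + u * L) (y0 + v * H)| <= rc (d * (`|L| + `|H|)) ->
     `|g z - (A + B * z)| <= rc e) ->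
  `|square s t d| <= rc (4 * e * (d * (`|L| + `|H|))).
Proof.
move=> s0 s1 t0 t1 d0 hu hv h.
have dE a l r : `|a + (r + d) * l - (a + r * l)| = d * `|l|.
  by rewrite (_ : _ - _ = d * l) ?normrM ?(ger0_norm d0)//; ring.
rewrite (_ : d * (_ + _) = `|x0 + (s + d) * L - (x0 + s * L)|
   + `|y0 + (t + d) * H - (y0 + t * H)|); last by rewrite !dE mulrDr.
apply: (@contour_le _ _ _ _ A B); try by apply: affine_lt => //; apply/andP; split; lra.
move=> x y hx hy; apply: h; apply: le_trans (le_reim _) _.
rewrite -rcD ler_rc mulrDr reB imB !re_pt !im_pt; apply: lerD;
  [exact: (affine_between d0 hu hx)|exact: (affine_between d0 hv hy)].
Qed.

Lemma square_add s t d : square s t d =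
  square s t (d/2) + square (s + d/2) t (d/2) + square s (t + d/2) (d/2) + square (s + d/2) (t + d/2) (d/2).
Proof.
have e (r : R) : r + d / 2 + d / 2 = r + d by field.
by rewrite /square !e /contour; ring.
Qed.

(** Near a point where [g] is differentiable, the integral along a small square is
    small compared with the area, by comparison with the affine approximation. *)
Lemma goursat (s0 t0 d0 : R) : 0 <= s0 -> s0 + d0 <= 1 -> 0 <= t0 -> t0 + d0 <= 1 -> 0 < d0 ->
  (forall s t, s0 <= s <= s0 + d0 -> t0 <= t <= t0 + d0 ->
     differentiable g (pt (x0 + s * L) (y0 + t * H))) ->
  square s0 t0 d0 = 0.
Proof.
move=> hs0 hs1 ht0 ht1 d0p dg; apply: bisection => //; first exact: square_add.
move=> s t e hs ht e0.
set z0 := pt (x0 + s * L) (y0 + t * H).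
pose S : R := `|L| + `|H|.
have S0 : 0 <= S by rewrite addr_ge0.
pose e' := e / (4 * S ^+ 2 + 1).
have S1 : 0 < 4 * S ^+ 2 + 1 by rewrite ltr_wpDl// mulr_ge0// sqr_ge0.
have e'0 : 0 < e' by rewrite divr_gt0.
have rce' : 0 < rc e' by rewrite -rc0 ltr_rc.
have [r r0 hr] := differentiable_eps (dg s t hs ht) rce'.
have r'0 : 0 < re r by exact: gt0_re.
exists (re r / (S + 1)); first by rewrite divr_gt0// ltr_wpDl.
move=> s' t' d /andP[dp hd] h1 h2 h3 h4 h5 h6.
have dS : d * S < re r.
  rewrite ltr_pdivlMr ?ltr_wpDl// in hd.
  by apply: le_lt_trans hd; rewrite ler_wpM2l//; [exact: ltW|lra].
pose B := 'd g z0 1.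
apply: (@le_trans _ _ (rc (4 * (e' * (d * S)) * (d * S)))).
  apply: (@square_le _ _ _ s t _ (g z0 - B * z0) B) => //; try lra.
  move=> z hz; have -> : g z - (g z0 - B * z0 + B * z) = g (z0 + (z - z0)) - g z0 - 'd g z0 (z - z0).
    have -> : 'd g z0 (z - z0) = (z - z0) * B by rewrite -[X in 'd g z0 X]mulr1 linearZ.
    by rewrite [z0 + _]addrC subrK; ring.
  apply: le_trans (hr _ _) _ => //.
    by apply: le_lt_trans hz _; rewrite (ge0_rcE (ltW r0)) ltr_rc.
  by rewrite (rcM e') ler_wpM2l// ltW.
rewrite ler_rc (_ : _ * _ = e * d ^+ 2 * ((4 * S ^+ 2) / (4 * S ^+ 2 + 1))); last by rewrite /e'; field; exact: lt0r_neq0.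
rewrite ler_piMr//; first by rewrite mulr_ge0 ?sqr_ge0// ltW.
by rewrite ler_pdivrMr// mul1r lerDl.
Qed.

(** Goursat's lemma when differentiability may fail at a corner, as it does for a
    difference quotient. *)
Lemma goursat_corner :
  (forall z, `|re z| < K -> `|im z| < K -> z != pt x0 y0 -> differentiable g z) ->
  contour x0 (x0 + L) y0 (y0 + H) = 0.
Proof.
move=> dg; have [->|L0] := eqVneq L 0; first by rewrite addr0 /contour; ring.
have [->|H0] := eqVneq H 0; first by rewrite addr0 /contour; ring.
have -> : contour x0 (x0 + L) y0 (y0 + H) = square 0 0 1.
  by rewrite /square !mul0r !addr0 !add0r !mul1r.
have dg' s t : 0 <= s <= 1 -> 0 <= t <= 1 -> (s != 0) || (t != 0) ->
    differentiable g (pt (x0 + s * L) (y0 + t * H)).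
  move=> hs ht st; apply: dg; rewrite ?re_pt ?im_pt; try exact: affine_lt.
  apply/eqP => E; move: st.
  have := congr1 re E; rewrite !re_pt => /eqP; rewrite addrC -subr_eq0 addrK mulf_eq0 (negbTE L0) orbF => ->.
  have := congr1 im E; rewrite !im_pt => /eqP; rewrite addrC -subr_eq0 addrK mulf_eq0 (negbTE H0) orbF => ->.
  by [].
(* The squares that avoid the corner contribute nothing, so that only a tiny square
   at the corner remains, where [g] is bounded. *)
have half n : square 0 0 1 = square 0 0 ((1/2) ^+ n).
  elim: n => [|n IH]; first by rewrite expr0.
  have dn : 0 < (1/2 : R) ^+ n by rewrite exprn_gt0.
  have dn1 : (1/2 : R) ^+ n <= 1 by rewrite exprn_ile1//; lra.
  rewrite IH square_add exprS (_ : 1 / 2 * _ = (1/2) ^+ n / 2); last by field.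
  set d := (1/2) ^+ n in dn dn1 *.
  have z1 : square (0 + d/2) 0 (d/2) = 0.
    apply: goursat; [lra|lra|lra|lra|lra|move=> s t hs ht; apply: dg'; [lra|lra|]].
    by apply/orP; left; rewrite gt_eqF//; lra.
  have z2 : square 0 (0 + d/2) (d/2) = 0.
    apply: goursat; [lra|lra|lra|lra|lra|move=> s t hs ht; apply: dg'; [lra|lra|]].
    by apply/orP; right; rewrite gt_eqF//; lra.
  have z3 : square (0 + d/2) (0 + d/2) (d/2) = 0.
    apply: goursat; [lra|lra|lra|lra|lra|move=> s t hs ht; apply: dg'; [lra|lra|]].
    by apply/orP; right; rewrite gt_eqF//; lra.
  rewrite z1 z2 z3.
  by rewrite !addr0.
apply/eqP/negPn/negP => n0.
have m0 : 0 < re `|square 0 0 1| by apply: gt0_re; rewrite normr_gt0.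
pose S : R := `|L| + `|H|.
have S0 : 0 < S by rewrite addr_gt0// normr_gt0.
have gc0 : {for pt x0 y0, continuous g} by exact: gc.
have /continuous_atP/(_ 1 ltr01)/nbhs_ballP[r r0 hr] := gc0.
have r'0 : 0 < re r by exact: gt0_re.
pose q := Num.min (re r / S) (re `|square 0 0 1| / (4 * S)).
have q0 : 0 < q by rewrite lt_min !divr_gt0// mulr_gt0.
have [n hn] : exists n, (1/2) ^+ n < q.
  exists (Num.truncn q^-1).+1; rewrite div1r exprVn -[ltRHS]invrK ltf_pV2 ?posrE ?invr_gt0// ?exprn_gt0//.
  by apply: lt_trans (truncnS_gt _) _; rewrite -natrX ltr_nat ltn_expl.
set d := (1/2) ^+ n in hn; move: hn; rewrite lt_min => /andP[hn1 hn2].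
have d0 : 0 < d by rewrite exprn_gt0.
have d1 : d <= 1 by rewrite exprn_ile1//; lra.
have : `|square 0 0 d| <= rc (4 * 1 * (d * S)).
  apply: (@square_le _ _ _ 0 0 _ (g (pt x0 y0)) 0); try lra.
  rewrite !mul0r !addr0 => z hz; rewrite mul0r addr0 rc1 distrC; apply/ltW/hr.
  rewrite /ball /= distrC; apply: le_lt_trans hz _.
  by rewrite [ltRHS](ge0_rcE (ltW r0)) ltr_rc -ltr_pdivlMr.
rewrite -half normE ler_rc leNgt => /negP; apply.
by rewrite mulr1 mulrA mulrAC mulrC -ltr_pdivlMr// mulr_gt0.
Qed.
End Rect.

Definition box : set (C R) := [set z | `|re z| < K /\ `|im z| < K].

(** A continuous function, holomorphic on a box but possibly at one point, has
    a primitive there.  The two L-shaped paths from the exceptional point define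
    the same function, which has the right increments in both directions. *)
Lemma primitive (e : C R) : box e ->
  (forall z, box z -> z != e -> differentiable g z) ->
  exists F : C R -> C R, forall z z' c (eta : R), box z -> box z' ->
    (forall y, `|y - z| <= 2 * `|z' - z| -> `|g y - c| <= rc eta) ->
    `|F z' - F z - c * (z' - z)| <= rc (4 * eta) * `|z' - z|.
Proof.
move=> [e1 e2] dg.
pose x0 := re e; pose y0 := im e.
exists (fun z => (U y0 (re z) - U y0 x0) + ci * (V (re z) (im z) - V (re z) y0)).
have F2 z : box z -> (U y0 (re z) - U y0 x0) + ci * (V (re z) (im z) - V (re z) y0) =
    ci * (V x0 (im z) - V x0 y0) + (U (im z) (re z) - U (im z) x0).
  move=> [z1 z2]; have := @goursat_corner x0 y0 (re z - x0) (im z - y0).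
  rewrite ![_ + (_ - _)]addrC !subrK => /(_ e1 z1 e2 z2) H.
  have /eqP : contour x0 (re z) y0 (im z) = 0.
    by apply: H => w w1 w2; rewrite -ptE => we; exact: dg.
  rewrite /contour -subr_eq0 => /eqP E; apply/eqP; rewrite -subr_eq0 -[X in _ == X]E.
  by apply/eqP; ring.
move=> z z' c eta hz hz' h.
have [z1 z2] := hz; have [z1' z2'] := hz'.
set x := re z in z1 *; set y := im z in z2 *; set x' := re z' in z1' *; set y' := im z' in z2' *.
pose w := pt x' y.
have hw : box w by split; rewrite /w ?re_pt ?im_pt.
have lx : rc `|x' - x| <= `|z' - z| by rewrite /x' /x -reB; exact: le_re.
have ly : rc `|y' - y| <= `|z' - z| by rewrite /y' /y -imB; exact: le_im.
have E1 := F2 z hz; have E2 := F2 w hw.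
rewrite /w re_pt im_pt -/x -/y in E1 E2 *.
have -> : U y0 x' - U y0 x0 + ci * (V x' y' - V x' y0) - (U y0 x - U y0 x0 + ci * (V x y - V x y0))
   - c * (z' - z) = (U y x' - U y x - c * rc (x' - x)) + ci * (V x' y' - V x' y - c * rc (y' - y)).
  rewrite E1.
  have -> : U y0 x' - U y0 x0 + ci * (V x' y' - V x' y0) =
     U y0 x' - U y0 x0 + ci * (V x' y - V x' y0) + ci * (V x' y' - V x' y) by ring.
  rewrite E2 {1}(ptE z') {1}(ptE z) -/x -/y -/x' -/y' /pt !rcB; ring.
have mm (s t r : R) : Num.min s t <= r <= Num.max s t -> `|r - s| <= `|t - s|.
  have [st|ts] := leP s t => /andP[r1 r2].
    by rewrite !ger0_norm ?subr_ge0// lerD2r.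
  by rewrite !ler0_norm ?subr_le0 ?(ltW ts)// lerN2 lerD2r.
apply: le_trans (ler_normD _ _) _.
have eta0 : 0 <= eta.
  rewrite -ler_rc rc0; apply: le_trans (h z _); first exact: normr_ge0.
  by rewrite subrr normr0 mulr_ge0.
have -> : rc (4 * eta) * `|z' - z| = rc (2 * eta) * `|z' - z| + rc (2 * eta) * `|z' - z|.
  by rewrite -mulrDl -rcD; congr (rc _ * _); ring.
have e2eta : 0 <= rc (2 * eta) by rewrite -rc0 ler_rc mulr_ge0.
apply: lerD.
  apply: le_trans (_ : rc (2 * eta * `|x' - x|) <= _); last by rewrite rcM ler_wpM2l.
  have := @hU y x x' c 0 eta z1 z1'; rewrite !mul0r addr0; apply.
  move=> r hr; rewrite mul0r addr0; apply: h.
  rewrite {1}(ptE z) -/x -/y /pt opprD addrACA subrr addr0 -rcB normr_rc.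
  apply: le_trans (_ : rc `|x' - x| <= _); first by rewrite ler_rc; exact: mm.
  by apply: le_trans lx _; rewrite mulr_natl mulr2n lerDl.
rewrite normrM norm_ci mul1r.
apply: le_trans (_ : rc (2 * eta * `|y' - y|) <= _); last by rewrite rcM ler_wpM2l.
have := @hV x' y y' c 0 eta z2 z2'; rewrite !mul0r addr0; apply.
move=> r hr; rewrite mul0r addr0; apply: h.
rewrite {1}(ptE z) -/x -/y /pt opprD addrACA -rcB -mulrBr -rcB.
apply: le_trans (ler_normD _ _) _; rewrite normrM norm_ci mul1r !normr_rc mulr_natl mulr2n.
by apply: lerD => //; apply: le_trans ly; rewrite ler_rc; exact: mm.
Qed.
End Goursat.

(** * Means over the unit circle *)

(** The order of the complex numbers is not total, so that a minimum is replaced by a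
    common lower bound. *)
Lemma pos_min2 (K : numFieldType) (d r : K) : 0 < d -> 0 < r ->
  exists2 m : K, 0 < m & m <= d /\ m <= r.
Proof.
move=> d0 r0; have s0 : 0 < d + r by exact: addr_gt0.
exists (d * r / (d + r)); first by rewrite divr_gt0// mulr_gt0.
split; first by rewrite ler_pdivrMr// ler_wpM2l ?(ltW d0)// lerDr ltW.
by rewrite ler_pdivrMr// mulrC ler_wpM2l ?(ltW r0)// lerDl ltW.
Qed.

Lemma near_differentiable (K : numFieldType) (V W : normedModType K) (f g : V -> W) (x : V) :
  (\forall y \near x, f y = g y) -> differentiable f x ->
  differentiable g x /\ 'd g x = 'd f x :> (V -> W).
Proof.
move=> fg df; apply: eps_differentiable; first exact: diff_continuous.
move=> e e0; have [d d0 hd] := differentiable_eps df e0.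
have /nbhs_normP[r /= r0 hr] := fg.
have r0' : 0 < r by [].
have [m m0 [md mr]] := pos_min2 d0 r0'.
exists m => // h hm; rewrite -!(hr) /=.
- by apply: hd; exact: lt_le_trans md.
- by rewrite /ball_/= subrr normr0.
- by rewrite /ball_/= opprD addrA subrr sub0r normrN; exact: lt_le_trans mr.
Qed.

Lemma fmap_ultra (T U : Type) (f : T -> U) (F : set_system T) :
  UltraFilter F -> UltraFilter (f @ F).
Proof.
move=> FU; apply: Build_UltraFilter => G GF FG; apply/seteqP; split => // A GA.
have [//|nA] := in_ultra_setVsetC (f @^-1` A) FU.
have GnA : G (~` A) by exact: FG.
have : G set0 by rewrite -(setICr A); exact: filterI.
by move=> /filter_not_empty.
Qed.

Section Mean.
Context {R : realType}.
Implicit Types (f g : C R -> C R).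

(** The square root in the right half-plane, so that iterated roots tend to 1. *)
Definition half_sqrt (z : C R) : C R := if 0 <= re (sqrtC z) then sqrtC z else - sqrtC z.
Lemma half_sqrtK z : half_sqrt z ^+ 2 = z.
Proof. by rewrite /half_sqrt; case: ifP => _; rewrite ?sqrrN sqrtCK. Qed.
Lemma re_half_sqrt z : 0 <= re (half_sqrt z).
Proof.
rewrite /half_sqrt; case: ifP => //= /negbT; rewrite -ltNge => /ltW h.
by rewrite reN oppr_ge0.
Qed.

(** [zeta n] is a primitive root of unity of order [2 ^ n.+1]. *)
Fixpoint zeta (n : nat) : C R := if n is n'.+1 then half_sqrt (zeta n') else -1.
Definition zord (n : nat) : nat := (2 ^ n.+1)%N.

Lemma zetaX n : zeta n ^+ (2 ^ n) = -1.
Proof.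
elim: n => [|n IH]; first by rewrite expn0 expr1.
by rewrite expnS exprM half_sqrtK.
Qed.
Lemma zeta_ord n : zeta n ^+ zord n = 1.
Proof. by rewrite /zord expnSr exprM zetaX sqrrN expr1n. Qed.
Lemma zord_gt0 n : (0 < zord n)%N. Proof. by rewrite expn_gt0. Qed.
Lemma norm_zeta n : `|zeta n| = 1.
Proof.
apply/eqP; rewrite -(@pexpr_eq1 _ _ (zord n))//; last exact: zord_gt0.
by rewrite -normrX zeta_ord normr1.
Qed.
Lemma norm_zetaX n k : `|zeta n ^+ k| = 1.
Proof. by rewrite normrX norm_zeta expr1n. Qed.
Lemma zeta_neq1 n : zeta n != 1.
Proof.
apply/eqP => E; have := zetaX n; rewrite E expr1n => /eqP.
by rewrite -subr_eq0 opprK -mulr2n (pnatr_eq0 (C R) 2).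
Qed.

Lemma sqr_normE (z : C R) : `|z| ^+ 2 = rc (re z ^+ 2 + im z ^+ 2).
Proof. by rewrite -add_Re2_Im2. Qed.

(** [|z ^+ 2 - 1| = |z - 1| * |z + 1|], and [|z + 1| ^+ 2 >= 2] when [z] is of
    modulus 1 in the right half-plane. *)
Lemma zeta_close n : `|zeta n - 1| ^+ 2 <= rc (4 / 2 ^+ n).
Proof.
elim: n => [|n IH].
  rewrite expr0 divr1 -opprD normrN [1 + 1](_ : _ = rc 2); last by rewrite (@rc_nat R 2).
  by rewrite normr_rc -rcX ler_rc normr_nat -natrX ler_nat.
have h : 2 <= `|zeta n.+1 + 1| ^+ 2.
  have := sqr_normE (zeta n.+1); rewrite norm_zeta expr1n -rc1 => /rc_inj h1.
  have re1 : re (1 : C R) = 1 by []. have im1 : im (1 : C R) = 0 by [].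
  rewrite sqr_normE -(@rc_nat R 2) ler_rc reD imD re1 im1 addr0.
  have := re_half_sqrt (zeta n); rewrite -/(zeta n.+1) => h2.
  by rewrite sqrrD expr1n mulr1; move: h1 h2; set a := re (zeta _) ^+ 2; set b := _ ^+ 2; lra.
have e : `|zeta n - 1| ^+ 2 = `|zeta n.+1 - 1| ^+ 2 * `|zeta n.+1 + 1| ^+ 2.
  by rewrite -exprMn -normrM -subr_sqr_1 half_sqrtK.
rewrite e in IH.
have : `|zeta n.+1 - 1| ^+ 2 * 2 <= rc (4 / 2 ^+ n).
  by apply: le_trans IH; rewrite ler_wpM2l// exprn_ge0.
rewrite -ler_pdivlMr// => /le_trans; apply.
rewrite (_ : 4 / 2 ^+ n.+1 = 4 / 2 ^+ n / 2 :> R); last by rewrite exprS; field.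
by rewrite (rcM (4 / 2 ^+ n)) rcV (@rc_nat R 2).
Qed.

Lemma zeta_cvg (e : C R) : 0 < e -> exists m, forall n, (m <= n)%N -> `|zeta n - 1| < e.
Proof.
move=> e0; have e'0 : 0 < re e ^+ 2 by rewrite exprn_gt0// gt0_re.
exists (Num.truncn (4 / re e ^+ 2)).+1 => n hn.
rewrite -(@ltr_pXn2r _ 2) ?nnegrE ?normr_ge0 ?(ltW e0)//.
apply: le_lt_trans (zeta_close n) _; rewrite [e](ge0_rcE (ltW e0)) -rcX ltr_rc.
rewrite ltr_pdivrMr ?exprn_gt0// mulrC -ltr_pdivrMr//.
apply: lt_trans (truncnS_gt _) _; rewrite -natrX ltr_nat.
by apply: leq_ltn_trans hn _; exact: ltn_expl.
Qed.

Definition avg n f : C R := (zord n)%:R^-1 * \sum_(k < zord n) f (zeta n ^+ k).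

Lemma zord_neq0 n : (zord n)%:R != 0 :> C R.
Proof. by rewrite pnatr_eq0 -lt0n zord_gt0. Qed.

Lemma avg_le n f (B : C R) : (forall z, `|z| = 1 -> `|f z| <= B) -> `|avg n f| <= B.
Proof.
move=> h; rewrite /avg normrM normfV normr_nat ler_pdivrMl ?ltr0n ?zord_gt0//.
apply: le_trans (ler_norm_sum _ _ _) _.
rewrite mulr_natl -[X in _ *+ X]card_ord -sumr_const; apply: ler_sum => k _.
by apply: h; exact: norm_zetaX.
Qed.

Definition nonprincipal_def := ultraFilterLemma (@eventually_filter : ProperFilter \oo).
Definition nonprincipal : set_system nat := proj1_sig (cid nonprincipal_def).
Lemma nonprincipal_ultra : UltraFilter nonprincipal.
Proof. by rewrite /nonprincipal; case: cid => U []. Qed.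
Lemma nonprincipal_oo : \oo `<=` nonprincipal.
Proof. by rewrite /nonprincipal; case: cid => U []. Qed.
Instance nonprincipal_proper : ProperFilter nonprincipal.
Proof. exact: (@ultra_proper _ _ nonprincipal_ultra). Qed.

Definition circle_bound f (B : C R) := forall z, `|z| = 1 -> `|f z| <= B.

(** The mean over the unit circle, as the limit of the averages over roots of unity
    along an ultrafilter: it exists for all bounded functions, and is linear. *)
Definition mean f : C R := get [set l | avg ^~ f @ nonprincipal --> l].

Lemma mean_cvg f B : circle_bound f B -> avg ^~ f @ nonprincipal --> mean f.
Proof.
move=> fB.
have := @cdisc_compact R B; rewrite compact_ultra => /(_ (avg ^~ f @ nonprincipal)).
case.
- by apply: fmap_ultra; exact: nonprincipal_ultra.
- by rewrite /fmap/=; apply: (@filterE _ nonprincipal) => n /=; exact: avg_le.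
- move=> l [_ hl]; rewrite /mean; exact: (getI hl).
Qed.

Lemma mean_uniq f l : avg ^~ f @ nonprincipal --> l -> mean f = l.
Proof.
move=> h; have h' : avg ^~ f @ nonprincipal --> mean f
  by exact: (@getI _ [set l | avg ^~ f @ nonprincipal --> l] l h).
exact: (cvg_unique _ h' h).
Qed.

Lemma mean_lim f l : avg ^~ f @ \oo --> l -> mean f = l.
Proof. by move=> h; apply: mean_uniq => A /h; exact: nonprincipal_oo. Qed.

Lemma eq_mean f g : (forall z, `|z| = 1 -> f z = g z) -> mean f = mean g.
Proof.
move=> fg; have -> : mean f = get [set l | avg ^~ g @ nonprincipal --> l]; last by [].
rewrite /mean; suff -> : avg ^~ f = avg ^~ g by [].
apply/funext => n; rewrite /avg; congr (_ * _); apply: eq_bigr => k _.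
by rewrite fg// norm_zetaX.
Qed.

Lemma meanD f g B B' : circle_bound f B -> circle_bound g B' -> mean (fun z => f z + g z) = mean f + mean g.
Proof.
move=> hf hg; apply: mean_uniq.
have -> : avg ^~ (fun z => f z + g z) = (fun n => avg n f + avg n g).
  by apply/funext => n; rewrite /avg big_split mulrDr.
by apply: cvgD; [exact: mean_cvg hf|exact: mean_cvg hg].
Qed.

Lemma meanZ f B (c : C R) : circle_bound f B -> mean (fun z => c * f z) = c * mean f.
Proof.
move=> hf; apply: mean_uniq.
have -> : avg ^~ (fun z => c * f z) = (fun n => c * avg n f).
  by apply/funext => n; rewrite /avg -mulr_sumr mulrCA.
by apply: cvgM; [exact: cvg_cst|exact: mean_cvg hf].
Qed.

Lemma mean_le f B : circle_bound f B -> `|mean f| <= B.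
Proof.
move=> hf; apply: (@closed_cvg _ _ nonprincipal _ (avg ^~ f) (fun z : C R => `|z| <= B)).
- exact: closed_normC_le.
- by apply: (@filterE _ nonprincipal) => n; exact: avg_le.
- exact: mean_cvg hf.
Qed.

(** Cauchy's theorem on the unit circle: the average of [w * g (r * w)] is a
    Riemann sum of the increments of a primitive of [g] around the circle. *)
Lemma avg_primitive (g F : C R -> C R) (K : R) (r : C R) :
  0 < r -> (forall z, `|z| <= r -> {for z, continuous g}) ->
  (forall z, `|z| <= r -> box K z) ->
  (forall z z' c (eta : R), box K z -> box K z' ->
    (forall y, `|y - z| <= 2 * `|z' - z| -> `|g y - c| <= rc eta) ->
    `|F z' - F z - c * (z' - z)| <= rc (4 * eta) * `|z' - z|) ->
  avg ^~ (fun w => w * g (r * w)) @ \oo --> (0 : C R).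
Proof.
move=> r0 gc rK hF; apply: (@cvgrPdist_lt _ (C R) _ _ _ _ _).2 => e e0.
pose eta := re e / 8.
have eta0 : 0 < eta by rewrite divr_gt0// gt0_re.
have reta : 0 < rc eta by rewrite -rc0 ltr_rc.
have [d d0 hd] := unif_cont_disc gc reta.
have [m hm] := zeta_cvg (divr_gt0 d0 (mulr_gt0 (ltr0Sn (C R) 1) r0)).
exists m => // n mn; rewrite sub0r normrN.
pose N := zord n; pose w k : C R := r * zeta n ^+ k.
have wK k : `|w k| = r by rewrite normrM norm_zetaX mulr1 gtr0_norm.
have wS k : `|w k.+1 - w k| = r * `|zeta n - 1|.
  by rewrite /w exprSr -mulrBr -{2}[zeta n ^+ k]mulr1 -mulrBr !normrM norm_zetaX mul1r gtr0_norm.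
have S1 : \sum_(k < N) (F (w k.+1) - F (w k)) = 0.
  rewrite -(big_mkord xpredT (fun k => F (w k.+1) - F (w k))) telescope_sumr//.
  by rewrite /w zeta_ord expr0 subrr.
have E : N%:R * (r * (zeta n - 1)) * avg n (fun w => w * g (r * w)) =
    \sum_(k < N) (g (w k) * (w k.+1 - w k)).
  rewrite /avg -/N mulrACA divff ?zord_neq0// mul1r mulr_sumr.
  by apply: eq_bigr => k _; rewrite /w exprSr; ring.
have z1 : 0 < `|zeta n - 1| by rewrite normr_gt0 subr_eq0 zeta_neq1.
have N0 : 0 < N%:R :> C R by rewrite ltr0n zord_gt0.
have : `|N%:R * (r * (zeta n - 1)) * avg n (fun w => w * g (r * w))| <=
     N%:R * (r * `|zeta n - 1|) * rc (4 * eta).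
  have -> : N%:R * (r * (zeta n - 1)) * avg n (fun w => w * g (r * w)) =
      \sum_(k < N) (g (w k) * (w k.+1 - w k) - (F (w k.+1) - F (w k))).
    by rewrite E sumrB S1 subr0.
  apply: le_trans (ler_norm_sum _ _ _) _.
  rewrite -mulrA mulr_natl -[X in _ *+ X]card_ord -sumr_const; apply: ler_sum => k _.
  rewrite distrC; apply: le_trans (hF (w k) (w k.+1) (g (w k)) eta _ _ _) _;
    try by apply: rK; rewrite wK.
    2: by rewrite wS mulrC.
  move=> y hy; apply: hd; first by rewrite wK.
  apply: le_lt_trans hy _; rewrite wS mulrA -ltr_pdivlMl ?mulr_gt0// mulrC.
  exact: hm.
rewrite normrM normrM normr_nat normrM (gtr0_norm r0).
rewrite ler_pM2l; last by rewrite !mulr_gt0.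
move=> /le_lt_trans; apply; rewrite [ltRHS](ge0_rcE (ltW e0)) ltr_rc /eta.
by have := gt0_re e0; lra.
Qed.
End Mean.

(** * Cauchy's formula *)

Section Toolkit.
Context {K : numFieldType} {V : normedModType K}.
Implicit Types (f g : V -> K).
Lemma dfD f g x : differentiable f x -> differentiable g x ->
  differentiable (fun y => f y + g y) x.
Proof. exact: differentiableD. Qed.
Lemma dfB f g x : differentiable f x -> differentiable g x ->
  differentiable (fun y => f y - g y) x.
Proof. exact: differentiableB. Qed.
Lemma dfM f g x : differentiable f x -> differentiable g x ->
  differentiable (fun y => f y * g y) x.
Proof. exact: differentiableM. Qed.
Lemma dfV f x : differentiable f x -> f x != 0 -> differentiable (fun y => (f y)^-1) x.
Proof. exact: differentiableV. Qed.
Lemma dfc (W : normedModType K) (c : W) (x : V) : differentiable (fun _ : V => c) x.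
Proof. exact: differentiable_cst. Qed.
Lemma dfi (x : V) : differentiable (fun y : V => y) x.
Proof. exact: ex_diff. Qed.
End Toolkit.

Lemma compact_norm_bound (R : realType) (T : topologicalType) (A : set T) (h : T -> C R) :
  compact A -> (forall x, A x -> {for x, continuous h}) ->
  exists B : C R, forall x, A x -> `|h x| <= B.
Proof.
move=> /compact_near_coveringP/near_covering_withinP cA hc.
have [|B [_ hB]] := cA R (pinfty_nbhs R) (fun M x => `|h x| <= rc M) _.
  move=> x /hc /continuous_atP/(_ 1 ltr01) hx.
  exists ([set y | `|h x - h y| < 1], [set M | re `|h x| + 1 < M]).
    by split => //; exact: nbhs_pinfty_gt (num_real _).
  move=> [y M] [/= hy hM] _; rewrite -(subrK (h x) (h y)).
  apply: le_trans (ler_normD _ _) _; rewrite distrC addrC.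
  apply: le_trans (_ : rc (re `|h x| + 1) <= _); last by rewrite ler_rc ltW.
  by rewrite rcD -normE lerD2l rc1 ltW.
by exists (rc (B + 1)); apply: hB; rewrite ltrDl.
Qed.

Section Cauchy.
Context {R : realType}.
Implicit Types (f g : C R -> C R).

Section Clamp.
Variable K : R.
Hypothesis K0 : 0 < K.
Definition clamp1 (x : R) : R := Num.max (- K) (Num.min K x).
(** The retraction of the plane onto a box, which extends a function continuous on the
    box to a function continuous everywhere. *)
Definition clamp (z : C R) : C R := pt (clamp1 (re z)) (clamp1 (im z)).

Lemma clamp1_le x : `|clamp1 x| <= K.
Proof.
rewrite /clamp1 ler_norml le_max ge_max lexx /= ge_min lexx /= andbT.
by move: K0; lra.
Qed.
Lemma clamp1_id x : `|x| < K -> clamp1 x = x.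
Proof.
rewrite ltr_norml => /andP[h1 h2]; rewrite /clamp1 min_r ?ltW// max_r// ltW//.
Qed.
Lemma clamp_id z : box K z -> clamp z = z.
Proof. by move=> [h1 h2]; rewrite /clamp !clamp1_id// -ptE. Qed.
Lemma clamp1_continuous : continuous clamp1.
Proof.
move=> x; apply: (@continuous_max R R (fun=> - K) (fun x => Num.min K x) x).
  exact: cst_continuous.
by apply: (@continuous_min R R (fun=> K) id x); [exact: cst_continuous|exact: cvg_id].
Qed.
Lemma clamp_continuous : continuous clamp.
Proof.
have cre : continuous (rc \o (clamp1 \o re)).
  move=> z; apply: continuous_comp; last exact: continuous_rc.
  by apply: continuous_comp; [exact: continuous_re|exact: clamp1_continuous].
have cim : continuous (rc \o (clamp1 \o im)).
  move=> z; apply: continuous_comp; last exact: continuous_rc.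
  by apply: continuous_comp; [exact: continuous_im|exact: clamp1_continuous].
move=> z; have h1 : (fun z => rc (clamp1 (re z))) z @[z --> z] --> rc (clamp1 (re z)) by exact: cre.
have h2 : (fun z => rc (clamp1 (im z))) z @[z --> z] --> rc (clamp1 (im z)) by exact: cim.
exact: (cvgD h1 (cvgM (cvg_cst ci) h2)).
Qed.
Lemma norm_clamp z : `|clamp z| <= rc (2 * K).
Proof.
apply: le_trans (le_reim _) _; rewrite /clamp re_pt im_pt -rcD ler_rc.
by have := clamp1_le (re z); have := clamp1_le (im z); lra.
Qed.
Lemma box_open z : box K z -> \forall y \near z, box K y.
Proof.
move=> [h1 h2].
have h1' : \forall y \near z, `|re y| < K.
  have c : {for z, continuous (fun z : C R => `|re z|)}.
    by apply: (@continuous_comp _ _ _ re); [exact: continuous_re|exact: norm_continuous].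
  exact: (cvgr_lt _ c).
have h2' : \forall y \near z, `|im y| < K.
  have c : {for z, continuous (fun z : C R => `|im z|)}.
    by apply: (@continuous_comp _ _ _ im); [exact: continuous_im|exact: norm_continuous].
  exact: (cvgr_lt _ c).
by apply: filterS2 h1' h2' => y; split.
Qed.
End Clamp.

Lemma avg_cauchy f (r e : C R) : 0 < r -> `|e| <= r ->
  (forall z, `|z| < 4 * r -> {for z, continuous f}) ->
  (forall z, `|z| < 4 * r -> z != e -> differentiable f z) ->
  avg ^~ (fun w => w * f (r * w)) @ \oo --> (0 : C R).
Proof.
move=> r0 er fc fd.
pose K := re r * (3/2).
have rr := gt0_re r0.
have K0 : 0 < K by rewrite /K; lra.
have rE := ge0_rcE (ltW r0).
have in_box z : `|z| <= r -> box K z.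
  move=> zr; split; rewrite -ltr_rc.
    by apply: le_lt_trans (le_re z) _; apply: le_lt_trans zr _; rewrite rE ltr_rc /K; lra.
  by apply: le_lt_trans (le_im z) _; apply: le_lt_trans zr _; rewrite rE ltr_rc /K; lra.
have KE : rc (2 * K) < 4 * r.
  by rewrite rE -(@rc_nat R 4) -rcM ltr_rc /K; lra.
pose g := f \o clamp K.
have gc : continuous g.
  move=> z; apply: continuous_comp; first exact: clamp_continuous.
  by apply: fc; apply: le_lt_trans KE; exact: norm_clamp.
have box_lt z : box K z -> `|z| < 4 * r.
  by move=> hz; rewrite -(clamp_id hz); apply: le_lt_trans KE; exact: norm_clamp.
have gE z : box K z -> g z = f z by move=> hz; rewrite /g /= clamp_id.
have [U [V [hU hV]]] := prim_ex K gc.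
have [|F hF] := primitive gc hU hV (in_box e er).
  move=> z hz ze; have fz := fd z (box_lt z hz) ze.
  apply: (near_differentiable _ fz).1.
  by apply: filterS (box_open hz) => y /gE.
have -> : avg ^~ (fun w => w * f (r * w)) = avg ^~ (fun w => w * g (r * w)).
  apply/funext => n; rewrite /avg; congr (_ * _); apply: eq_bigr => k _.
  by rewrite gE//; apply: in_box; rewrite normrM norm_zetaX mulr1 gtr0_norm.
by apply: avg_primitive r0 _ in_box hF => z _; exact: gc.
Qed.

Lemma mean_cauchy f (r e : C R) : 0 < r -> `|e| <= r ->
  (forall z, `|z| < 4 * r -> {for z, continuous f}) ->
  (forall z, `|z| < 4 * r -> z != e -> differentiable f z) ->
  mean (fun w => w * f (r * w)) = 0.
Proof. by move=> *; apply: mean_lim; apply: avg_cauchy; eassumption. Qed.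

(** The conjugate of Cauchy's theorem, as conjugation is inversion on the circle. *)
Lemma mean_kernel (c : C R) : `|c| <= 4^-1 / 2 -> mean (fun w => w / (w - c)) = 1.
Proof.
move=> hc; pose h (w : C R) := c^* / (1 - c^* * w).
(* On the unit circle [w^-1] is the conjugate of [w], so that the kernel is [1] plus the
   conjugate of [w * h w], and [h] is holomorphic on a large disc. *)
have cJ : `|c^*| <= 4^-1 / 2 by rewrite norm_conjC.
have c1 w : `|w| < 4 * 1 -> 1 - c^* * w != 0.
  rewrite mulr1 => w4; rewrite subr_eq0; apply/eqP => E.
  have : `|c^* * w| < 1.
    rewrite normrM; apply: le_lt_trans (_ : 4^-1 / 2 * 4 < 1).
      by apply: ler_pM => //; exact: ltW.
    by rewrite mulrAC mulVf ?pnatr_eq0// mul1r invf_lt1// ltr1n.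
  by rewrite -E normr1 ltxx.
have dh w : `|w| < 4 * 1 -> differentiable h w.
  move=> /c1 n0; apply: dfM; first exact: dfc.
  by apply: dfV.
have := @avg_cauchy h 1 0 ltr01; rewrite normr0 => /(_ ler01).
move=> /(_ (fun w hw => differentiable_continuous (dh w hw)) (fun w hw _ => dh w hw)) H.
apply: mean_lim; apply: (@cvgrPdist_lt _ (C R) _ _ _ _ _).2 => e e0.
have /cvgrPdist_lt/(_ e e0) := H.
apply: filterS => n; rewrite sub0r normrN => he.
have -> : avg n (fun w => w / (w - c)) = 1 + (avg n (fun w => w * h (1 * w)))^*.
  rewrite /avg rmorphM fmorphV rmorph_nat rmorph_sum.
  have split1 (F : 'I_(zord n) -> C R) : 1 + (zord n)%:R^-1 * (\sum_(k < zord n) F k) =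
      (zord n)%:R^-1 * \sum_(k < zord n) (1 + F k).
    by rewrite big_split mulrDr sumr_const card_ord mulVf// zord_neq0.
  rewrite split1; congr (_ * _); apply: eq_bigr => k _ /=.
  set w := zeta n ^+ k; have w1 : `|w| = 1 by exact: norm_zetaX.
  have w0 : w != 0 by rewrite -normr_eq0 w1 oner_eq0.
  have wJ : w^* = w^-1 by rewrite invC_norm w1 expr1n invr1 mul1r.
  rewrite mul1r /h !(rmorphM, fmorphV, rmorphB, rmorph1) /= conjCK wJ.
  have wc : w - c != 0.
    rewrite subr_eq0; apply/eqP => wc; move: hc; rewrite -wc w1.
    by rewrite -invfM -natrM invf_ge1 ?ltr0n// lern1.
  have n1 : 1 - c * w^-1 != 0.
    by apply: contraNneq wc => /eqP; rewrite subr_eq0 => /eqP E; rewrite -[c](divfK w0) -E mul1r subrr.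
  by field; rewrite w0 wc.
by rewrite opprD addrA subrr sub0r normrN norm_conjC.
Qed.

(** Cauchy's theorem holds for the difference quotient of [f] at [z], which is
    continuous at [z] and holomorphic elsewhere. *)
Theorem cauchy_formula f (r z : C R) : 0 < r -> `|z| <= r / 8 ->
  (forall w, `|w| < 4 * r -> differentiable f w) ->
  mean (fun w => f (r * w) * (r * w / (r * w - z))) = f z.
Proof.
move=> r0 hz df.
have rn0 : r != 0 by rewrite gt_eqF.
have zr : `|z| <= r.
  by apply: le_trans hz _; rewrite ler_pdivrMr ?ltr0n// ler_peMr ?(ltW r0)// ler1n.
have z4 : `|z| < 4 * r.
  by apply: le_lt_trans zr _; rewrite ltr_pMl// ltr1n.
(* The difference quotient of [f] at [z]; the means of its Cauchy kernel split. *)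
pose g w := if w == z then 'd f z 1 else (f w - f z) / (w - z).
have gd w : `|w| < 4 * r -> w != z -> differentiable g w.
  move=> hw wz.
  have d1 : differentiable (fun w => (f w - f z) / (w - z)) w.
    apply: dfM; first by apply: dfB => //; exact: df.
    by apply: dfV => //; rewrite subr_eq0.
  apply: (near_differentiable _ d1).1.
  have : 0 < `|w - z| by rewrite normr_gt0 subr_eq0.
  move=> /(nbhs_ballC w); apply: filterS => y hy; rewrite /g ifF//; apply/negP => /eqP E.
  by move: hy; rewrite E /ball/= ltxx.
have gz : {for z, continuous g}.
  apply/continuous_atP => e e0.
  have [d d0 hd] := differentiable_eps (df z z4) (divr_gt0 e0 (ltr0Sn (C R) 1)).
  apply: filterS (nbhs_ballC z d0) => w; rewrite /ball /= => zw.
  rewrite /g eqxx; case: eqVneq => [_|wz]; first by rewrite subrr normr0.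
  have wz0 : 0 < `|w - z| by rewrite normr_gt0 subr_eq0.
  have := hd (w - z); rewrite distrC => /(_ zw); rewrite [z + _]addrC subrK.
  have -> : 'd f z (w - z) = (w - z) * 'd f z 1 by rewrite -[X in 'd f z X]mulr1 linearZ.
  move=> h; rewrite distrC.
  have -> : (f w - f z) / (w - z) - 'd f z 1 = (f w - f z - (w - z) * 'd f z 1) / (w - z).
    by field; rewrite subr_eq0.
  rewrite normrM normfV ltr_pdivrMr//; apply: le_lt_trans h _.
  by rewrite [`|z - w|]distrC ltr_pM2r// ltr_pdivrMr ?ltr0n// ltr_pMr// ltr1n.
have gc w : `|w| < 4 * r -> {for w, continuous g}.
  move=> hw; have [->//|wz] := eqVneq w z.
  exact: differentiable_continuous (gd w hw wz).
have := mean_cauchy r0 zr gc gd.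
have fb : exists B, forall w, `|w| = r -> `|f w| <= B.
  have [|B hB] := compact_norm_bound (@cdisc_compact R r) (h := f).
    move=> w /= wr; apply: differentiable_continuous; apply: df.
    by apply: le_lt_trans wr _; rewrite ltr_pMl// ltr1n.
  by exists B => w wr; apply: hB; rewrite /= wr.
have [B hB] := fb.
have rz w : `|w| = 1 -> r * (7 / 8) <= `|r * w - z|.
  move=> w1; apply: le_trans (lerB_dist _ _); rewrite normrM w1 mulr1 (gtr0_norm r0).
  rewrite lerBrDl -lerBrDr; apply: le_trans hz _.
  by rewrite le_eqVlt; apply/orP; left; apply/eqP; field.
have rz0 w : `|w| = 1 -> r * w - z != 0.
  by move=> /rz h; rewrite -normr_gt0; apply: lt_le_trans h; rewrite mulr_gt0// divr_gt0// ltr0n.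
have bk : circle_bound (fun w => r * w / (r * w - z)) (8 / 7).
  move=> w w1; rewrite normrM normfV normrM w1 mulr1 (gtr0_norm r0).
  rewrite ler_pdivrMr; last by rewrite normr_gt0 rz0.
  rewrite -ler_pdivrMl ?divr_gt0 ?ltr0n//; apply: le_trans (rz w w1).
  by rewrite le_eqVlt; apply/orP; left; apply/eqP; field.
have b1 : circle_bound (fun w => f (r * w) * (r * w / (r * w - z))) (B * (8 / 7)).
  move=> w w1; rewrite normrM; apply: ler_pM => //; last exact: bk.
  by apply: hB; rewrite normrM w1 mulr1 gtr0_norm.
have b2 : circle_bound (fun w => - f z * (r * w / (r * w - z))) (`|f z| * (8 / 7)).
  by move=> w w1; rewrite normrM normrN; apply: ler_pM => //; exact: bk.
have b0 : circle_bound (fun w => w * g (r * w)) (r^-1 * (B * (8/7) + `|f z| * (8 / 7))).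
  move=> w w1; rewrite [X in `|X|](_ : _ = r^-1 * (f (r * w) * (r * w / (r * w - z)) + - f z * (r * w / (r * w - z)))).
    rewrite normrM normfV (gtr0_norm r0) ler_pM2l ?invr_gt0//.
    by apply: le_trans (ler_normD _ _) _; apply: lerD; [exact: b1|exact: b2].
  have := rz0 w w1; rewrite /g subr_eq0 => h; rewrite (negbTE h); field.
  by rewrite rn0 subr_eq0 h.
move=> E; have : r * mean (fun w => w * g (r * w)) = 0 by rewrite E mulr0.
rewrite -(meanZ r b0).
have -> : mean (fun w => r * (w * g (r * w))) =
   mean (fun w => f (r * w) * (r * w / (r * w - z)) + - f z * (r * w / (r * w - z))).
  apply: eq_mean => w w1; have := rz0 w w1; rewrite /g subr_eq0 => h; rewrite (negbTE h); field.
  by rewrite subr_eq0 h.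
rewrite (meanD b1 b2) (meanZ (- f z) bk).
have -> : mean (fun w => r * w / (r * w - z)) = 1.
  rewrite -(@mean_kernel (z / r)).
    apply: eq_mean => w w1; have -> : w - z / r = (r * w - z) / r by field.
    by rewrite invf_div mulrA [w * r]mulrC.
  rewrite normrM normfV (gtr0_norm r0) ler_pdivrMr//; apply: le_trans hz _.
  by rewrite le_eqVlt; apply/orP; left; apply/eqP; field.
by move/eqP; rewrite mulr1 subr_eq0 => /eqP.
Qed.
End Cauchy.

(** * Taylor expansion in one variable *)

Section OneVar.
Context {R : realType}.
Variables (f : C R -> C R) (r B : C R).
Hypothesis r0 : 0 < r.
Hypothesis df : forall w, `|w| < 4 * r -> differentiable f w.
Hypothesis fB : forall w, `|w| < 4 * r -> `|f w| <= B.
Implicit Types z w : C R.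

Let rn0 : r != 0. Proof. by rewrite gt_eqF. Qed.
Let zr z : `|z| <= r / 8 -> `|z| <= r / 2.
Proof.
move/le_trans; apply; rewrite ler_pM2l// lef_pV2 ?posrE ?ltr0n//.
by rewrite ler_nat.
Qed.
Let nr w : `|w| = 1 -> `|r * w| = r.
Proof. by move=> w1; rewrite normrM w1 mulr1 gtr0_norm. Qed.
Let rw0 w : `|w| = 1 -> r * w != 0.
Proof. by move=> w1; rewrite -normr_gt0 nr. Qed.
Let rz z w : `|z| <= r / 8 -> `|w| = 1 -> r / 2 <= `|r * w - z|.
Proof.
move=> hz w1; apply: le_trans (lerB_dist _ _); rewrite nr//.
rewrite lerBrDl -lerBrDr; apply: le_trans (zr hz) _.
by rewrite le_eqVlt; apply/orP; left; apply/eqP; field.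
Qed.
Let rz0 z w : `|z| <= r / 8 -> `|w| = 1 -> r * w - z != 0.
Proof.
by move=> h1 h2; rewrite -normr_gt0; apply: lt_le_trans (rz h1 h2); rewrite divr_gt0// ltr0n.
Qed.
Let rzV z w : `|z| <= r / 8 -> `|w| = 1 -> `|(r * w - z)^-1| <= 2 / r.
Proof.
move=> h1 h2; rewrite normfV -[2 / r]invf_div lef_pV2 ?posrE; first exact: rz.
  by rewrite normr_gt0 rz0.
by rewrite divr_gt0// ltr0n.
Qed.
Let cB w : `|w| = 1 -> `|f (r * w)| <= B.
Proof. by move=> w1; apply: fB; rewrite nr// ltr_pMl// ltr1n. Qed.
Let B0 : 0 <= B.
Proof. by apply: le_trans (cB (normr1 _)). Qed.

(** Remainders of the Taylor expansion of [f] at 0, and its coefficients. *)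
Definition remainder m z := mean (fun w => f (r * w) * ((r * w) ^- m * (r * w / (r * w - z)))).
Definition coefficient m := mean (fun w => f (r * w) * (r * w) ^- m).

Let kernel_bound m z : `|z| <= r / 8 ->
  circle_bound (fun w => f (r * w) * ((r * w) ^- m * (r * w / (r * w - z)))) (B * (r ^- m * 2)).
Proof.
move=> hz w w1; rewrite normrM; apply: ler_pM => //; first exact: cB.
rewrite normrM normfV normrX nr//; apply: ler_pM => //.
  by rewrite invr_ge0 exprn_ge0// ltW.
rewrite normrM nr//; apply: le_trans (ler_wpM2l (ltW r0) (rzV hz w1)) _.
by rewrite mulrCA divff// mulr1.
Qed.
Let coef_bound m : circle_bound (fun w => f (r * w) * (r * w) ^- m) (B * r ^- m).
Proof.
move=> w w1; rewrite normrM normfV normrX nr//; apply: ler_pM => //; last exact: cB.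
by rewrite invr_ge0 exprn_ge0// ltW.
Qed.

Lemma remainder_le m z : `|z| <= r / 8 -> `|remainder m z| <= B * (r ^- m * 2).
Proof. by move=> hz; exact: mean_le (kernel_bound m hz). Qed.
Lemma coefficient_le m : `|coefficient m| <= B * r ^- m.
Proof. exact: mean_le (coef_bound m). Qed.

Lemma remainder0E z : `|z| <= r / 8 -> remainder 0 z = f z.
Proof.
move=> hz; rewrite -(cauchy_formula r0 hz df) /remainder; apply: eq_mean => w w1.
by rewrite expr0 invr1 mul1r.
Qed.

Lemma remainderS m z : `|z| <= r / 8 ->
  remainder m z = coefficient m + z * remainder m.+1 z.
Proof.
move=> hz; rewrite /remainder /coefficient -(meanZ z (kernel_bound m.+1 hz)).
have b : circle_bound (fun w => z * (f (r * w) * ((r * w) ^- m.+1 * (r * w / (r * w - z)))))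
    (`|z| * (B * (r ^- m.+1 * 2))).
  by move=> w w1; rewrite normrM ler_wpM2l//; exact: kernel_bound.
rewrite -(meanD (coef_bound m) b); apply: eq_mean => w w1.
have h1 := rw0 w1; have h2 := rz0 hz w1.
move: h1 h2; set a := r * w => h1 h2; rewrite exprS.
by field; rewrite h1 h2 expf_neq0.
Qed.

Lemma taylor0 z : `|z| <= r / 8 -> f z = coefficient 0 + z * remainder 1 z.
Proof. by move=> hz; rewrite -remainderS// remainder0E. Qed.

Lemma coefficient0E : coefficient 0 = f 0.
Proof.
have h : `|0 : C R| <= r / 8 by rewrite normr0 divr_ge0// ltW.
by rewrite (taylor0 h) mul0r addr0.
Qed.

Lemma first_order z : `|z| <= r / 8 -> `|f z - f 0| <= `|z| * (B * (r^-1 * 2)).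
Proof.
move=> hz; rewrite (taylor0 hz) coefficient0E addrC addKr normrM ler_wpM2l//.
exact: remainder_le.
Qed.

Lemma second_order z : `|z| <= r / 8 ->
  `|f z - f 0 - z * coefficient 1| <= `|z| ^+ 2 * (B * (r ^- 2 * 2)).
Proof.
move=> hz; rewrite (taylor0 hz) coefficient0E (remainderS 1 hz).
rewrite (_ : _ - _ - _ = z ^+ 2 * remainder 2 z); last by ring.
by rewrite normrM normrX ler_wpM2l ?exprn_ge0//; exact: remainder_le.
Qed.

(** Both sides are limits of the difference quotients of [f] at 0. *)
Lemma coefficient1E : coefficient 1 = 'd f 0 1.
Proof.
apply/eqP; rewrite -subr_eq0; apply/negPn/negP; rewrite -normr_gt0 => n0.
set n := `| _ | in n0.
have f0 : differentiable f 0 by apply: df; rewrite normr0 mulr_gt0// ltr0n.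
have [d d0 hd] := differentiable_eps f0 (divr_gt0 n0 (ltr0Sn (C R) 3)).
pose Q := B * (r ^- 2 * 2) + 1.
have Q0 : 0 < Q.
  by rewrite ltr_wpDl// mulr_ge0// mulr_ge0// invr_ge0 exprn_ge0// ltW.
have [m1 m10 [md mr]] := pos_min2 d0 (divr_gt0 r0 (ltr0Sn (C R) 7)).
have [m2 m20 [m21 m2Q]] := pos_min2 m10 (divr_gt0 (divr_gt0 n0 (ltr0Sn (C R) 3)) Q0).
pose z := m2 / 2.
have z0 : 0 < z by rewrite divr_gt0// ltr0n.
have zm : z < m2 by rewrite ltr_pdivrMr ?ltr0n// ltr_pMr// ltr1n.
have nz : `|z| = z by rewrite gtr0_norm.
have z8 : `|z| <= r / 8 by rewrite nz; apply: le_trans (ltW zm) _; apply: le_trans m21 _.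
have := second_order z8; have := hd z.
rewrite add0r nz => /(_ (lt_le_trans zm (le_trans m21 md))) h1 h2.
have : z * n <= n / 4 * z + z ^+ 2 * (B * (r ^- 2 * 2)).
  have -> : z * n = `|(f z - f 0 - 'd f 0 z) - (f z - f 0 - z * coefficient 1)|.
    have -> : 'd f 0 z = z * 'd f 0 1 by rewrite -[X in 'd f 0 X]mulr1 linearZ.
    by rewrite -{1}nz -normrM; apply: congr1; ring.
  by apply: le_trans (ler_normB _ _) _; apply: lerD.
have zQ : z ^+ 2 * (B * (r ^- 2 * 2)) <= n / 4 * z.
  apply: le_trans (_ : z * (z * Q) <= _).
    rewrite expr2 -mulrA ler_pM2l// ler_pM2l//; by rewrite lerDl.
  rewrite [leRHS]mulrC ler_pM2l//.
  by rewrite -ler_pdivlMr//; apply: le_trans (ltW zm) _.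
move=> /le_trans /(_ (lerD (lexx _) zQ)).
rewrite [z * n]mulrC -mulrDl ler_pM2r// (_ : n / 4 + n / 4 = n / 2); last by field.
move=> h; have n2 : n / 2 < n by rewrite ltr_pdivrMr ?ltr0n// ltr_pMr// ltr1n.
by have := le_lt_trans h n2; rewrite ltxx.
Qed.

(** If all coefficients vanish, [f z] is [z ^+ m] times a remainder of size [r ^- m]
    for all [m], hence 0.  Otherwise the remainder at the first nonzero coefficient
    has this coefficient as value at 0. *)
Lemma order_dichotomy :
  (forall z, `|z| <= r / 8 -> f z = 0) \/
  (exists m, remainder m 0 != 0 /\ forall z, `|z| <= r / 8 -> f z = z ^+ m * remainder m z).
Proof.
have lead m z : `|z| <= r / 8 -> (forall j, (j < m)%N -> coefficient j = 0) -> f z = z ^+ m * remainder m z.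
  move=> hz; elim: m => [|m IH] h; first by rewrite expr0 mul1r remainder0E.
  rewrite IH => [|j jm]; last by apply: h; exact: ltnW.
  by rewrite remainderS// h// add0r mulrA -exprSr.
have [[m cm]|nc] := pselect (exists m, coefficient m != 0).
  right; have ex : exists m, coefficient m != 0 by exists m.
  case: (ex_minnP ex) => {cm}m cm hm; exists m; split.
    by rewrite remainderS ?mul0r ?addr0// normr0 divr_ge0// ltW.
  move=> z hz; apply: lead => // j jm; apply/eqP/negPn/negP => /hm.
  by rewrite leqNgt jm.
left => z hz; have c0 j : coefficient j = 0.
  by apply/eqP/negPn/negP => cj; apply: nc; exists j.
apply/eqP/negPn/negP; rewrite -normr_gt0 => fz.
have Hm m : `|f z| <= (1/2) ^+ m * (B * 2).
  rewrite (lead m z hz) => [|j _]; last exact: c0.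
  rewrite normrM normrX; apply: le_trans (ler_wpM2l (exprn_ge0 _ _) (remainder_le m hz)) _ => //.
  rewrite mulrCA [leRHS]mulrCA ler_wpM2l// mulrA ler_wpM2r// -exprVn -exprMn.
  by rewrite lerXn2r ?nnegrE ?mulr_ge0 ?invr_ge0 ?(ltW r0)// ler_pdivrMr// mulrC mulrA mulr1; exact: zr.
have B20 : 0 < B * 2.
  by have := lt_le_trans fz (Hm 0%N); rewrite expr0 mul1r.
pose q := `|f z| / (B * 2).
have q0 : 0 < q by rewrite divr_gt0.
have [n hn] : exists n, (1/2 : C R) ^+ n < q.
  have [k hk] : exists k : nat, re q^-1 < k%:R.
    by exists (Num.truncn (re q^-1)).+1; exact: truncnS_gt.
  exists k; rewrite div1r exprVn -[ltRHS]invrK ltf_pV2 ?posrE ?invr_gt0// ?exprn_gt0//.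
  rewrite [ltLHS]ge0_rcE ?invr_ge0 ?ltW//.
  apply: lt_trans (_ : rc k%:R < _); first by rewrite ltr_rc.
  by rewrite rc_nat -natrX ltr_nat ltn_expl.
have := Hm n; rewrite -ler_pdivrMr// => /le_lt_trans /(_ hn).
by rewrite ltxx.
Qed.
End OneVar.

(** * Holomorphic functions on a normed space *)

Section Holo.
Context {R : realType} {V : normedModType (C R)}.
Implicit Types (h : V -> C R) (x y v : V).

Lemma diff_line h x y (t0 : C R) : differentiable h (x + t0 *: y) ->
  differentiable (fun t : C R => h (x + t *: y)) t0 /\
  'd (fun t : C R => h (x + t *: y)) t0 1 = 'd h (x + t0 *: y) y.
Proof.
move=> dh.
have da : is_diff t0 (fun t : C R => x + t *: y) (fun t => t *: y).
  apply: is_diff_eq; apply/funext => t. exact: add0r.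
have dg : differentiable (fun t : C R => x + t *: y) t0 by exact: ex_diff.
split; first exact: (differentiable_comp dg dh).
have -> : (fun t : C R => h (x + t *: y)) = h \o (fun t : C R => x + t *: y) by [].
by rewrite diff_comp//= diff_val scale1r.
Qed.

Section Ball.
Variables (h : V -> C R) (x : V) (rho B : C R).
Hypothesis rho0 : 0 < rho.
Hypothesis dh : forall y, `|y - x| < rho -> differentiable h y.
Hypothesis hB : forall y, `|y - x| < rho -> `|h y| <= B.

Let B0 : 0 <= B.
Proof. by apply: le_trans (hB (y := x) _); rewrite ?subrr ?normr0. Qed.

Let in_ball v (r w : C R) : 0 < r -> 4 * r * `|v| <= rho -> `|w| < 4 * r -> `|x + w *: v - x| < rho.
Proof.
move=> r0 rv wr; rewrite addrAC subrr add0r normrZ.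
have [->|v0] := eqVneq v 0; first by rewrite normr0 mulr0.
by apply: lt_le_trans rv; rewrite ltr_pM2r// normr_gt0.
Qed.
Let dline v (r w : C R) : 0 < r -> 4 * r * `|v| <= rho -> `|w| < 4 * r ->
  differentiable (fun t : C R => h (x + t *: v)) w.
Proof. by move=> r0 rv wr; apply: (diff_line (dh (in_ball r0 rv wr))).1. Qed.
Let bline v (r w : C R) : 0 < r -> 4 * r * `|v| <= rho -> `|w| < 4 * r ->
  `|h (x + w *: v)| <= B.
Proof. by move=> r0 rv wr; apply: hB; exact: (in_ball r0 rv wr). Qed.

Let d0line v : 'd (fun t : C R => h (x + t *: v)) 0 1 = 'd h x v.
Proof.
have hx : differentiable h (x + 0 *: v) by rewrite scale0r addr0; apply: dh; rewrite subrr normr0.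
by rewrite (diff_line hx).2 scale0r addr0.
Qed.

(** Cauchy's formula for the derivative, on a line. *)
Lemma diff_mean v (r : C R) : 0 < r -> 4 * r * `|v| <= rho ->
  'd h x v = mean (fun w => h (x + (r * w) *: v) * (r * w)^-1).
Proof.
move=> r0 rv; rewrite -d0line.
by rewrite -(coefficient1E r0 (fun w => dline r0 rv (w := w)) (fun w => bline r0 rv (w := w))).
Qed.

Let radius (y : V) : y != 0 -> 0 < rho / (4 * `|y|) /\ 4 * (rho / (4 * `|y|)) * `|y| <= rho.
Proof.
move=> y0; have n0 : 0 < `|y| by rewrite normr_gt0.
split; first by rewrite divr_gt0// mulr_gt0// ltr0n.
by rewrite le_eqVlt; apply/orP; left; apply/eqP; field; rewrite gt_eqF.
Qed.

Lemma diff_bound v : `|'d h x v| <= `|v| * (B * (4 / rho)).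
Proof.
have [->|v0] := eqVneq v 0.
  by rewrite linear0 !normr0 mul0r.
have [r0 rv] := radius v0; have n0 : 0 < `|v| by rewrite normr_gt0.
rewrite -d0line -(coefficient1E r0 (fun w => dline r0 rv (w := w)) (fun w => bline r0 rv (w := w))).
apply: le_trans (coefficient_le r0 (fun w => bline r0 rv (w := w)) 1) _.
rewrite expr1 invf_div le_eqVlt; apply/orP; left; apply/eqP; field.
by rewrite gt_eqF.
Qed.

Let one_small (y : V) : y != 0 -> `|y| <= rho / 32 -> `|1 : C R| <= rho / (4 * `|y|) / 8.
Proof.
move=> y0 hy; have n0 : 0 < `|y| by rewrite normr_gt0.
rewrite normr1 -mulrA -invfM ler_pdivlMr ?mulr_gt0 ?ltr0n// mul1r.
have -> : 4 * `|y| * 8 = `|y| * 32 by ring.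
by rewrite -ler_pdivlMr ?ltr0n.
Qed.

Lemma lipschitz_bound y : `|y| <= rho / 32 -> `|h (x + y) - h x| <= `|y| * (B * (8 / rho)).
Proof.
have [->|y0] := eqVneq y 0.
  by rewrite addr0 subrr !normr0 mul0r.
move=> hy; have [r0 rv] := radius y0; have n0 : 0 < `|y| by rewrite normr_gt0.
have := first_order r0 (fun w => dline r0 rv (w := w)) (fun w => bline r0 rv (w := w)) (one_small y0 hy).
rewrite scale1r scale0r addr0 normr1 mul1r => /le_trans; apply.
rewrite invf_div le_eqVlt; apply/orP; left; apply/eqP; field.
by rewrite gt_eqF.
Qed.

Lemma taylor_bound y : `|y| <= rho / 32 ->
  `|h (x + y) - h x - 'd h x y| <= `|y| ^+ 2 * (B * (32 / rho ^+ 2)).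
Proof.
have [->|y0] := eqVneq y 0.
  by rewrite addr0 subrr linear0 subr0 !normr0 expr0n mul0r.
move=> hy; have [r0 rv] := radius y0; have n0 : 0 < `|y| by rewrite normr_gt0.
have := second_order r0 (fun w => dline r0 rv (w := w)) (fun w => bline r0 rv (w := w)) (one_small y0 hy).
rewrite (coefficient1E r0 (fun w => dline r0 rv (w := w)) (fun w => bline r0 rv (w := w))) d0line.
rewrite scale1r scale0r addr0 normr1 mul1r expr1n mul1r => /le_trans; apply.
rewrite le_eqVlt; apply/orP; left; apply/eqP; field.
by rewrite !gt_eqF// divr_gt0// mulr_gt0// ltr0n.
Qed.
End Ball.

(** A mean of uniformly bounded holomorphic functions is holomorphic: the
    Taylor estimate is uniform. *)
Lemma mean_differentiable (G : C R -> V -> C R) (x0 : V) (rho B : C R) : 0 < rho ->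
  (forall w y, `|w| = 1 -> `|y - x0| < rho -> differentiable (G w) y) ->
  (forall w y, `|w| = 1 -> `|y - x0| < rho -> `|G w y| <= B) ->
  forall x, `|x - x0| < rho / 2 -> differentiable (fun y => mean (fun w => G w y)) x.
Proof.
move=> rho0 dG hB x hx.
have r20 : 0 < rho / 2 by rewrite divr_gt0// ltr0n.
have near0 y : `|y - x| < rho / 2 -> `|y - x0| < rho.
  move=> hy; rewrite -(subrKA x) (splitr rho); apply: le_lt_trans (ler_normD _ _) _.
  exact: ltrD.
have dG' w y : `|w| = 1 -> `|y - x| < rho / 2 -> differentiable (G w) y.
  by move=> w1 /near0; exact: dG.
have hB' w y : `|w| = 1 -> `|y - x| < rho / 2 -> `|G w y| <= B.
  by move=> w1 /near0; exact: hB.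
pose L v := mean (fun w => 'd (G w) x v).
have bL v : circle_bound (fun w => 'd (G w) x v) (`|v| * (B * (4 / (rho / 2)))).
  move=> w w1; apply: (@diff_bound (G w) x (rho / 2) B r20) => y; [exact: dG'|exact: hB'].
have dGx w : `|w| = 1 -> differentiable (G w) x.
  by move=> w1; apply: dG' => //; rewrite subrr normr0.
have Llin : linear L.
  move=> a u v; rewrite /L.
  rewrite -[a *: mean _]/(a * mean (fun w => 'd (G w) x u)) -(meanZ a (bL u)).
  have bZ : circle_bound (fun w => a * 'd (G w) x u) (`|a| * (`|u| * (B * (4 / (rho / 2))))).
    by move=> w w1; rewrite normrM ler_wpM2l//; exact: bL.
  rewrite -(meanD bZ (bL v)); apply: eq_mean => w w1.
  by rewrite linearP.
pose Lm := GRing.isLinear.Build _ _ _ _ L Llin.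
pose LL : {linear V -> C R} := HB.pack L Lm.
have bL' v : `|LL v| <= `|v| * (B * (4 / (rho / 2))) by exact: mean_le (bL v).
have B0 : 0 <= B by apply: le_trans (hB 1 x0 _ _); rewrite ?normr1 ?subrr ?normr0.
have LC : continuous LL.
  move=> v; apply/continuous_atP => e e0.
  pose M := B * (4 / (rho / 2)) + 1.
  have M0 : 0 < M by rewrite ltr_wpDl// mulr_ge0// divr_ge0// ltW.
  apply/nbhs_normP; exists (e / M) => /=; first by rewrite divr_gt0.
  move=> y hy; have E : LL v - LL y = LL (v - y) by rewrite linearB.
  rewrite -[X in X < _]/(`|LL v - LL y|) E; apply: le_lt_trans (bL' _) _.
  apply: le_lt_trans (_ : `|v - y| * M < _); last by rewrite -ltr_pdivlMr.
  by rewrite ler_wpM2l// lerDl.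
apply: (@eps_differentiable _ _ _ _ _ LL LC _).1 => e e0.
pose Q := B * (32 / (rho / 2) ^+ 2) + 1.
have Q0 : 0 < Q by rewrite ltr_wpDl// mulr_ge0// divr_ge0// exprn_ge0// ltW.
have [m m0 [md mr]] := pos_min2 (divr_gt0 e0 Q0) (divr_gt0 r20 (ltr0Sn (C R) 31)).
exists m => // y hy.
have y32 : `|y| <= rho / 2 / 32 by apply/ltW/lt_le_trans/mr.
have yr : `|(x + y) - x| < rho / 2.
  rewrite addrAC subrr add0r; apply: le_lt_trans y32 _.
  by rewrite ltr_pdivrMr ?ltr0n// ltr_pMr// ltr1n.
have b1 : circle_bound (fun w => G w (x + y)) B by move=> w w1; exact: hB'.
have b2 : circle_bound (fun w => -1 * G w x) B.
  by move=> w w1; rewrite mulN1r normrN; apply: hB' => //; rewrite subrr normr0.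
have b2' : circle_bound (fun w => G w x) B.
  by move=> w w1; apply: hB' => //; rewrite subrr normr0.
have b3 : circle_bound (fun w => -1 * 'd (G w) x y) (`|y| * (B * (4 / (rho / 2)))).
  by move=> w w1; rewrite mulN1r normrN; exact: bL.
have b12 : circle_bound (fun w => G w (x + y) + -1 * G w x) (B + B).
  by move=> w w1; apply: le_trans (ler_normD _ _) _; apply: lerD; [exact: b1|exact: b2].
have -> : mean (fun w => G w (x + y)) - mean (fun w => G w x) - LL y =
    mean (fun w => G w (x + y) + -1 * G w x + -1 * 'd (G w) x y).
  by rewrite (meanD b12 b3) (meanD b1 b2) (meanZ _ b2') (meanZ _ (bL y)) !mulN1r.
apply: le_trans (_ : `|y| ^+ 2 * (B * (32 / (rho / 2) ^+ 2)) <= _).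
  apply: mean_le => w w1; rewrite !mulN1r.
  exact: (taylor_bound r20 (fun z => dG' w z w1) (fun z => hB' w z w1) y32).
apply: le_trans (_ : `|y| ^+ 2 * Q <= _); first by rewrite ler_wpM2l ?exprn_ge0// lerDl.
rewrite expr2 -mulrA mulrC ler_wpM2r// -ler_pdivlMr//.
exact: le_trans (ltW hy) md.
Qed.

Definition hol h x := \forall y \near x, differentiable h y.

Lemma hol_diff h x : hol h x -> differentiable h x.
Proof. exact: nbhs_singleton. Qed.

Lemma hol_near h x : hol h x -> \forall y \near x, hol h y.
Proof. by move/nbhs_interior. Qed.

Lemma hol_cont h x : hol h x -> {for x, continuous h}.
Proof. by move/hol_diff/differentiable_continuous. Qed.

Lemma hol_ball h x : hol h x -> exists rho B : C R, [/\ 0 < rho,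
  forall y, `|y - x| < rho -> differentiable h y &
  forall y, `|y - x| < rho -> `|h y| <= B].
Proof.
move=> hh; have /continuous_atP/(_ 1 ltr01)/nbhs_normP[r1 /= r10 h1] := hol_cont hh.
have /nbhs_normP[r2 /= r20 h2] := hh.
have [m m0 [m1 m2]] := pos_min2 r10 r20.
exists m, (`|h x| + 1); split => // y; rewrite distrC => hy.
  by apply: h2; exact: lt_le_trans m2.
have := h1 y (lt_le_trans hy m1) => /= h3.
rewrite -(subrK (h x) (h y)) addrC; apply: le_trans (ler_normD _ _) _.
by rewrite lerD2l distrC ltW.
Qed.

(** A derivative is a mean of values of the function on a circle. *)
Lemma hol_derive h x v : hol h x -> hol (fun y => 'D_v h y) x.
Proof.
move=> /hol_ball[rho [B [rho0 dh hB]]].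
have r20 : 0 < rho / 2 by rewrite divr_gt0// ltr0n.
pose r := rho / 2 / (4 * (`|v| + 1)).
have v1 : 0 < `|v| + 1 by rewrite ltr_wpDl.
have r0 : 0 < r by rewrite divr_gt0// mulr_gt0// ltr0n.
have rv : 4 * r * `|v| <= rho / 2.
  rewrite (_ : _ * _ = rho / 2 * (`|v| / (`|v| + 1))); last by rewrite /r; field; rewrite gt_eqF.
  by rewrite ler_piMr ?(ltW r20)// ler_pdivrMr// mul1r lerDl.
have rv' : r * `|v| < rho / 2.
  have [->|v0] := eqVneq v 0; first by rewrite normr0 mulr0.
  apply: lt_le_trans rv; by rewrite ltr_pM2r ?normr_gt0// ltr_pMl// ltr1n.
have near0 y z : `|y - x| < rho / 2 -> `|z - y| < rho / 2 -> `|z - x| < rho.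
  move=> h1 h2; rewrite -(subrKA y) (splitr rho); apply: le_lt_trans (ler_normD _ _) _.
  exact: ltrD.
pose G w y := h (y + (r * w) *: v) * (r * w)^-1.
have rwv w : `|w| = 1 -> `|(r * w) *: v| = r * `|v|.
  by move=> w1; rewrite normrZ normrM w1 mulr1 gtr0_norm.
have inb w y : `|w| = 1 -> `|y - x| < rho / 2 -> `|y + (r * w) *: v - x| < rho.
  move=> w1 hy; apply: (near0 _ _ hy).
  rewrite addrAC subrr add0r rwv//.
have dG : forall y, `|y - x| < rho / 2 / 2 -> differentiable (fun y => mean (fun w => G w y)) y.
  apply: (@mean_differentiable G x (rho / 2) (B * r^-1)) => // w y w1 hy.
    apply: dfM; last exact: dfc.
    have d1 : differentiable (fun y => y + (r * w) *: v) y.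
      exact: (differentiableD (dfi y) (dfc _ y)).
    by apply: (@differentiable_comp _ _ _ _ (fun y => y + (r * w) *: v) h) => //; apply: dh; exact: inb.
  rewrite normrM normfV normrM w1 mulr1 (gtr0_norm r0) ler_wpM2r ?invr_ge0 ?(ltW r0)//.
  by apply: hB; exact: inb.
have r40 : 0 < rho / 2 / 2 by rewrite divr_gt0// ltr0n.
have E y : `|y - x| < rho / 2 -> 'D_v h y = mean (fun w => G w y).
  move=> hy; rewrite deriveE; last first.
    by apply: dh; apply: lt_trans hy _; rewrite ltr_pdivrMr ?ltr0n// ltr_pMr// ltr1n.
  rewrite (@diff_mean h y (rho / 2) B r20 _ _ v r)// => z hz.
    by apply: dh; exact: near0 hz.
  by apply: hB; exact: near0 hz.
have nE : \forall y \near x, \forall z \near y, mean (fun w => G w z) = 'D_v h z.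
  have nb : \forall y \near x, mean (fun w => G w y) = 'D_v h y.
    apply/nbhs_normP; exists (rho / 2) => // y /=; rewrite distrC => /E ->//.
  by move/nbhs_interior : nb.
have nD : \forall y \near x, differentiable (fun y => mean (fun w => G w y)) y.
  apply/nbhs_normP; exists (rho / 2 / 2) => // y /=; rewrite distrC; exact: dG.
by apply: filterS2 nE nD => y h1 h2; exact: (near_differentiable h1 h2).1.
Qed.
End Holo.

(** * Identity theorem, linear differential equations, division *)

Section Dist.
Context {K : numFieldType} {V : normedModType K}.
Lemma nbhs_dist (x : V) (P : set V) : nbhs x P ->
  exists2 d : K, 0 < d & forall y, `|y - x| < d -> P y.
Proof.
move=> xP; have /nbhs_normP[d /= d0 hd] : \forall y \near x, P y by [].
by exists d => // y; rewrite distrC => /hd.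
Qed.
Lemma dist_nbhs (x : V) (P : set V) (d : K) : 0 < d ->
  (forall y, `|y - x| < d -> P y) -> nbhs x P.
Proof.
move=> d0 hd; suff : \forall y \near x, P y by [].
by apply/nbhs_normP; exists d => // y /=; rewrite distrC => /hd.
Qed.
End Dist.

Section HolTools.
Context {R : realType} {V : normedModType (C R)}.
Implicit Types (h g f : V -> C R) (x y q v : V).

Lemma hol_eq h g x : (\forall y \near x, h y = g y) -> hol h x -> hol g x.
Proof.
move=> /nbhs_interior hg hh; apply: filterS2 hg hh => y h1 h2.
exact: (near_differentiable h1 h2).1.
Qed.
Lemma hol_cst (c : C R) x : hol (fun=> c) x.
Proof. by apply: nearW => y; exact: dfc. Qed.
Lemma holD h g x : hol h x -> hol g x -> hol (fun y => h y + g y) x.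
Proof. by apply: filterS2 => y; exact: dfD. Qed.
Lemma holB h g x : hol h x -> hol g x -> hol (fun y => h y - g y) x.
Proof. by apply: filterS2 => y; exact: dfB. Qed.
Lemma holM h g x : hol h x -> hol g x -> hol (fun y => h y * g y) x.
Proof. by apply: filterS2 => y; exact: dfM. Qed.
Lemma holX h x n : hol h x -> hol (fun y => h y ^+ n) x.
Proof.
move=> hh; elim: n => [|n IH]; first exact: (hol_cst 1).
apply: (hol_eq _ (holM hh IH)); apply: nearW => y; by rewrite exprS.
Qed.
Lemma cont_neq0 h x : {for x, continuous h} -> h x != 0 -> \forall y \near x, h y != 0.
Proof.
move=> /continuous_atP hc h0; have n0 : 0 < `|h x| by rewrite normr_gt0.
apply: filterS (hc _ n0) => y hy; apply: contraTneq hy => ->.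
by rewrite subr0 ltxx.
Qed.
Lemma hol_neq0 h x : hol h x -> h x != 0 -> \forall y \near x, h y != 0.
Proof. by move/hol_cont; exact: cont_neq0. Qed.
Lemma holV h x : hol h x -> h x != 0 -> hol (fun y => (h y)^-1) x.
Proof.
by move=> hh h0; apply: filterS2 hh (hol_neq0 hh h0) => y; exact: dfV.
Qed.

Lemma deD h g x v : differentiable h x -> differentiable g x ->
  'D_v (fun y => h y + g y) x = 'D_v h x + 'D_v g x.
Proof. by move=> dh dg; apply: deriveD; exact: diff_derivable. Qed.
Lemma deB h g x v : differentiable h x -> differentiable g x ->
  'D_v (fun y => h y - g y) x = 'D_v h x - 'D_v g x.
Proof. by move=> dh dg; apply: deriveB; exact: diff_derivable. Qed.
Lemma deM h g x v : differentiable h x -> differentiable g x ->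
  'D_v (fun y => h y * g y) x = h x * 'D_v g x + g x * 'D_v h x.
Proof. by move=> dh dg; apply: deriveM; exact: diff_derivable. Qed.
Lemma de_cst (c : C R) x v : 'D_v (fun _ : V => c) x = 0.
Proof. exact: derive_cst. Qed.

Definition nz h x := ~ (\forall y \near x, h y = 0).

Lemma nzP h x : nz h x -> forall P : set V, (\forall y \near x, P y) -> exists2 y, P y & h y != 0.
Proof.
move=> hx P Px; apply: contrapT => no; apply: hx; apply: filterS Px => y Py.
by apply/eqP/negPn/negP => hy; apply: no; exists y.
Qed.

Lemma neq0_nz h x : h x != 0 -> nz h x.
Proof. by move=> h0 /nbhs_singleton /eqP; rewrite (negbTE h0). Qed.

(** The points where [h] does not vanish are dense near [x]. *)
Lemma dense_eq h f g x : nz h x -> {for x, continuous f} -> {for x, continuous g} ->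
  (\forall y \near x, h y != 0 -> f y = g y) -> f x = g x.
Proof.
move=> hx fc gc fg; apply/eqP; rewrite -subr_eq0; apply/negPn/negP => ne.
have c : {for x, continuous (fun y => f y - g y)} by exact: (cvgB fc gc).
have n0 := cont_neq0 c ne.
have [y [h1 h2] h3] := nzP hx (filterI fg n0).
by move: h2; rewrite h1// subrr eqxx.
Qed.
End HolTools.

Lemma hol_comp (R : realType) (V W : normedModType (C R)) (phi : W -> V) (h : V -> C R) (x : W) :
  (forall y, differentiable phi y) -> hol h (phi x) -> hol (h \o phi) x.
Proof.
move=> dphi hh; have c : {for x, continuous phi} by exact: differentiable_continuous.
have H : \forall y \near x, differentiable h (phi y) by exact: (c _ hh).
by apply: filterS H => y dh; exact: differentiable_comp.
Qed.

Lemma hol_line (R : realType) (V : normedModType (C R)) (h : V -> C R) (x v : V) (t : C R) :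
  hol h (x + t *: v) -> hol (fun s : C R => h (x + s *: v)) t.
Proof.
move=> hh; apply: (@hol_comp R V (C R) (fun s : C R => x + s *: v)) hh => s.
exact: ex_diff.
Qed.

Section OneVarTools.
Context {R : realType}.
Implicit Types (k : C R -> C R) (z : C R).

Lemma hol_id z : hol (fun w : C R => w) z.
Proof.
suff : \forall y \near z, differentiable (fun w : C R => w) y by [].
by near=> y; exact: dfi.
Unshelve. all: by end_near. Qed.

Lemma disc_bounded k (r : C R) : (forall z, `|z| <= r -> differentiable k z) ->
  exists B, forall z, `|z| <= r -> `|k z| <= B.
Proof.
move=> dk; have [|B hB] := compact_norm_bound (@cdisc_compact R r) (h := k).
  by move=> w /= wr; apply: differentiable_continuous; apply: dk.
by exists B.
Qed.

(** The Cauchy kernel is holomorphic in [z], uniformly on the circle. *)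
Lemma remainder_hol k (r B : C R) m : 0 < r ->
  (forall w, `|w| < 4 * r -> differentiable k w) ->
  (forall w, `|w| < 4 * r -> `|k w| <= B) -> hol (remainder k r m) 0.
Proof.
move=> r0 dk kB.
have nr (w : C R) : `|w| = 1 -> `|r * w| = r by move=> w1; rewrite normrM w1 mulr1 gtr0_norm.
have r2 : 0 < r / 2 by rewrite divr_gt0// ltr0n.
have rz (z w : C R) : `|w| = 1 -> `|z| < r / 2 -> r / 2 <= `|r * w - z|.
  move=> w1 hz; apply: le_trans (lerB_dist _ _); rewrite nr//.
  rewrite lerBrDl -lerBrDr; apply: le_trans (ltW hz) _.
  by rewrite le_eqVlt; apply/orP; left; apply/eqP; field.
have rz0 (z w : C R) : `|w| = 1 -> `|z| < r / 2 -> r * w - z != 0.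
  by move=> w1 hz; rewrite -normr_gt0; apply: lt_le_trans (rz _ _ w1 hz).
have H := @mean_differentiable R (C R)
  (fun w z => k (r * w) * ((r * w) ^- m * (r * w / (r * w - z)))) 0 (r / 2) (B * (r ^- m * 2)) r2.
apply/nbhs_normP; exists (r / 2 / 2); first by rewrite /= divr_gt0// ltr0n.
move=> z /= hz; apply: H; last by rewrite subr0 -normrN -sub0r.
- move=> w y w1; rewrite subr0 => hy.
  apply: dfM; first exact: dfc.
  apply: dfM; first exact: dfc.
  apply: dfM; first exact: dfc.
  by apply: dfV; [exact: (dfB (dfc _ _) (dfi _))|exact: rz0].
- move=> w y w1; rewrite subr0 => hy.
  rewrite !normrM !normfV normrX !nr//; apply: ler_pM => //.
  + by rewrite !mulr_ge0// ?invr_ge0 ?exprn_ge0// ltW.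
  + by apply: kB; rewrite nr// ltr_pMl// ltr1n.
  + apply: ler_wpM2l; first by rewrite invr_ge0 exprn_ge0// ltW.
    rewrite ler_pdivrMr ?normr_gt0 ?rz0// -ler_pdivrMl ?ltr0n//.
    rewrite -normrM nr// [2^-1 * r]mulrC; exact: rz.
Qed.

Lemma hol_order k : hol k 0 -> nz k 0 ->
  exists m u, [/\ hol u 0, u 0 != 0 & \forall z \near 0, k z = z ^+ m * u z].
Proof.
move=> /hol_ball[rho [B [rho0 dk kB]]] nk.
pose r := rho / 4; have r0 : 0 < r by rewrite divr_gt0// ltr0n.
have r4 : 4 * r = rho by rewrite /r; field.
have dk' w : `|w| < 4 * r -> differentiable k w by rewrite r4 => hw; apply: dk; rewrite subr0.
have kB' w : `|w| < 4 * r -> `|k w| <= B by rewrite r4 => hw; apply: kB; rewrite subr0.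
have near8 : \forall z \near (0 : C R), `|z| <= r / 8.
  apply/nbhs_normP; exists (r / 8) => /=; first by rewrite divr_gt0// ltr0n.
  by move=> z /=; rewrite sub0r normrN => /ltW.
have [k0|[m [m0 hm]]] := order_dichotomy r0 dk' kB'.
  by exfalso; apply: nk; apply: filterS near8.
exists m, (remainder k r m); split => //; first exact: remainder_hol kB'.
by apply: filterS near8.
Qed.

(** The order at 0 is infinite, hence the function vanishes on a disc whose radius
    only depends on the domain. *)
Lemma disc_identity k (r : C R) : 0 < r ->
  (forall w, `|w| < 8 * r -> differentiable k w) ->
  (\forall z \near 0, k z = 0) -> forall z, `|z| <= r / 8 -> k z = 0.
Proof.
move=> r0 dk k0.
have h48 w : `|w| <= 4 * r -> `|w| < 8 * r.
  by move/le_lt_trans; apply; rewrite ltr_pM2r// ltr_nat.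
have [|B hB] := @disc_bounded k (4 * r); first by move=> w /h48; exact: dk.
have dk' w : `|w| < 4 * r -> differentiable k w by move=> /ltW /h48; exact: dk.
have kB' w : `|w| < 4 * r -> `|k w| <= B by move=> /ltW; exact: hB.
have [//|[m [m0 hm]]] := order_dichotomy r0 dk' kB'.
have hh := remainder_hol m r0 dk' kB'.
have near8 : \forall z \near (0 : C R), `|z| <= r / 8.
  apply/nbhs_normP; exists (r / 8) => /=; first by rewrite divr_gt0// ltr0n.
  by move=> z /=; rewrite sub0r normrN => /ltW.
have [d d0 hd] := @nbhs_dist _ (C R) 0 _ (filterI k0 (filterI near8 (hol_neq0 hh m0))).
have d2 : 0 < d / 2 by rewrite divr_gt0// ltr0n.
have [] := hd (d / 2).
  by rewrite subr0 gtr0_norm// ltr_pdivrMr ?ltr0n// ltr_pMr// ltr1n.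
move=> e1 [e2 e3]; move: e1; rewrite hm// => /eqP.
by rewrite mulf_eq0 (negbTE e3) orbF expf_eq0 (gt_eqF d2) andbF.
Qed.

Lemma hol_punctured k : hol k 0 -> nz k 0 -> exists2 d, 0 < d & forall z, `|z| < d -> z != 0 -> k z != 0.
Proof.
move=> hk nk; have [m [u [hu u0 hm]]] := hol_order hk nk.
have [d d0 hd] := @nbhs_dist _ (C R) 0 _ (filterI hm (hol_neq0 hu u0)).
exists d => // z zd z0; have [|-> h2] := hd z; first by rewrite subr0.
by rewrite mulf_neq0// expf_neq0.
Qed.

(** Uniqueness for the linear equation [e' = kappa e]: the order at 0 of a
    nonzero solution vanishing at 0 would drop by one. *)
Lemma ode_unique (e kappa : C R -> C R) : hol e 0 -> {for 0, continuous kappa} -> e 0 = 0 ->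
  (\forall z \near 0, 'D_1 e z = kappa z * e z) -> \forall z \near 0, e z = 0.
Proof.
move=> he kc e0 de; apply: contrapT => ne.
have [m [u [hu u0 hm]]] := hol_order he ne.
have m0 : m != 0%N.
  apply: contra_eq_neq e0 => m0; have := nbhs_singleton hm; rewrite m0 expr0 mul1r => ->.
  exact: u0.
have e1 : \forall z \near (0 : C R), z != 0 -> m%:R * u z = z * (kappa z * u z - 'D_1 u z).
  apply: filterS3 de hu (nbhs_interior hm) => z h1 h2 h3 z0.
  have dz : differentiable (fun z : C R => z ^+ m) z.
    exact: (hol_diff (holX m (hol_id z))).
  rewrite (near_eq_derive _ h3) (deM _ dz h2) exp_derive (nbhs_singleton h3) in h1.
  have h1' : z ^+ m * 'D_1 u z + u z * (m%:R * z ^+ m.-1) = kappa z * (z ^+ m * u z).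
    by rewrite -h1; congr (_ + _ * _); rewrite /GRing.scale/= mulr1.
  have p0 : z ^+ m.-1 != 0 by rewrite expf_neq0.
  apply: (mulfI p0); move: h1'; rewrite -[in z ^+ m](prednK (_ : (0 < m)%N)) ?lt0n// !exprS => h1'.
  by apply/eqP; rewrite -subr_eq0; move/eqP: h1'; rewrite -subr_eq0 => /eqP h1'; apply/eqP; rewrite -h1'; ring.
have idnz : nz (fun z : C R => z) 0.
  move=> /nbhs_normP[d /= d0 hd]; have d2 : 0 < d / 2 by rewrite divr_gt0// ltr0n.
  have : d / 2 = 0; last by move/eqP; rewrite (gt_eqF d2).
  by apply: hd; rewrite /= sub0r normrN gtr0_norm// ltr_pdivrMr ?ltr0n// ltr_pMr// ltr1n.
have uc : {for 0, continuous u} by exact: hol_cont.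
have duc : {for 0, continuous (fun z => 'D_1 u z)} by exact: hol_cont (hol_derive _ _).
have c1 : {for 0, continuous (fun z => m%:R * u z)} by exact: (cvgM (cvg_cst _) uc).
have c2 : {for 0, continuous (fun z => z * (kappa z * u z - 'D_1 u z))}.
  have ic : {for 0, continuous (fun z : C R => z)} by exact: hol_cont (hol_id 0).
  exact: (cvgM ic (cvgB (cvgM kc uc) duc)).
have := dense_eq idnz c1 c2 e1; rewrite mul0r => /eqP.
by rewrite mulf_eq0 (negbTE u0) orbF pnatr_eq0 (negbTE m0).
Qed.
End OneVarTools.

Section Identity.
Context {R : realType} {V : normedModType (C R)}.
Implicit Types (h g : V -> C R) (x y q v : V).

(** A point [q'] close to [q] sees a whole neighborhood of [q] along lines contained in
    the domain, to which the one-variable identity theorem applies. *)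
Lemma hol_identity h q : hol h q ->
  \forall q' \near q, (\forall y \near q', h y = 0) -> \forall y \near q, h y = 0.
Proof.
move=> /nbhs_dist[rho rho0 dh]; pose e := rho / 8 / 8 / 4.
have e0 : 0 < e by rewrite !divr_gt0// ltr0n.
apply: (dist_nbhs e0) => q' hq' hz; apply: (dist_nbhs e0) => x hx.
pose k (t : C R) := h (q' + t *: (x - q')).
have xq' : `|x - q'| < 2 * e.
  rewrite -(subrKA q) mulr_natl mulr2n; apply: le_lt_trans (ler_normD _ _) _.
  by apply: ltrD => //; rewrite distrC.
have dk w : `|w| < 8 * 8 -> differentiable k w.
  move=> hw; apply: (diff_line (dh _ _)).1.
  rewrite addrAC; apply: le_lt_trans (ler_normD _ _) _.
  have -> : rho = 8 * 8 * (2 * e) + 8 * 8 * (2 * e) by rewrite /e; field.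
  apply: ltrD => //; last first.
    by rewrite normrZ; apply: ltr_pM => //.
  apply: lt_le_trans hq' _; rewrite mulrA ler_peMl ?(ltW e0)//.
  by rewrite -!natrM ler1n.
have k0 : \forall t \near (0 : C R), k t = 0.
  have c : {for 0, continuous (fun t : C R => q' + t *: (x - q'))}.
    by apply: differentiable_continuous; exact: ex_diff.
  by have := c (fun y => h y = 0); rewrite scale0r addr0 => /(_ hz).
have h8 : 0 < 8 :> C R by rewrite ltr0n.
have := disc_identity h8 dk k0 (z := 1).
rewrite normr1 divff ?gt_eqF// => /(_ (lexx _)).
by rewrite /k scale1r addrC subrK.
Qed.

Lemma hol_zero_near h q : (\forall y \near q, h y = 0) ->
  \forall q' \near q, \forall y \near q', h y = 0.
Proof. by move/nbhs_interior. Qed.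

Lemma nz_near h q : hol h q -> nz h q -> \forall q' \near q, nz h q'.
Proof. by move=> /hol_identity hh hq; apply: filterS hh => q' H /H. Qed.

(** A product of germs which are not zero is not zero: near [q], both factors are
    nowhere locally zero, and one of them has nonzero values. *)
Lemma nzM h g q : hol h q -> hol g q -> nz h q -> nz g q -> nz (fun y => h y * g y) q.
Proof.
move=> hh hg nh ng hz.
have [y [[h1 h2] [h3 h4]] h0] := nzP nh (filterI (filterI hh (hol_zero_near hz)) (filterI (hol_near hh) (hol_identity hg))).
apply: ng; apply: h4; apply: filterS2 h2 (hol_neq0 h3 h0) => z /eqP.
by rewrite mulf_eq0 => /orP[->//|/eqP].
Qed.

(** The Lipschitz constant of a bounded function on a ball is inversely proportional
    to the radius. *)
Lemma liouville h B : (forall y, differentiable h y) -> (forall y, `|h y| <= B) ->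
  forall x, h x = h 0.
Proof.
move=> dh hB x; apply/eqP; rewrite -subr_eq0; apply/negPn/negP; rewrite -normr_gt0 => n0.
have B0 : 0 <= B by apply: le_trans (hB 0).
(* The radius makes the Lipschitz bound smaller than half of the increment. *)
pose rho := 32 * (`|x| + 1) + `|x| * (B * 8) / (`|h x - h 0| / 2).
have x1 : 0 < `|x| + 1 by rewrite ltr_wpDl.
have t0 : 0 <= `|x| * (B * 8) / (`|h x - h 0| / 2) by rewrite !divr_ge0// !mulr_ge0.
have rho0 : 0 < rho by rewrite ltr_pwDl// mulr_gt0// ltr0n.
have := @lipschitz_bound R V h 0 rho B rho0 (fun y _ => dh y) (fun y _ => hB y) x.
rewrite add0r => H; have : `|h x - h 0| <= `|h x - h 0| / 2.
  apply: le_trans (H _) _.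
    rewrite ler_pdivlMr ?ltr0n// mulrC /rho -[leLHS]addr0; apply: lerD => //.
    by rewrite ler_wpM2l// lerDl.
  rewrite mulrA mulrA ler_pdivrMr// -ler_pdivrMl ?divr_gt0 ?ltr0n// mulrC.
  by rewrite /rho !mulrA lerDr mulr_ge0// ltW// ltr0n.
by rewrite ler_pdivlMr ?ltr0n// ger_pMr// lern1.
Qed.

(** On the line through [y] in a direction [sigma] transverse to the kernel, the
    quotient is the difference quotient of [h] at a point of the kernel, and
    Cauchy's formula exhibits it as a mean of functions holomorphic in [y]. *)
Lemma hol_division h q (l : {linear V -> C R}) (sigma : V) : continuous l -> l sigma = 1 ->
  hol h q -> (\forall y \near q, l (y - q) = 0 -> h y = 0) ->
  exists2 k, hol k q & \forall y \near q, h y = l (y - q) * k y.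
Proof.
move=> lc ls /hol_ball[rho [B [rho0 dh hB]]] hz.
have [e0 e00 he0] := nbhs_dist hz.
have s1 : 0 < `|sigma| + 1 by rewrite ltr_wpDl.
have [m m0 [m1 m2]] := pos_min2 rho0 e00.
pose r := m / 16 / (`|sigma| + 1).
have r0 : 0 < r by rewrite !divr_gt0// ltr0n.
have rs : 4 * r * `|sigma| < m / 2.
  apply: le_lt_trans (_ : m / 4 < _).
    rewrite (_ : 4 * r * `|sigma| = m / 4 * (`|sigma| / (`|sigma| + 1))).
      by rewrite ler_piMr ?divr_ge0 ?(ltW m0)// ler_pdivrMr// mul1r lerDl.
    by rewrite /r; field; rewrite gt_eqF.
  by rewrite ltr_pM2l// ltf_pV2 ?posrE ?ltr0n// ltr_nat.
pose P y := y - l (y - q) *: sigma.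
have dl y : differentiable (fun y => l (y - q)) y.
  apply: (@differentiable_comp _ _ _ _ (fun y => y - q) l).
    exact: (differentiableB (dfi y) (dfc q y)).
  exact: linear_differentiable.
have ds (a : C R) : differentiable (fun t : C R => t *: sigma) a by exact: ex_diff.
have dP y : differentiable P y.
  apply: differentiableB; first exact: dfi.
  exact: (@differentiable_comp _ _ _ _ (fun y => l (y - q)) (fun t : C R => t *: sigma)).
have Pq : P q = q by rewrite /P subrr linear0 scale0r subr0.
have lP y : l (P y - q) = 0.
  by rewrite /P addrAC linearB linearZ /= ls [_ *: 1]mulr1 subrr.
have r16 : 0 < r / 8 by rewrite divr_gt0// ltr0n.
have [d d0 hd] : exists2 d, 0 < d & forall y, `|y - q| < d ->
    `|P y - q| < m / 2 /\ `|l (y - q)| < r / 8.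
  have cP : {for q, continuous P} by exact: differentiable_continuous.
  have cl : {for q, continuous (fun y => l (y - q))} by exact: differentiable_continuous.
  have m20 : 0 < m / 2 by rewrite divr_gt0// ltr0n.
  have n1 : \forall y \near q, `|P y - q| < m / 2.
    have /continuous_atP/(_ _ m20) := cP; rewrite Pq.
    by apply: filterS => y; rewrite distrC.
  have n2 : \forall y \near q, `|l (y - q)| < r / 8.
    have /continuous_atP/(_ _ r16) := cl; rewrite subrr linear0.
    by apply: filterS => y; rewrite sub0r normrN.
  by have [d d0 hd] := nbhs_dist (filterI n1 n2); exists d.
have inball y (t : C R) : `|y - q| < d -> `|t| <= 4 * r -> `|P y + t *: sigma - q| < m.
  move=> /hd[hP _] ht; rewrite addrAC (splitr m); apply: le_lt_trans (ler_normD _ _) _.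
  by apply: ltrD => //; rewrite normrZ; apply: le_lt_trans rs; rewrite ler_wpM2r.
have nr (w : C R) : `|w| = 1 -> `|r * w| = r by move=> w1; rewrite normrM w1 mulr1 gtr0_norm.
have rle : r <= 4 * r by rewrite ler_peMl ?(ltW r0)// ler1n.
have den w y : `|w| = 1 -> `|y - q| < d -> r / 2 <= `|r * w - l (y - q)|.
  move=> w1 /hd[_ hl]; apply: le_trans (lerB_dist _ _); rewrite nr//.
  rewrite lerBrDl -lerBrDr; apply: le_trans (ltW hl) _.
  apply: le_trans (_ : r / 2 <= _); last by rewrite le_eqVlt; apply/orP; left; apply/eqP; field.
  by rewrite ler_pM2l// lef_pV2 ?posrE ?ltr0n// ler_nat.
have den0 w y : `|w| = 1 -> `|y - q| < d -> r * w - l (y - q) != 0.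
  by move=> w1 hy; rewrite -normr_gt0; apply: lt_le_trans (den w y w1 hy); rewrite divr_gt0// ltr0n.
pose G w y := h (P y + (r * w) *: sigma) * (r * w - l (y - q))^-1.
have GB w y : `|w| = 1 -> `|y - q| < d -> `|G w y| <= B * (2 / r).
  move=> w1 hy; rewrite normrM normfV; apply: ler_pM => //.
    by apply: hB; apply: lt_le_trans m1; apply: inball => //; rewrite nr.
  rewrite -[2 / r]invf_div lef_pV2 ?posrE ?normr_gt0 ?den0 ?divr_gt0 ?ltr0n//.
  exact: den.
have dG w y : `|w| = 1 -> `|y - q| < d -> differentiable (G w) y.
  move=> w1 hy; apply: dfM.
    apply: (@differentiable_comp _ _ _ _ (fun y => P y + (r * w) *: sigma) h).
      exact: (differentiableD (dP y) (dfc _ y)).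
    by apply: dh; apply: lt_le_trans m1; apply: inball => //; rewrite nr.
  by apply: dfV; [exact: (dfB (dfc _ _) (dl y))|exact: den0].
exists (fun y => mean (fun w => G w y)).
  have d2 : 0 < d / 2 by rewrite divr_gt0// ltr0n.
  by apply: (dist_nbhs d2) => y; exact: (mean_differentiable d0 dG GB).
apply: (dist_nbhs d0) => y hy; have [hPy hly] := hd y hy.
pose f t := h (P y + t *: sigma).
have df (t : C R) : `|t| < 4 * r -> differentiable f t.
  move=> /ltW ht; have hb : `|P y + t *: sigma - q| < rho by apply: lt_le_trans m1; exact: inball.
  exact: (diff_line (dh _ hb)).1.
have f0 : f 0 = 0.
  rewrite /f scale0r addr0; apply: he0; last exact: lP.
  by apply: lt_le_trans m2; apply: lt_trans hPy _; rewrite ltr_pdivrMr ?ltr0n// ltr_pMr// ltr1n.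
have fl : f (l (y - q)) = h y by rewrite /f /P subrK.
have z8 : `|0 : C R| <= r / 8 by rewrite normr0 ltW.
have {fl}-> : h y = f (l (y - q)) - f 0 by rewrite f0 subr0 fl.
rewrite -(cauchy_formula r0 (ltW hly) df) -(cauchy_formula r0 z8 df).
have fB (w : C R) : `|w| = 1 -> `|f (r * w)| <= B.
  by move=> w1; apply: hB; apply: lt_le_trans m1; apply: inball => //; rewrite nr.
have b1 : circle_bound (fun w => f (r * w) * (r * w / (r * w - l (y - q)))) (B * 2).
  move=> w w1; rewrite normrM; apply: ler_pM => //; first exact: fB.
  rewrite normrM nr// normfV ler_pdivrMr ?normr_gt0 ?den0//.
  by rewrite -ler_pdivrMl ?ltr0n// mulrC; exact: den.
have b0 : circle_bound (fun w => f (r * w) * (r * w / (r * w - 0))) B.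
  move=> w w1; rewrite subr0 divff ?mulr1; first exact: fB.
  by rewrite -normr_gt0 nr.
have b0' : circle_bound (fun w => -1 * (f (r * w) * (r * w / (r * w - 0)))) B.
  by move=> w w1; rewrite mulN1r normrN; exact: b0.
rewrite -[- mean _]mulN1r -(meanZ _ b0) -(meanD b1 b0') -(meanZ (l (y - q)) (fun w w1 => GB w y w1 hy)).
apply: eq_mean => w w1; have := den0 w y w1 hy.
have rw0 : r * w != 0 by rewrite -normr_gt0 nr.
rewrite /G -/(f (r * w)); move: (f (r * w)) (l (y - q)) (r * w) rw0 => F z a a0 az.
by field; rewrite ?subr0 ?a0 ?az.
Qed.
End Identity.

(** * Persistence of zeros *)

Section Hurwitz.
Context {R : realType} {V : normedModType (C R)}.
Implicit Types (k : V -> C R) (x y q v : V).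

(** On a small circle in direction [e], a holomorphic function whose restriction
    to that direction vanishes at [q] dominates its variation at [q]. *)
Lemma circle_lower_bound k q e (eps : C R) : 0 < eps -> hol k q ->
  nz (fun t : C R => k (q + t *: e)) 0 -> k q = 0 ->
  exists r c d : C R, [/\ 0 < r < eps, 0 < c, 0 < d &
    forall y, `|y| < d -> [/\
      forall t, `|t| = r -> 3 * c <= `|k (q + t *: e + y)|,
      `|k (q + y)| <= c &
      forall t, `|t| < 4 * r -> differentiable k (q + t *: e + y)]].
Proof.
move=> eps0 hk nk kq.
have [rho [B [rho0 dk kB]]] := hol_ball hk.
have hf : hol (fun t : C R => k (q + t *: e)) 0 by apply: hol_line; rewrite scale0r addr0.
have [m [u [hu u0 hm]]] := hol_order hf nk.
have nu : 0 < `|u 0| / 2 by rewrite divr_gt0 ?ltr0n// normr_gt0.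
have /continuous_atP/(_ _ nu) uc := hol_cont hu.
have [d1 d10 hd1] := @nbhs_dist _ (C R) 0 _ (filterI hm uc).
have e1 : 0 < `|e| + 1 by rewrite ltr_wpDl.
have rho2 : 0 < rho / 2 by rewrite divr_gt0// ltr0n.
have rhoe : 0 < rho / 2 / (`|e| + 1) by rewrite divr_gt0.
have [m1 m10 [m1d m1e]] := pos_min2 d10 eps0.
have [m2 m20 [m21 m2r]] := pos_min2 m10 rhoe.
pose r := m2 / 8.
have r0 : 0 < r by rewrite divr_gt0// ltr0n.
have rm : r < m2 by rewrite ltr_pdivrMr ?ltr0n// ltr_pMr// ltr1n.
have r4 : 4 * r = m2 / 2 by rewrite /r; field.
have r4m : 4 * r < m2 by rewrite r4 ltr_pdivrMr ?ltr0n// ltr_pMr// ltr1n.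
pose c := `|u 0| / 2 * r ^+ m / 4.
have c0 : 0 < c by rewrite !divr_gt0 ?ltr0n// mulr_gt0// exprn_gt0.
have f_le t : `|t| = r -> 4 * c <= `|k (q + t *: e)|.
  move=> tr; have [|-> hu1] := hd1 t.
    by rewrite subr0 tr; apply: lt_le_trans m1d; exact: lt_le_trans m21.
  rewrite normrM normrX tr (_ : 4 * c = r ^+ m * (`|u 0| / 2)); last by rewrite /c; field.
  rewrite ler_wpM2l ?exprn_ge0 ?(ltW r0)//.
  rewrite -(lerD2r (`|u 0| / 2)) -splitr.
  have tri : `|u 0| <= `|u t| + `|u 0 - u t| by rewrite -{1}[u 0](subrKC (u t)) ler_normD.
  by apply: le_trans tri _; rewrite lerD2l ltW.
have inb t : `|t| < 4 * r -> `|q + t *: e - q| < rho / 2.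
  move=> ht; rewrite addrAC subrr add0r normrZ.
  apply: le_lt_trans (_ : `|t| * (`|e| + 1) < _); first by rewrite ler_wpM2l// lerDl.
  by rewrite -ltr_pdivlMr//; apply: lt_trans ht _; apply: lt_le_trans r4m m2r.
have inb2 x y : `|x - q| < rho / 2 -> `|y - x| < rho / 2 -> `|y - q| < rho.
  move=> h1 h2; rewrite -(subrKA x) (splitr rho); apply: le_lt_trans (ler_normD _ _) _.
  exact: ltrD.
have B0 : 0 <= B by apply: le_trans (kB q _); rewrite ?subrr ?normr0.
pose L := B * (8 / (rho / 2)) + 1.
have L0 : 0 < L by rewrite ltr_wpDl// mulr_ge0// divr_ge0// ltW.
have lip x y : `|x - q| < rho / 2 -> `|y| <= rho / 2 / 32 -> `|k (x + y) - k x| <= `|y| * L.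
  move=> hx hy; apply: le_trans (_ : `|y| * (B * (8 / (rho / 2))) <= _).
    apply: (lipschitz_bound rho2) => //.
      by move=> z /(inb2 _ _ hx); exact: dk.
    by move=> z /(inb2 _ _ hx); exact: kB.
  by rewrite ler_wpM2l// lerDl.
have [d d0 [dc dr]] := pos_min2 (divr_gt0 c0 L0) (divr_gt0 rho2 (ltr0Sn (C R) 31)).
exists r, c, d; split => //.
  by rewrite r0; apply: lt_le_trans rm _; apply: le_trans m21 _.
move=> y hy; have hy' : `|y| <= rho / 2 / 32 by apply: le_trans (ltW hy) _.
have yL : `|y| * L <= c by rewrite -ler_pdivlMr//; apply: le_trans (ltW hy) _.
split.
- move=> t tr; have t4 : `|t| < 4 * r by rewrite tr ltr_pMl// ltr1n.
  have h1 := le_trans (lip _ y (inb t t4) hy') yL.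
  rewrite -(lerD2r c); apply: le_trans (_ : 4 * c <= _).
    by rewrite le_eqVlt; apply/orP; left; apply/eqP; ring.
  apply: le_trans (f_le t tr) _.
  rewrite -[k (q + t *: e)](subrKC (k (q + t *: e + y))).
  by apply: le_trans (ler_normD _ _) _; rewrite lerD2l distrC.
- by have := lip q y; rewrite kq subr0 subrr normr0 => /(_ rho2 hy') /le_trans; apply.
- move=> t t4; apply: dk; apply: (inb2 _ _ (inb t t4)).
  rewrite addrAC subrr add0r; apply: le_lt_trans hy' _.
  by rewrite ltr_pdivrMr ?ltr0n// ltr_pMr// ltr1n.
Qed.

(** If [k] had no zero on a disc, Cauchy's formula for its inverse would bound [1 / k] at
    the center by its values on the circle, where [k] is larger. *)
Lemma hurwitz k q e (eps : C R) : 0 < eps -> hol k q ->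
  nz (fun t : C R => k (q + t *: e)) 0 -> k q = 0 ->
  exists2 d, 0 < d & forall y, `|y| < d -> exists2 t, `|t| < eps & k (q + t *: e + y) = 0.
Proof.
move=> eps0 hk nk kq; have e4 : 0 < eps / 4 by rewrite divr_gt0// ltr0n.
have [r [c [d [/andP[r0 re] c0 d0 H]]]] := circle_lower_bound e4 hk nk kq.
exists d => // y /H[H1 H2 H3]; apply: contrapT => no.
pose f (t : C R) := k (q + t *: e + y).
have re4 : 4 * r < eps by rewrite -ltr_pdivlMl ?ltr0n// mulrC.
have f0 t : `|t| < 4 * r -> f t != 0.
  by move=> ht; apply/eqP => ft; apply: no; exists t => //; exact: lt_trans re4.
have df t : `|t| < 4 * r -> differentiable (fun t => (f t)^-1) t.
  move=> ht; apply: dfV; last exact: f0.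
  apply: (@differentiable_comp _ _ _ _ (fun t : C R => q + t *: e + y) k); last exact: H3.
  exact: ex_diff.
have z8 : `|0 : C R| <= r / 8 by rewrite normr0 divr_ge0// ltW.
have E := cauchy_formula r0 z8 df.
have : `|(f 0)^-1| <= (3 * c)^-1.
  rewrite -E; apply: mean_le => w w1.
  have rw : `|r * w| = r by rewrite normrM w1 mulr1 gtr0_norm.
  have rw0 : r * w != 0 by rewrite -normr_gt0 rw.
  rewrite subr0 divff// mulr1 normfV lef_pV2 ?posrE ?mulr_gt0 ?ltr0n//; first exact: H1.
  by rewrite normr_gt0 f0// rw ltr_pMl// ltr1n.
have f00 : f 0 != 0 by apply: f0; rewrite normr0 mulr_gt0// ltr0n.
rewrite normfV lef_pV2 ?posrE ?mulr_gt0 ?ltr0n ?normr_gt0//.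
rewrite /f scale0r addr0 => /le_trans /(_ H2).
by rewrite ger_pMl// lern1.
Qed.
End Hurwitz.

(** * Zero sets that are unions of lines in the plane *)

Lemma hol_ext (R : realType) (V : normedModType (C R)) (h g : V -> C R) x :
  (forall y, h y = g y) -> hol h x -> hol g x.
Proof. by move=> /funext ->. Qed.

Section Plane.
Context {R : realType}.
Let V := 'rV[C R]_2.
Implicit Types (h k : V -> C R) (x y q v : V) (a t : C R).

Definition e1 : V := delta_mx 0 0.
Definition e2 : V := delta_mx 0 1.
Definition zc x : C R := x 0 0.
Definition wc x : C R := x 0 1.

Lemma planeP x y : zc x = zc y -> wc x = wc y -> x = y.
Proof.
move=> h1 h2; apply/rowP => j; case: j => -[|[|//]] lj.
  by rewrite (_ : Ordinal lj = 0); [exact: h1|apply/val_inj].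
by rewrite (_ : Ordinal lj = 1); [exact: h2|apply/val_inj].
Qed.

Lemma zcD x y : zc (x + y) = zc x + zc y. Proof. by rewrite /zc mxE. Qed.
Lemma wcD x y : wc (x + y) = wc x + wc y. Proof. by rewrite /wc mxE. Qed.
Lemma zcB x y : zc (x - y) = zc x - zc y. Proof. by rewrite /zc !mxE. Qed.
Lemma wcB x y : wc (x - y) = wc x - wc y. Proof. by rewrite /wc !mxE. Qed.
Lemma zcZ a x : zc (a *: x) = a * zc x. Proof. by rewrite /zc mxE. Qed.
Lemma wcZ a x : wc (a *: x) = a * wc x. Proof. by rewrite /wc mxE. Qed.
Lemma zce1 : zc e1 = 1. Proof. by rewrite /zc mxE. Qed.
Lemma wce1 : wc e1 = 0. Proof. by rewrite /wc mxE. Qed.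
Lemma zce2 : zc e2 = 0. Proof. by rewrite /zc mxE. Qed.
Lemma wce2 : wc e2 = 1. Proof. by rewrite /wc mxE. Qed.
Lemma zc0 : zc 0 = 0. Proof. by rewrite /zc mxE. Qed.
Lemma wc0 : wc 0 = 0. Proof. by rewrite /wc mxE. Qed.
Definition coordE := (zcD, wcD, zcB, wcB, zcZ, wcZ, zce1, wce1, zce2, wce2, zc0, wc0).

Lemma planeE x : x = zc x *: e1 + wc x *: e2.
Proof. by apply: planeP; rewrite !coordE !mulr1 !mulr0 ?addr0 ?add0r. Qed.

Lemma norm_coord x j : `|x 0 j| <= `|x|.
Proof.
rewrite [leRHS]/Num.norm /= mx_normE -[leLHS]nngE num_le.
exact: (@le_bigmax _ _ _ _ _ (0 : 'I_1, j)).
Qed.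
Lemma norm_delta (j : 'I_2) : `|delta_mx 0 j : V| <= 1.
Proof.
have [->|n0] := eqVneq (`|delta_mx 0 j : V|) 0; first exact: ler01.
have [[i l] /= E] := @mx_norm_neq0 _ _ _ (delta_mx 0 j : V) n0.
rewrite [leLHS]E mxE; case: (_ && _); first by rewrite normr1.
by rewrite normr0 ler01.
Qed.

Lemma norm_plane x : `|x| <= `|zc x| + `|wc x|.
Proof.
rewrite {1}(planeE x); apply: le_trans (ler_normD _ _) _.
by apply: lerD; rewrite normrZ ler_piMr// norm_delta.
Qed.

(** The lines through the origin other than the horizontal axis, by their direction
    and, next, by their equation. *)
Definition dir a : V := a *: e1 + e2.
Definition lf a x : C R := zc x - a * wc x.
Lemma lf_is_linear a : linear (lf a).
Proof. by move=> c u v; rewrite /lf !coordE /GRing.scale /=; ring. Qed.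
HB.instance Definition _ a := GRing.isLinear.Build _ _ _ _ (lf a) (lf_is_linear a).

Lemma zc_dir a : zc (dir a) = a. Proof. by rewrite /dir !coordE mulr1 addr0. Qed.
Lemma wc_dir a : wc (dir a) = 1. Proof. by rewrite /dir !coordE mulr0 add0r. Qed.
Lemma lf_e1 a : lf a e1 = 1. Proof. by rewrite /lf !coordE mulr0 subr0. Qed.
Lemma lf_dir a b : lf a (dir b) = b - a. Proof. by rewrite /lf zc_dir wc_dir mulr1. Qed.

Lemma dirB a b : dir b - dir a = (b - a) *: e1.
Proof. by rewrite /dir opprD addrACA subrr addr0 scalerBl. Qed.

Lemma zc_continuous : continuous zc. Proof. exact: coord_continuous. Qed.
Lemma wc_continuous : continuous wc. Proof. exact: coord_continuous. Qed.
Lemma lf_continuous a : continuous (lf a).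
Proof.
move=> x; exact: (cvgB (@zc_continuous x) (cvgM (cvg_cst a) (@wc_continuous x))).
Qed.
Lemma hol_lf a x : hol (lf a) x.
Proof.
suff : \forall y \near x, differentiable (lf a) y by [].
near=> y; apply: linear_differentiable; exact: lf_continuous.
Unshelve. all: by end_near. Qed.

Definition lprod (s : seq (C R)) x : C R := \prod_(a <- s) lf a x.
Lemma lprod_cons a s x : lprod (a :: s) x = lf a x * lprod s x.
Proof. by rewrite /lprod big_cons. Qed.
Lemma hol_lprod s x : hol (lprod s) x.
Proof.
elim: s => [|a s IH].
  by apply: hol_ext (hol_cst 1 x) => y; rewrite /lprod big_nil.
by apply: hol_ext (holM (hol_lf a x) IH) => y; rewrite lprod_cons.
Qed.

(** Near the origin, the zero set of [h] is a union of pieces of lines, which are not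
    assumed to pass through the origin. *)
Definition zero_lines h := exists2 rho : C R, 0 < rho &
  forall y, `|y| < rho -> y != 0 -> h y = 0 -> exists2 v, v != 0 &
    forall t, `|y + t *: v| < rho -> h (y + t *: v) = 0.

Lemma affine_nz (b c t0 : C R) : b != 0 -> nz (fun t : C R => b + t * c) t0.
Proof.
move=> b0; have [->|c0] := eqVneq c 0.
  by apply: neq0_nz; rewrite mulr0 addr0.
move=> /nbhs_dist[d d0 hd].
have d2 : 0 < d / 2 by rewrite divr_gt0// ltr0n.
have E1 : b + t0 * c = 0 by apply: hd; rewrite subrr normr0.
have E2 : b + (t0 + d / 2) * c = 0.
  by apply: hd; rewrite addrAC subrr add0r gtr0_norm// ltr_pdivrMr ?ltr0n// ltr_pMr// ltr1n.
have : d / 2 * c = 0.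
  have -> : d / 2 * c = (b + (t0 + d / 2) * c) - (b + t0 * c) by ring.
  by rewrite E2 E1 subrr.
by move/eqP; rewrite mulf_eq0 (gt_eqF d2) (negbTE c0).
Qed.

Lemma lf_line a y v t : lf a (y + t *: v) = lf a y + t * lf a v.
Proof. by rewrite linearD linearZ. Qed.

(** The restriction of a product of linear forms to a line is a product of affine
    functions, none of which is zero when [y] avoids their kernels. *)
Lemma lprod_line_nz s y v (t0 : C R) : (forall a, a \in s -> lf a y != 0) ->
  hol (fun t : C R => lprod s (y + t *: v)) t0 /\ nz (fun t : C R => lprod s (y + t *: v)) t0.
Proof.
move=> hs; split; first exact: hol_line (hol_lprod s _).
elim: s hs => [|a s IH] hs.
  by apply: neq0_nz; rewrite /lprod big_nil oner_eq0.
have -> : (fun t : C R => lprod (a :: s) (y + t *: v)) =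
   (fun t => (lf a y + t * lf a v) * lprod s (y + t *: v)).
  by apply/funext => t; rewrite lprod_cons lf_line.
apply: nzM.
- by apply: holD; [exact: hol_cst|apply: holM; [exact: hol_id|exact: hol_cst]].
- exact: hol_line (hol_lprod s _).
- by apply: affine_nz; apply: hs; rewrite mem_head.
- by apply: IH => b bs; apply: hs; rewrite in_cons bs orbT.
Qed.

(** If [h] is a product of linear forms times [k], its zero set a union of lines,
    and [k] vanishes at the origin but not on the horizontal axis, then [k] vanishes
    on a line through the origin: it vanishes on lines passing near the origin,
    whose slopes are bounded, and one takes a limit. *)
Lemma line_in_zeros h k s : hol k 0 -> nz (fun t : C R => k (0 + t *: e1)) 0 -> k 0 = 0 ->
  zero_lines h -> (\forall x \near (0 : V), h x = lprod s x * k x) ->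
  exists a, \forall t \near (0 : C R), k (t *: dir a) = 0.
Proof.
move=> hk nk k0 [rho rho0 hlines] hE.
apply: contrapT => noline.
have {}noline a : nz (fun t : C R => k (t *: dir a)) 0.
  by move=> H; apply: noline; exists a.
have hka a : hol (fun t : C R => k (t *: dir a)) 0.
  have : hol (fun t : C R => k (0 + t *: dir a)) 0 by apply: hol_line; rewrite scale0r addr0.
  by apply: hol_ext => t; rewrite add0r.
have [rh rh0 hrh] := nbhs_dist hE.
have [rk rk0 hrk] := nbhs_dist hk.
have [m1 m10 [m1a m1b]] := pos_min2 rh0 rk0.
have [m2 m20 [m2a m2b]] := pos_min2 m10 rho0.
(* everything happens in the ball of radius m2 *)
have m22 : 0 < m2 / 2 by rewrite divr_gt0// ltr0n.
have [r [c [d [/andP[r0 rm2] c0 d0 Hcirc]]]] := circle_lower_bound m22 hk nk k0.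
have [s1 s10 [s1d s1m]] := pos_min2 d0 m22.
have circ z w : `|z| = r -> `|w| < s1 -> k (z *: e1 + w *: e2) != 0.
  move=> zr ws; have [|H _ _] := Hcirc (w *: e2).
    rewrite normrZ; apply: le_lt_trans (_ : `|w| < _).
      by rewrite ler_piMr// norm_delta.
    exact: lt_le_trans s1d.
  have := H z zr; rewrite add0r => H'.
  by rewrite -normr_gt0; apply: lt_le_trans H'; rewrite mulr_gt0// ltr0n.
have notin : exists2 dd, 0 < dd & forall w, `|w| < dd -> w != 0 ->
    forall a, a \in s -> k (w *: dir a) != 0.
  elim: (s) => [|a s' [d1 d10 h1]]; first by exists 1.
  have [d3 d30 h3] := hol_punctured (hka a) (noline a).
  have [d4 d40 [d41 d43]] := pos_min2 d10 d30.
  exists d4 => // w wd w0 b; rewrite in_cons => /orP[/eqP->|bs].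
    by apply: h3 => //; exact: lt_le_trans d43.
  by apply: h1 => //; exact: lt_le_trans d41.
have [dd dd0 hdd] := notin.
(* A line of slope larger than [A] through a point close to the origin would reach
   [|z| = r] before [|w|] reaches [s1]. *)
pose A := 4 * r / s1.
have key (eta : C R) : 0 < eta -> exists y a, [/\ `|y| < eta, `|a| <= A &
    forall t, `|y + t *: dir a| < m2 -> k (y + t *: dir a) = 0].
  move=> eta0.
  have [n1 n10 [n1a n1b]] := pos_min2 eta0 r0.
  have n12 : 0 < n1 / 2 by rewrite divr_gt0// ltr0n.
  have [dh dh0 hh] := hurwitz n12 hk nk k0.
  have [g1 g10 [g1a g1b]] := pos_min2 dh0 dd0.
  have [g2 g20 [g2a g2b]] := pos_min2 n12 (divr_gt0 s10 (ltr0Sn (C R) 1)).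
  have [g3 g30 [g3a g3b]] := pos_min2 g10 g20.
  pose w := g3 / 2.
  have w0 : 0 < w by rewrite divr_gt0// ltr0n.
  have wg : `|w| < g3 by rewrite gtr0_norm// ltr_pdivrMr ?ltr0n// ltr_pMr// ltr1n.
  have nwe : `|w *: e2| <= `|w| by rewrite normrZ ler_piMr// norm_delta.
  have [|z zn kz] := hh (w *: e2).
    apply: le_lt_trans nwe _; apply: lt_le_trans wg _; apply: le_trans g3a _; exact: g1a.
  rewrite add0r in kz; set y := z *: e1 + w *: e2 in kz.
  have zcy : zc y = z by rewrite /y !coordE mulr1 mulr0 addr0.
  have wcy : wc y = w by rewrite /y !coordE mulr1 mulr0 add0r.
  clearbody y.
  have yn : `|y| < n1.
    apply: le_lt_trans (norm_plane y) _; rewrite zcy wcy (splitr n1); apply: ltrD => //.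
    by apply: lt_le_trans wg _; apply: le_trans g3b _.
  have rm : r < m2 by apply: lt_trans rm2 _; rewrite ltr_pdivrMr ?ltr0n// ltr_pMr// ltr1n.
  have ym2 : `|y| < m2 by apply: lt_trans yn _; apply: le_lt_trans n1b _.
  have wn0 : w != 0 by rewrite gt_eqF.
  have y0 : y != 0 by apply: contra_neq wn0 => yE; rewrite -wcy yE wc0.
  have m2h : m2 <= rh by apply: le_trans m2a _.
  have m2k : m2 <= rk by apply: le_trans m2a _.
  have hy0 : h y = 0 by rewrite hrh ?kz ?mulr0// subr0; exact: lt_le_trans m2h.
  have [v v0 hv] := hlines y (lt_le_trans ym2 m2b) y0 hy0.
  have lfy a : a \in s -> lf a y != 0.
    move=> as_; apply/eqP => E; have wdd : `|w| < dd.
      by apply: lt_le_trans wg _; apply: le_trans g3a _.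
    have := hdd w wdd wn0 a as_; suff -> : w *: dir a = y by rewrite kz eqxx.
    apply: planeP; [rewrite zcZ zc_dir zcy|by rewrite wcZ wc_dir wcy mulr1].
    by move/eqP: E; rewrite /lf zcy wcy subr_eq0 mulrC => /eqP.
  (* [k] vanishes on the whole line, since the linear forms do not *)
  have kline t : `|y + t *: v| < m2 -> k (y + t *: v) = 0.
    move=> ht; have hkt : hol (fun t : C R => k (y + t *: v)) t.
      apply: hol_line; have dk : \forall x \near y + t *: v, `|x| < m2.
        have g : 0 < m2 - `|y + t *: v| by rewrite subr_gt0.
        apply: (dist_nbhs g) => x hx; rewrite -(subrK (y + t *: v) x).
        by apply: le_lt_trans (ler_normD _ _) _; rewrite -ltrBrDr.
      by apply: filterS dk => x hx; apply: hrk; rewrite subr0; exact: lt_le_trans m2k.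
    have [hL nL] := lprod_line_nz v t lfy.
    apply/eqP/negPn/negP => kt0.
    have := nzM hL hkt nL (neq0_nz kt0); apply.
    have cc : {for t, continuous (fun t : C R => y + t *: v)}.
      by apply: differentiable_continuous; exact: ex_diff.
    have dk : \forall x \near y + t *: v, `|x| < m2.
      have g : 0 < m2 - `|y + t *: v| by rewrite subr_gt0.
      apply: (dist_nbhs g) => x hx; rewrite -(subrK (y + t *: v) x).
      by apply: le_lt_trans (ler_normD _ _) _; rewrite -ltrBrDr.
    have cdk : \forall t' \near t, `|y + t' *: v| < m2 by exact: (cc _ dk).
    apply: filterS cdk => t' ht'.
    rewrite -hrh ?subr0; last exact: lt_le_trans m2h.
    by apply: hv; exact: lt_le_trans m2b.
  have r2m : r + s1 <= m2.
    rewrite (splitr m2); apply: lerD => //; exact: ltW.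
  have zr : `|z| < r.
    by apply: lt_trans zn _; apply: lt_le_trans n1b; rewrite ltr_pdivrMr ?ltr0n// ltr_pMr// ltr1n.
  have ws : `|w| < s1 / 2 by apply: lt_le_trans wg _; apply: le_trans g3b _.
  have ss : s1 / 2 < s1 by rewrite ltr_pdivrMr ?ltr0n// ltr_pMr// ltr1n.
  have nocirc t : zc (y + t *: v) = r -> `|wc (y + t *: v)| < s1 -> False.
    move=> E1 E2; have nr : `|zc (y + t *: v)| = r by rewrite E1 gtr0_norm.
    have : k (y + t *: v) = 0.
      apply: kline; apply: le_lt_trans (norm_plane _) _; rewrite nr.
      by apply: lt_le_trans r2m; rewrite ltrD2l.
    by rewrite {1}(planeE (y + t *: v)) => /eqP; rewrite (negbTE (circ _ _ nr E2)).
  have wv0 : wc v != 0.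
    apply/eqP => wv; have zv : zc v != 0.
      by apply: contra_neq v0 => zv; apply: planeP; rewrite ?zv ?wv ?coordE.
    apply: (nocirc ((r - z) / zc v)).
      by rewrite !coordE zcy divfK// addrC subrK.
    by rewrite !coordE wv mulr0 addr0 wcy; exact: lt_trans ss.
  pose a := zc v / wc v.
  have line_dir t : t *: dir a = (t / wc v) *: v.
    by apply: planeP; [rewrite !zcZ zc_dir /a|rewrite !wcZ wc_dir]; field.
  exists y, a; split; first exact: lt_le_trans n1a.
    rewrite real_leNgt ?normr_real ?ger0_real// ?divr_ge0 ?mulr_ge0 ?(ltW r0) ?(ltW s10)//.
    apply/negP => aA; have A0 : 0 < `|a| by apply: lt_trans aA; rewrite divr_gt0// mulr_gt0// ltr0n.
    have an0 : a != 0 by rewrite -normr_gt0.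
    have zE t : zc (y + (t / wc v) *: v) = z + t * a by rewrite -line_dir zcD zcZ zc_dir zcy.
    have wE t : wc (y + (t / wc v) *: v) = w + t by rewrite -line_dir wcD wcZ wc_dir mulr1 wcy.
    apply: (nocirc ((r - z) / a / wc v)); rewrite ?zE ?wE.
      by rewrite divfK// addrC subrK.
    apply: le_lt_trans (ler_normD _ _) _; rewrite (splitr s1); apply: ltrD => //.
    rewrite normrM normfV ltr_pdivrMr//.
    apply: le_lt_trans (ler_normB _ _) _; rewrite (gtr0_norm r0).
    apply: lt_trans (_ : r + r < _); first by rewrite ltrD2l.
    have -> : r + r = s1 / 2 * A by rewrite /A; field; rewrite gt_eqF.
    by rewrite ltr_pM2l// divr_gt0// ltr0n.
  by move=> t; rewrite line_dir; exact: kline.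
have /compact_near_coveringP/near_covering_withinP cA := @cdisc_compact R A.
pose good (y : V) (a : C R) := exists2 t, `|y + t *: dir a| < m2 & k (y + t *: dir a) != 0.
have hgood : \forall y \near (0 : V), [set z : C R | `|z| <= A] `<=` good y.
  apply: (cA V (nbhs (0 : V)) good (nbhs_filter (0 : V))) => a aA.
  have nearm : \forall t \near (0 : C R), `|t *: dir a| < m2.
    have p : 0 < m2 / (`|dir a| + 1) by rewrite divr_gt0// ltr_wpDl.
    apply: (dist_nbhs p) => t; rewrite subr0 ltr_pdivlMr ?ltr_wpDl// => ht.
    rewrite normrZ; apply: le_lt_trans ht; by rewrite ler_wpM2l// lerDl.
  have [t tm kt] := nzP (noline a) nearm.
  have contk : {for t *: dir a, continuous k}.
    by apply: differentiable_continuous; apply: hrk; rewrite subr0; apply: lt_le_trans tm _; apply: le_trans m2a _.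
  have g : 0 < m2 - `|t *: dir a| by rewrite subr_gt0.
  have n1 : \forall x \near t *: dir a, `|x| < m2.
    apply: (dist_nbhs g) => x hx; rewrite -(subrK (t *: dir a) x).
    by apply: le_lt_trans (ler_normD _ _) _; rewrite -ltrBrDr.
  have [b b0 hb] := nbhs_dist (filterI n1 (cont_neq0 contk kt)).
  have b2 : 0 < b / 2 by rewrite divr_gt0// ltr0n.
  have t1 : 0 < `|t| + 1 by rewrite ltr_wpDl.
  exists (ball (a : C R) (b / 2 / (`|t| + 1)), [set y : V | `|y - 0| < b / 2]).
    split; first by apply: nbhs_ballC; rewrite divr_gt0.
    by apply: (dist_nbhs b2).
  move=> [a' y] [/= ha' hy] _.
  suff /hb [] : `|y + t *: dir a' - t *: dir a| < b by exists t.
  have -> : y + t *: dir a' - t *: dir a = y + (t * (a' - a)) *: e1.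
    by rewrite -addrA -scalerBr dirB scalerA.
  rewrite (splitr b); apply: le_lt_trans (ler_normD _ _) _; apply: ltrD.
    by move: hy; rewrite subr0.
  rewrite normrZ; apply: le_lt_trans (_ : `|t * (a' - a)| < _).
    by rewrite ler_piMr// norm_delta.
  rewrite normrM; move: ha'; rewrite /ball /= distrC ltr_pdivlMr// => ha'.
  by apply: le_lt_trans ha'; rewrite mulrC ler_wpM2l// lerDl.
have [b b0 hb] := nbhs_dist hgood.
have [y [a [h1 h2 h3]]] := key b b0.
have [||t ht] := hb y _ a; rewrite ?subr0//.
by rewrite h3// eqxx.
Qed.
End Plane.

(** * Factorization into linear forms *)

Section Cancel.
Context {R : realType} {V : normedModType (C R)}.
Implicit Types (h f g l : V -> C R) (q : V).

Lemma hol_cancel l f g q : hol l q -> nz l q -> hol f q -> hol g q ->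
  (\forall x \near q, l x * f x = l x * g x) -> \forall x \near q, f x = g x.
Proof.
move=> hl nl hf hg E.
apply: filterS3 (nz_near hl nl) (filterI hf hg) (nbhs_interior E) => x nx [fx gx] Ex.
apply: (dense_eq nx); [exact: differentiable_continuous|exact: differentiable_continuous|].
by apply: filterS Ex => y E' l0; exact: (mulfI l0).
Qed.
End Cancel.

Section Factor.
Context {R : realType}.
Let V := 'rV[C R]_2.
Implicit Types (h k g : V -> C R) (x y : V) (a b t : C R).

Lemma id_nz : nz (fun t : C R => t) 0.
Proof.
move=> /nbhs_dist[d d0 hd]; have d2 : 0 < d / 2 by rewrite divr_gt0// ltr0n.
have : d / 2 = 0; last by move/eqP; rewrite (gt_eqF d2).
by apply: hd; rewrite subr0 gtr0_norm// ltr_pdivrMr ?ltr0n// ltr_pMr// ltr1n.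
Qed.

Lemma lf_nz a q : nz (lf a) q.
Proof.
have [|l0] := eqVneq (lf a q) 0; last exact: neq0_nz.
move=> l0 /nbhs_dist[d d0 hd]; have d2 : 0 < d / 2 by rewrite divr_gt0// ltr0n.
have : lf a (q + (d / 2) *: e1) = 0.
  apply: hd; rewrite addrAC subrr add0r normrZ; apply: le_lt_trans (_ : `|d / 2| < _).
    by rewrite ler_piMr// norm_delta.
  by rewrite gtr0_norm// ltr_pdivrMr ?ltr0n// ltr_pMr// ltr1n.
by rewrite lf_line l0 lf_e1 mulr1 add0r => /eqP; rewrite (gt_eqF d2).
Qed.

Lemma near0_wc (P : set (C R)) : (\forall t \near (0 : C R), P t) -> \forall y \near (0 : V), P (wc y).
Proof.
move=> H; have c : {for (0 : V), continuous (@wc R)} by exact: wc_continuous.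
by apply: (c P); rewrite wc0.
Qed.

Lemma near0_line (v : V) (P : set V) : (\forall y \near (0 : V), P y) ->
  \forall t \near (0 : C R), P (t *: v).
Proof.
move=> H; have c : {for (0 : C R), continuous (fun t : C R => t *: v)}.
  by apply: differentiable_continuous; exact: ex_diff.
by apply: (c P); rewrite scale0r.
Qed.

Lemma lf0_dir a y : lf a y = 0 -> y = wc y *: dir a.
Proof.
move=> /eqP; rewrite /lf subr_eq0 => /eqP E.
by apply: planeP; rewrite ?zcZ ?zc_dir ?wcZ ?wc_dir ?mulr1// E mulrC.
Qed.

Lemma division_dir k a : hol k 0 -> (\forall t \near (0 : C R), k (t *: dir a) = 0) ->
  exists2 k', hol k' 0 & \forall y \near (0 : V), k y = lf a y * k' y.
Proof.
move=> hk hz.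
have [|k' hk' E] := @hol_division R V k 0 (lf a) e1 (@lf_continuous R a) (lf_e1 a) hk.
  apply: filterS (near0_wc hz) => y H; rewrite subr0 => /lf0_dir ->; exact: H.
by exists k' => //; apply: filterS E => y; rewrite subr0.
Qed.

Lemma hol_line0 k (v : V) : hol k 0 -> hol (fun t : C R => k (t *: v)) 0.
Proof.
move=> hk; have : hol (fun t : C R => k (0 + t *: v)) 0 by apply: hol_line; rewrite scale0r addr0.
by apply: hol_ext => t; rewrite add0r.
Qed.

(** Weierstrass preparation, when the zero set is a union of lines: dividing
    repeatedly lowers the order of vanishing on the horizontal axis. *)
Theorem zero_lines_factor h : hol h 0 -> nz (fun t : C R => h (t *: e1)) 0 -> zero_lines h ->
  exists s u, [/\ hol u 0, u 0 != 0 & \forall x \near (0 : V), h x = lprod s x * u x].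
Proof.
move=> hh nh lh.
have main n : forall s k, hol k 0 -> (\forall x \near (0 : V), h x = lprod s x * k x) ->
   (exists u1, [/\ hol u1 0, u1 0 != 0 & \forall t \near (0 : C R), k (t *: e1) = t ^+ n * u1 t]) ->
   exists s u, [/\ hol u 0, u 0 != 0 & \forall x \near (0 : V), h x = lprod s x * u x].
  elim: n => [|n IH] s k hk hE [u1 [hu1 u10 ku]].
    exists s, k; split => //; have := nbhs_singleton ku.
    by rewrite scale0r expr0 mul1r => ->.
  have k0 : k 0 = 0 by have := nbhs_singleton ku; rewrite scale0r expr0n mul0r.
  have nk : nz (fun t : C R => k (0 + t *: e1)) 0.
    move=> kz; have [t [[h1 h2] h3] t0] := nzP id_nz (filterI (filterI kz ku) (hol_neq0 hu1 u10)).
    move: h1; rewrite add0r h2 => /eqP.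
    by rewrite mulf_eq0 (negbTE h3) orbF expf_eq0 (negbTE t0) andbF.
  have [a ha] := line_in_zeros hk nk k0 lh hE.
  have [k' hk' E] := division_dir hk ha.
  apply: (IH (a :: s) k' hk').
    by apply: filterS2 hE E => x -> ->; rewrite lprod_cons mulrCA mulrA.
  exists u1; split => //.
  apply: (hol_cancel (hol_id 0) id_nz (hol_line0 e1 hk') (holM (holX n (hol_id 0)) hu1)).
  apply: filterS2 ku (near0_line e1 E) => t h1 h2.
  by rewrite mulrA -exprS -h1 h2 linearZ /= lf_e1 [_ *: 1]mulr1.
have hh1 := hol_line0 e1 hh.
have [m [u [hu u0 hm]]] := hol_order hh1 nh.
apply: (main m [::] h hh); last by exists u.
by apply: filterE => x; rewrite /lprod big_nil mul1r.
Qed.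

Definition ldvd a m g := exists2 k, hol k 0 & \forall x \near (0 : V), g x = lf a x ^+ m * k x.

(** Equations of distinct lines are coprime. *)
Lemma ldvd_coprime a b m g : a != b -> hol g 0 -> ldvd a m (fun x => lf b x * g x) -> ldvd a m g.
Proof.
move=> ab; elim: m g => [|m IH] g hg [k hk E].
  by exists g => //; apply: filterE => x; rewrite expr0 mul1r.
have gz : \forall t \near (0 : C R), g (t *: dir a) = 0.
  have n0 : nz (fun t : C R => t * (a - b)) 0.
    by apply: nzM; [exact: hol_id|exact: hol_cst|exact: id_nz|apply: neq0_nz; rewrite subr_eq0].
  apply: (hol_cancel (holM (hol_id 0) (hol_cst (a - b) 0)) n0 (hol_line0 _ hg) (hol_cst 0 0)).
  apply: filterS (near0_line (dir a) E) => t; rewrite !linearZ /= !lf_dir subrr.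
  by rewrite scaler0 expr0n mul0r mulr0.
have [g' hg' E'] := division_dir hg gz.
have [k' hk' E2] : ldvd a m g'.
  apply: IH => //; exists k => //.
  apply: (hol_cancel (hol_lf a 0) (@lf_nz a 0)).
  - exact: holM (hol_lf b 0) hg'.
  - exact: holM (holX m (hol_lf a 0)) hk.
  - by apply: filterS2 E E' => x h1 h2; rewrite mulrCA -h2 h1 exprS mulrA.
exists k' => //; apply: filterS2 E' E2 => x -> ->.
by rewrite exprS mulrA.
Qed.

(** Unique factorization: coprime powers of linear forms divide together. *)
Lemma lprod_dvd s g : hol g 0 -> (forall a, ldvd a (count_mem a s) g) ->
  exists2 k, hol k 0 & \forall x \near (0 : V), g x = lprod s x * k x.
Proof.
elim: s g => [|a s IH] g hg hs.
  by exists g => //; apply: filterE => x; rewrite /lprod big_nil mul1r.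
have [k hk] := hs a; rewrite /= eqxx add1n => E.
pose g1 x := lf a x ^+ count_mem a s * k x.
have hg1 : hol g1 0 by apply: holM => //; exact: holX (hol_lf a 0).
have gE : \forall x \near (0 : V), g x = lf a x * g1 x.
  by apply: filterS E => x ->; rewrite /g1 exprS mulrA.
have [b|k1 hk1 E1] := IH g1 hg1.
  have [->|ba] := eqVneq b a; first by exists k => //; apply: filterE.
  have [k2 hk2] := hs b; rewrite /= eq_sym (negbTE ba) add0n => E2.
  apply: (ldvd_coprime ba hg1); exists k2 => //.
  by apply: filterS2 gE E2 => x <-.
exists k1 => //; apply: filterS2 gE E1 => x -> ->.
by rewrite lprod_cons mulrA.
Qed.

Lemma lprod_count a s x : lprod s x = lf a x ^+ count_mem a s * lprod [seq b <- s | b != a] x.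
Proof.
elim: s => [|b s IH]; first by rewrite /lprod !big_nil mul1r.
rewrite lprod_cons IH /=; case: eqVneq => [->|ba] /=.
  by rewrite add1n exprS mulrA.
by rewrite add0n lprod_cons mulrCA.
Qed.
End Factor.

(** * Wronskians and the inflection of a pencil *)

Section QuadraticForm.
Context {K : comNzRingType}.

(** The quadratic form of matrix [a] at the vector [(w2, - w1)], which is tangent to the
    level curve of [f / g] when [w1] and [w2] are the Wronskians. *)
Definition qform (w1 w2 a11 a21 a12 a22 : K) : K :=
  w2 ^+ 2 * a11 - w1 * w2 * (a21 + a12) + w1 ^+ 2 * a22.

Lemma qform_homog u u1 u2 w1 w2 a11 a21 a12 a22 :
  qform (u ^+ 2 * w1) (u ^+ 2 * w2) (u ^+ 2 * a11 + w1 * (2 * u * u1))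
    (u ^+ 2 * a21 + w1 * (2 * u * u2)) (u ^+ 2 * a12 + w2 * (2 * u * u1))
    (u ^+ 2 * a22 + w2 * (2 * u * u2)) = u ^+ 6 * qform w1 w2 a11 a21 a12 a22.
Proof. by rewrite /qform; ring. Qed.

Lemma qform_change a b c e w1 w2 a11 a21 a12 a22 :
  qform (a * w1 + b * w2) (c * w1 + e * w2)
    (a * (a * a11 + b * a21) + b * (a * a12 + b * a22))
    (a * (c * a11 + e * a21) + b * (c * a12 + e * a22))
    (c * (a * a11 + b * a21) + e * (a * a12 + b * a22))
    (c * (c * a11 + e * a21) + e * (c * a12 + e * a22))
  = (a * e - b * c) ^+ 2 * qform w1 w2 a11 a21 a12 a22.
Proof. by rewrite /qform; ring. Qed.

Lemma qform_divides p b db w1 w2 a11 a21 a12 a22 : w2 = p * b -> a22 = p * db ->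
  qform w1 w2 a11 a21 a12 a22 = p * (b * (w2 * a11 - w1 * (a21 + a12)) + w1 ^+ 2 * db).
Proof. by move=> -> ->; rewrite /qform; ring. Qed.

Lemma eq_qform w1 w2 a11 a21 a12 a22 w1' w2' a11' a21' a12' a22' :
  w1 = w1' -> w2 = w2' -> a11 = a11' -> a21 = a21' -> a12 = a12' -> a22 = a22' ->
  qform w1 w2 a11 a21 a12 a22 = qform w1' w2' a11' a21' a12' a22'.
Proof. by move=> -> -> -> -> -> ->. Qed.

End QuadraticForm.

Section Inflection.
Context {R : realType} {V : normedModType (C R)}.
Implicit Types (h f g u : V -> C R) (x q d : V).

(** The numerator of the derivative of [g / f], and at the same time minus that of
    [f / g]: symmetric in the two charts of the projective line. *)
Definition wron d f g x : C R := f x * 'D_d g x - g x * 'D_d f x.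

(** The second derivative of a level curve of [f / g], up to a factor: it vanishes
    identically when the level curves are lines. *)
Definition inflection d1 d2 f g x : C R :=
  qform (wron d1 f g x) (wron d2 f g x) ('D_d1 (wron d1 f g) x) ('D_d2 (wron d1 f g) x)
    ('D_d1 (wron d2 f g) x) ('D_d2 (wron d2 f g) x).

Lemma hol_wron d f g x : hol f x -> hol g x -> hol (wron d f g) x.
Proof. by move=> hf hg; apply: holB; apply: holM => //; exact: hol_derive. Qed.

Lemma hol_inflection d1 d2 f g x : hol f x -> hol g x -> hol (inflection d1 d2 f g) x.
Proof.
move=> hf hg; have h1 := hol_wron d1 hf hg; have h2 := hol_wron d2 hf hg.
apply: holD; first apply: holB.
- by apply: holM; [exact: holX|exact: hol_derive].
- by apply: holM; [exact: holM|apply: holD; exact: hol_derive].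
- by apply: holM; [exact: holX|exact: hol_derive].
Qed.

Lemma deX h x d n : differentiable h x ->
  'D_d (fun y => h y ^+ n) x = n%:R * h x ^+ n.-1 * 'D_d h x.
Proof.
move=> dh; have dX m : differentiable (fun y => h y ^+ m) x.
  elim: m => [|m IH]; first exact: (dfc (1 : C R)).
  have -> : (fun y => h y ^+ m.+1) = (fun y => h y * h y ^+ m) by apply/funext => y; rewrite exprS.
  exact: dfM.
elim: n => [|n IH].
  have -> : (fun y => h y ^+ 0) = (fun=> 1) by apply/funext => y; rewrite expr0.
  by rewrite de_cst !mul0r.
have -> : (fun y => h y ^+ n.+1) = (fun y => h y * h y ^+ n) by apply/funext => y; rewrite exprS.
rewrite (deM _ dh (dX n)) IH /= -addn1 natrD.
case: n {IH} => [|n] /=; first by rewrite !expr0; ring.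
by rewrite exprS; ring.
Qed.

Lemma deZ h x d (c : C R) : differentiable h x -> 'D_d (fun y => c * h y) x = c * 'D_d h x.
Proof.
by move=> dh; apply: (etrans (deM d (dfc c x) dh)); rewrite de_cst mulr0 addr0.
Qed.

Lemma wron_homog d u f g x : differentiable u x -> differentiable f x -> differentiable g x ->
  wron d (fun y => u y * f y) (fun y => u y * g y) x = u x ^+ 2 * wron d f g x.
Proof.
move=> du df dg; rewrite /wron (deM _ du df) (deM _ du dg).
by move: ('D_d u x) ('D_d f x) ('D_d g x) (u x) (f x) (g x) => *; ring. Qed.

Lemma inflection_homog d1 d2 u f g x : hol u x -> hol f x -> hol g x ->
  inflection d1 d2 (fun y => u y * f y) (fun y => u y * g y) x =
  u x ^+ 6 * inflection d1 d2 f g x.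
Proof.
move=> hu hf hg; have du := hol_diff hu; have df := hol_diff hf; have dg := hol_diff hg.
have E d : \forall y \near x, wron d (fun y => u y * f y) (fun y => u y * g y) y = u y ^+ 2 * wron d f g y.
  by apply: filterS3 hu hf hg => y; exact: wron_homog.
have dw d := hol_diff (hol_wron d hf hg).
(* The Wronskian has degree 2; the extra terms contain [w_d] and cancel in the
   quadratic form. *)
have D d d' : 'D_d' (wron d (fun y => u y * f y) (fun y => u y * g y)) x =
    u x ^+ 2 * 'D_d' (wron d f g) x + wron d f g x * (2 * u x * 'D_d' u x).
  rewrite [LHS](near_eq_derive d' (E d)).
  rewrite [LHS](deM d' (hol_diff (holX 2 hu)) (dw d)).
  by rewrite [X in _ + _ * X = _](deX d' 2 du) expr1.
rewrite -(qform_homog _ ('D_d1 u x) ('D_d2 u x)); rewrite /inflection; apply: eq_qform; try exact: wron_homog; exact: D.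
Qed.

Lemma inflection_near d1 d2 f g f' g' x : (\forall y \near x, f y = f' y) ->
  (\forall y \near x, g y = g' y) -> inflection d1 d2 f g x = inflection d1 d2 f' g' x.
Proof.
move=> Ef Eg; have E d : \forall y \near x, wron d f g y = wron d f' g' y.
  apply: filterS2 (nbhs_interior Ef) (nbhs_interior Eg) => y ef eg.
  by rewrite /wron (nbhs_singleton ef) (nbhs_singleton eg) (near_eq_derive _ ef) (near_eq_derive _ eg).
rewrite /inflection; apply: eq_qform; [exact: (nbhs_singleton (E d1))|exact: (nbhs_singleton (E d2))| | | |].
- exact: (near_eq_derive d1 (E d1)).
- exact: (near_eq_derive d2 (E d1)).
- exact: (near_eq_derive d1 (E d2)).
- exact: (near_eq_derive d2 (E d2)).
Qed.

Lemma derive_comb h x (a b : C R) d1 d2 : differentiable h x ->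
  'D_(a *: d1 + b *: d2) h x = a * 'D_d1 h x + b * 'D_d2 h x.
Proof. by move=> dh; rewrite !(deriveE _ dh) linearD !linearZ. Qed.

(** The vector [(w2, - w1)] represents a tangent vector of the level curve, intrinsic
    up to the determinant. *)
Lemma inflection_change f g x (a b c e : C R) d1 d2 : hol f x -> hol g x ->
  inflection (a *: d1 + b *: d2) (c *: d1 + e *: d2) f g x =
  (a * e - b * c) ^+ 2 * inflection d1 d2 f g x.
Proof.
move=> hf hg.
have E (s t : C R) : \forall y \near x, wron (s *: d1 + t *: d2) f g y =
    s * wron d1 f g y + t * wron d2 f g y.
  apply: filterS2 hf hg => y df dg; rewrite /wron (derive_comb _ _ _ _ df) (derive_comb _ _ _ _ dg).
  by move: ('D_d1 f y) ('D_d2 f y) ('D_d1 g y) ('D_d2 g y) (f y) (g y) => *; ring.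
have dw1 := hol_diff (hol_wron d1 hf hg); have dw2 := hol_diff (hol_wron d2 hf hg).
have D d (s t : C R) : 'D_d (wron (s *: d1 + t *: d2) f g) x =
    s * 'D_d (wron d1 f g) x + t * 'D_d (wron d2 f g) x.
  apply: (etrans (near_eq_derive d (E s t))).
  by apply: (etrans (deD d (dfM (dfc s x) dw1) (dfM (dfc t x) dw2))); congr (_ + _); exact: deZ.
have C w (s t : C R) : differentiable w x -> 'D_(s *: d1 + t *: d2) w x = s * 'D_d1 w x + t * 'D_d2 w x.
  exact: derive_comb.
rewrite -qform_change; rewrite /inflection; apply: eq_qform; [exact: (nbhs_singleton (E a b))|exact: (nbhs_singleton (E c e))| | | |].
all: by apply: (etrans (D _ _ _)); congr (_ * _ + _ * _); exact: C.
Qed.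
End Inflection.

Section Pullback.
Context {R : realType} {V W : normedModType (C R)}.
Variables (q : V) (phi : {linear W -> V}).
Hypothesis phic : continuous phi.

Let dphi (y : W) : differentiable (fun x => q + phi x) y.
Proof.
by apply: (differentiableD (dfc q y)); exact: linear_differentiable.
Qed.

Lemma hol_pull (h : V -> C R) (x : W) : hol h (q + phi x) -> hol (fun x => h (q + phi x)) x.
Proof. by move=> hh; exact: (@hol_comp R V W (fun x => q + phi x) h x dphi hh). Qed.

Lemma derive_pull (h : V -> C R) (x d : W) : differentiable h (q + phi x) ->
  'D_d (fun x => h (q + phi x)) x = 'D_(phi d) h (q + phi x).
Proof.
move=> dh; rewrite (deriveE _ dh) (deriveE _ (@differentiable_comp _ _ _ _ (fun x => q + phi x) h x (dphi x) dh)).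
rewrite (diff_comp (dphi x) dh) /=; congr ('d h _ _).
have da : is_diff x (fun x => q + phi x) (fun y => 0 + phi y).
  apply: is_diffD; apply: DiffDef; first exact: linear_differentiable.
  exact: diff_lin.
by rewrite diff_val add0r.
Qed.

Lemma near_pull (P : set V) (x : W) : (\forall y \near q + phi x, P y) ->
  \forall y \near x, P (q + phi y).
Proof.
move=> H; have c : {for x, continuous (fun x => q + phi x)} by exact: differentiable_continuous.
exact: (c P H).
Qed.

Lemma inflection_pull (f g : V -> C R) (x d1 d2 : W) : hol f (q + phi x) -> hol g (q + phi x) ->
  inflection d1 d2 (fun x => f (q + phi x)) (fun x => g (q + phi x)) x =
  inflection (phi d1) (phi d2) f g (q + phi x).
Proof.
move=> hf hg.
have E d : \forall y \near x, wron d (fun x => f (q + phi x)) (fun x => g (q + phi x)) y =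
    wron (phi d) f g (q + phi y).
  by apply: filterS (near_pull (filterI hf hg)) => y [df dg]; rewrite /wron (derive_pull _ df) (derive_pull _ dg).
have D d d' : 'D_d' (wron d (fun x => f (q + phi x)) (fun x => g (q + phi x))) x =
   'D_(phi d') (wron (phi d) f g) (q + phi x).
  by rewrite (near_eq_derive _ (E d)) (derive_pull _ (hol_diff (hol_wron (phi d) hf hg))).
rewrite /inflection; apply: eq_qform; [exact: (nbhs_singleton (E d1))|exact: (nbhs_singleton (E d2))|exact: D|exact: D|exact: D|exact: D].
Qed.
End Pullback.

Section PlaneInflection.
Context {R : realType}.
Let V := 'rV[C R]_2.
Implicit Types (f g : V -> C R).

(** If a member of the pencil contains the line [lf a = 0] with multiplicity [m],
    so does the inflection: the Wronskian along the line is divisible by the same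
    power, and each term of the inflection contains it or its derivative along the
    line. *)
Lemma inflection_ldvd f g (c0 c1 a : C R) m : hol f 0 -> hol g 0 -> (c0 != 0) || (c1 != 0) ->
  ldvd a m (fun x => c0 * g x - c1 * f x) -> ldvd a m (inflection e1 e2 f g).
Proof.
move=> hf hg c01 [k hk E].
pose h x := c0 * g x - c1 * f x.
have hh : hol h 0 by apply: holB; apply: holM => //; exact: hol_cst.
pose T := dir a : V.
have dl x : differentiable (lf a) x by exact: hol_diff (hol_lf a x).
have lT x : 'D_T (lf a) x = 0.
  rewrite (deriveE _ (dl x)); have -> : 'd (lf a) x = lf a :> (V -> C R) by exact: diff_lin (@lf_continuous R a).
  by rewrite lf_dir subrr.
have lTm x n : 'D_T (fun y => lf a y ^+ n) x = 0.
  by rewrite (deX _ n (dl x)) lT mulr0.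
have dlm x n : differentiable (fun y : V => lf a y ^+ n) x by exact: hol_diff (holX n (hol_lf a x)).
have Dmul n u x : differentiable u x -> 'D_T (fun y => lf a y ^+ n * u y) x = lf a x ^+ n * 'D_T u x.
  by move=> du; rewrite (deM _ (dlm x n) du) lTm mulr0 addr0.
(* The equation [lf a] is constant in the direction [T] of its line. *)
have Dh : \forall x \near (0 : V), 'D_T h x = lf a x ^+ m * 'D_T k x.
  apply: filterS2 (nbhs_interior E) hk => x Ex dk.
  by rewrite (near_eq_derive _ Ex) (Dmul _ _ _ dk).
have [b hb Eb] : exists2 b, hol b 0 & \forall x \near (0 : V), wron T f g x = lf a x ^+ m * b x.
  have Dlin x : differentiable f x -> differentiable g x -> 'D_T h x = c0 * 'D_T g x - c1 * 'D_T f x.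
    move=> df dg; apply: (etrans (deB T (dfM (dfc c0 x) dg) (dfM (dfc c1 x) df))).
    by congr (_ - _); exact: deZ.
  have [c0n|] := boolP (c0 != 0).
    exists (fun x => c0^-1 * (f x * 'D_T k x - k x * 'D_T f x)).
      by apply: holM; [exact: hol_cst|apply: holB; apply: holM => //; exact: hol_derive].
    apply: filterS3 (filterI E Dh) hf hg => x [Ex Dx] df dg.
    apply: (mulfI c0n).
    have -> : c0 * wron T f g x = f x * 'D_T h x - h x * 'D_T f x.
      by rewrite /wron (Dlin _ df dg) /h;
      move: ('D_T f x) ('D_T g x) (f x) (g x) => *; ring.
    by rewrite Dx {1}/h Ex; move: ('D_T k x) ('D_T f x) ('D_T g x) (f x) (g x) (k x) (lf a x ^+ m) => *; field.
  move=> c0n; have c1n : c1 != 0 by move: c01; rewrite (negbTE c0n).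
  exists (fun x => c1^-1 * (g x * 'D_T k x - k x * 'D_T g x)).
    by apply: holM; [exact: hol_cst|apply: holB; apply: holM => //; exact: hol_derive].
  apply: filterS3 (filterI E Dh) hf hg => x [Ex Dx] df dg.
  apply: (mulfI c1n).
  have -> : c1 * wron T f g x = g x * 'D_T h x - h x * 'D_T g x.
    by rewrite /wron (Dlin _ df dg) /h;
      move: ('D_T f x) ('D_T g x) (f x) (g x) => *; ring.
  by rewrite Dx {1}/h Ex; move: ('D_T k x) ('D_T f x) ('D_T g x) (f x) (g x) (k x) (lf a x ^+ m) => *; field.
have hwT := hol_wron T hf hg; have hw1 := hol_wron e1 hf hg.
have DW : \forall x \near (0 : V), 'D_T (wron T f g) x = lf a x ^+ m * 'D_T b x.
  by apply: filterS2 (nbhs_interior Eb) hb => x Ex db; rewrite (near_eq_derive _ Ex) (Dmul _ _ _ db).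
exists (fun x => b x * (wron T f g x * 'D_e1 (wron e1 f g) x
   - wron e1 f g x * ('D_T (wron e1 f g) x + 'D_e1 (wron T f g) x)) + wron e1 f g x ^+ 2 * 'D_T b x).
  apply: holD.
    apply: holM => //; apply: holB; apply: holM => //; try exact: hol_derive.
    by apply: holD; exact: hol_derive.
  by apply: holM; [exact: holX|exact: hol_derive].
apply: filterS3 (filterI (hol_near hf) (hol_near hg)) Eb DW => x [hfx hgx] Ex Dx.
have -> : inflection e1 e2 f g x = inflection e1 T f g x.
  have := inflection_change 1 0 a 1 e1 e2 hfx hgx.
  by rewrite !scale1r scale0r addr0 -/(dir a) mulr1 mul0r subr0 expr1n mul1r => <-.
exact: qform_divides.
Qed.
End PlaneInflection.

(** * The projective line and the torus *)

Local Open Scope quotient_scope.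

Section ProjectiveLine.
Context {R : realType}.
Let V := 'rV[C R]_2.
Implicit Types (u w x : V) (c : P1 R).

Definition det2 u w : C R := zc u * wc w - wc u * zc w.

Lemma det2_colinear u w : u != 0 -> det2 u w = 0 -> exists k, w = k *: u.
Proof.
move=> u0 /eqP; rewrite subr_eq0 => /eqP E.
have [z0|z0] := eqVneq (zc u) 0.
  have w0 : wc u != 0.
    by apply: contra_neq u0 => w0; apply: planeP; rewrite !coordE.
  exists (wc w / wc u); apply: planeP; rewrite !coordE ?divfK// z0 mulr0.
  by move/eqP: E; rewrite z0 mul0r eq_sym mulf_eq0 (negbTE w0) => /eqP.
exists (zc w / zc u); apply: planeP; rewrite !coordE ?divfK//.
by rewrite -[LHS](mulKf z0) E; field.
Qed.

Lemma det2Z u k w : det2 u (k *: w) = k * det2 u w.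
Proof. by rewrite /det2 !coordE; ring. Qed.
Lemma det2xx u : det2 u u = 0. Proof. by rewrite /det2; ring. Qed.
Lemma det20 u : det2 u 0 = 0. Proof. by rewrite /det2 !coordE; ring. Qed.
Lemma det2C u w : det2 w u = - det2 u w. Proof. by rewrite /det2; ring. Qed.

Lemma homog_None w : homog w = None <-> w = 0.
Proof.
rewrite /homog; split => [|->].
  case: insubP => // /negP h _; apply/eqP; apply: contra_notT h => w0.
  by rewrite dim_vline w0.
by case: insubP => // c; rewrite dim_vline eqxx.
Qed.

(** Homogeneous coordinates of the point [c]. *)
Definition rp c : V := vpick (val c).

Lemma rp_neq0 c : rp c != 0.
Proof.
by rewrite vpick0 -dimv_eq0 (eqP (valP c)).
Qed.

Lemma rp_line c : <[rp c]>%VS = val c.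
Proof.
by apply/eqP; rewrite eqEdim -memvE memv_pick (eqP (valP c)) dim_vline rp_neq0.
Qed.

Lemma homog_Some w c : w != 0 -> homog w = Some c <-> det2 (rp c) w = 0.
Proof.
move=> w0; split.
  rewrite /homog; case: insubP => // c' _ E [ec]; subst c'.
  have : w \in val c by rewrite E memv_line.
  by rewrite -rp_line => /vlineP[k ->]; rewrite det2Z det2xx mulr0.
move=> /(det2_colinear (rp_neq0 c))[k E]; rewrite /homog.
have -> : <[w]>%VS = val c.
  apply/eqP; rewrite eqEdim (eqP (valP c)) dim_vline w0 andbT.
  by rewrite -memvE E memvZ// memv_pick.
exact: valK.
Qed.

Lemma homog_is_Some w : w != 0 -> exists c, homog w = Some c.
Proof.
by case E: (homog w) => [c|]; [exists c|move/homog_None: E => ->; rewrite eqxx].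
Qed.

Lemma homog_det2 u w c : u != 0 -> w != 0 -> homog u = Some c -> det2 u w = 0 -> homog w = Some c.
Proof.
move=> u0 w0 /(homog_Some _ u0) hu /(det2_colinear u0)[k E].
by apply/homog_Some => //; rewrite E det2Z hu mulr0.
Qed.

Lemma P1_infinite : ~ finite_set [set: P1 R].
Proof.
pose w n : V := e1 + n%:R *: e2.
have w0 n : w n != 0.
  by apply/eqP => /(congr1 zc) /eqP; rewrite !coordE mulr0 addr0 oner_eq0.
have [c hc] := @choice _ _ (fun n c => homog (w n) = Some c) (fun n => homog_is_Some (w0 n)).
move=> /(finite_preimage (f := c)) fin; apply: infinite_nat; apply: fin => m n _ _ E.
have : homog (w n) = Some (c m) by rewrite hc E.
move/(homog_Some _ (w0 n)) => dn; have /(homog_Some _ (w0 m)) dm := hc m.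
have [k ek] := det2_colinear (rp_neq0 (c m)) dm.
have [l el] := det2_colinear (rp_neq0 (c m)) dn.
have : det2 (w m) (w n) = 0 by rewrite el det2Z ek det2C det2Z det2xx mulr0 oppr0 mulr0.
rewrite /det2 !coordE !mulr0 !mulr1 !addr0 !add0r mul1r mulr1 => /eqP.
by rewrite subr_eq0 eqr_nat => /eqP.
Qed.

End ProjectiveLine.

Section Torus.
Context {R : realType} {B : 'M[C R]_(2 + 2, 2)}.
Let V := 'rV[C R]_2.
Let pi : V -> torus B := \pi_(torus B).

Lemma piD x y : pi (x + y) = pi x + pi y.
Proof. exact: (raddfD (\pi_(torus B))). Qed.

Lemma pi_eq x y : (pi x = pi y) <-> x - y \in Zspan B.
Proof.
rewrite /pi ring_quotient.Quotient.idealrBE; split => [->|/eqP//]; exact: eqxx.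
Qed.

Lemma pi_surj (p : torus B) : exists x, p = pi x.
Proof. by exists (repr p); rewrite /pi reprK. Qed.

Lemma torus_projection_continuous : continuous pi.
Proof. by apply/continuousP => U. Qed.

Lemma pi_open (U : set V) : open U -> open (pi @` U).
Proof.
move=> oU; suff : open (pi @^-1` (pi @` U)) by [].
have -> : pi @^-1` (pi @` U) = \bigcup_(l in [set` Zspan B]) ((fun x => x + l) @^-1` U).
  apply/seteqP; split => x /=.
    move=> [y Uy /esym/pi_eq h]; exists (y - x); last by rewrite /= addrC subrK.
    by rewrite /= -opprB rpredN.
  move=> [l /= hl Ul]; exists (x + l) => //; apply/pi_eq.
  by rewrite addrAC subrr add0r.
apply: bigcup_open => l _; apply: open_comp => // x _.
exact: (@cvgD _ _ _ (nbhs x) _ id (fun=> l) x l cvg_id (cvg_cst l)).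
Qed.
End Torus.

(** * Connectedness and local representatives *)

Section Connectedness.
Context {R : realType} {W : normedModType (C R)}.

Lemma segment_continuous (p v : W) : continuous (fun s : R => p + rc s *: v).
Proof.
move=> s; have h1 : (fun s : R => rc s *: v) @ s --> rc s *: v.
  exact: (@cvgZr_tmp _ _ _ (nbhs s) _ (fun s : R => rc s) (rc s) v (@continuous_rc R s)).
exact: (cvgD (cvg_cst p) h1).
Qed.

(** A normed space is connected, by its segments. *)
Lemma clopen_all (A : set W) : (forall x, A x -> \forall y \near x, A y) ->
  (forall x, ~ A x -> \forall y \near x, ~ A y) -> forall p q, A p -> A q.
Proof.
move=> oA cA p q Ap; pose g (s : R) := p + rc s *: (q - p).
have gc : continuous g by exact: segment_continuous.
pose D := g @^-1` A.
have oD : open D by apply: open_comp => [x _|]; [exact: gc|rewrite openE => x; exact: oA].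
have cD : closed D.
  rewrite -openC; have -> : ~` D = g @^-1` (~` A) by [].
  by apply: open_comp => [x _|]; [exact: gc|rewrite openE => x; exact: cA].
have I0 : `[0, 1]%classic (0 : R) by rewrite /= in_itv /= lexx ler01.
have I1 : `[0, 1]%classic (1 : R) by rewrite /= in_itv /= lexx ler01.
have E : `[0, 1]%classic `&` D = `[0, 1]%classic.
  apply: (@segment_connected R 0 1).
  - by exists 0; split => //; rewrite /D /g /= rc0 scale0r addr0.
  - by exists D.
  - by exists D.
move: I1; rewrite -E => -[_]; rewrite /D /g /= rc1 scale1r addrC subrK //.
Qed.

(** The identity theorem for a set that is locally the zero set of a holomorphic
    function. *)
Lemma analytic_all (Z : set W) (p : W) :
  (forall x, exists2 k : W -> C R, hol k x & \forall y \near x, k y = 0 <-> Z y) ->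
  (\forall y \near p, Z y) -> forall x, Z x.
Proof.
move=> hZ Zp x.
suff : \forall y \near x, Z y by exact: nbhs_singleton.
apply: (@clopen_all (fun x => \forall y \near x, Z y) _ _ p) => // y.
  exact: nbhs_interior.
have [k hk E] := hZ y; move=> nZ.
apply: filterS2 (hol_identity hk) (nbhs_interior E) => y' H E' Zy'; apply: nZ.
have /H k0 : \forall z \near y', k z = 0 by apply: filterS2 E' Zy' => z ez /ez.
by apply: filterS2 E k0 => z ez /ez.
Qed.
End Connectedness.

Lemma line_continuous (R : realType) (V : normedModType (C R)) (x v : V) :
  continuous (fun s : C R => x + s *: v).
Proof.
move=> t; apply: differentiable_continuous; exact: ex_diff.
Qed.

Section Representatives.
Context {R : realType} {B : 'M[C R]_(2 + 2, 2)}.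
Variable f : torus B -> option (P1 R).
Hypothesis hf : meromorphic f.
Let V := 'rV[C R]_2.
Implicit Types (F G : V -> V) (x y p q u v : V) (c : P1 R).
Let pi : V -> torus B := \pi_(torus B).

(** Homogeneous coordinates for [f] near [x], whose common zeros are the indeterminacy
    points.  Unlike the definition of meromorphy, this is an open condition on [x]. *)
Definition locrep F x := \forall y \near x, differentiable F y /\ f (pi y) = homog (F y).

Lemma locrep_near F x : locrep F x -> \forall y \near x, locrep F y.
Proof. exact: nbhs_interior. Qed.

Lemma locrep_exists q : exists2 F, locrep F q & \forall x \near q, F x = 0 -> x = q.
Proof.
have [F H] := hf q; exists F; first by apply: filterS H => x [].
by apply: filterS H => x [].
Qed.

Lemma locrep_hol F x : locrep F x -> hol (fun y => zc (F y)) x /\ hol (fun y => wc (F y)) x.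
Proof.
move=> hF; split; apply: filterS hF => y [dF _]; apply: (differentiable_comp dF); exact: differentiable_coord.
Qed.

Definition lam u F x := det2 u (F x).

Lemma hol_lam u F x : locrep F x -> hol (lam u F) x.
Proof.
move=> /locrep_hol[h1 h2]; apply: holB; apply: holM => //; exact: hol_cst.
Qed.

(** The fiber over [c], lifted to the plane, before taking the closure and with
    the indeterminacy points added. *)
Definition level c x := f (pi x) = None \/ f (pi x) = Some c.

Lemma lamZ F x c : f (pi x) = homog (F x) -> lam (rp c) F x = 0 <-> level c x.
Proof.
rewrite /level /lam => ->; have [->|F0] := eqVneq (F x) 0.
  by rewrite det20; split => // _; left; apply/homog_None.
split; first by move=> h; right; apply/homog_Some.
case; last by move/homog_Some; exact.
by move/homog_None => E; rewrite E eqxx in F0.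
Qed.

Lemma locrep_lamZ F x c : locrep F x -> \forall y \near x, lam (rp c) F y = 0 <-> level c y.
Proof. by apply: filterS => y [_]; exact: lamZ. Qed.

Lemma indet_isolated q : \forall x \near q, f (pi x) = None -> x = q.
Proof.
have [F hF F0] := locrep_exists q.
by apply: filterS2 hF F0 => x [_ ->] h /homog_None.
Qed.

Lemma Z_all c p : (\forall x \near p, level c x) -> forall x, level c x.
Proof.
apply: analytic_all => x; have [F hF _] := locrep_exists x.
by exists (lam (rp c) F); [exact: hol_lam|exact: locrep_lamZ].
Qed.

Lemma Z_line c x v : (\forall t \near (0 : C R), level c (x + t *: v)) -> forall t : C R, level c (x + t *: v).
Proof.
move=> H; refine (@analytic_all R (C R) (fun t => level c (x + t *: v)) 0 _ H) => t.
have [F hF _] := locrep_exists (x + t *: v).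
exists (fun s : C R => lam (rp c) F (x + s *: v)); first exact: hol_line (hol_lam _ hF).
exact: (line_continuous (locrep_lamZ c hF)).
Qed.

(** Away from indeterminacy, both coordinates of one representative are obtained from
    those of the other by the same factor, a quotient of nonzero coordinates. *)
Lemma rep_ratio F G x : locrep F x -> locrep G x -> F x != 0 -> G x != 0 ->
  exists u : V -> C R, [/\ hol u x, u x != 0 & \forall y \near x, G y = u y *: F y].
Proof.
move=> hF hG F0 G0.
have [hz hw] := locrep_hol hF; have [gz gw] := locrep_hol hG.
have co y : f (pi y) = homog (F y) -> f (pi y) = homog (G y) -> F y != 0 -> exists k, G y = k *: F y.
  move=> eF eG Fy0; apply: det2_colinear => //.
  have [c Fc] := homog_is_Some Fy0.
  have [G0'|Gy0] := eqVneq (G y) 0; first by rewrite G0' det20.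
  have /(homog_Some _ Fy0) dF := Fc.
  move: Fc; rewrite -eF eG => /(homog_Some _ Gy0) dG.
  have [k ek] := det2_colinear (rp_neq0 c) dF.
  have [l el] := det2_colinear (rp_neq0 c) dG.
  by rewrite el det2Z ek det2C det2Z det2xx mulr0 oppr0 mulr0.
have main (p : V -> C R) : (forall a y, p (a *: y) = a * p y) -> p 0 = 0 ->
    hol (fun y => p (F y)) x -> hol (fun y => p (G y)) x -> p (F x) != 0 ->
    exists u : V -> C R, [/\ hol u x, u x != 0 & \forall y \near x, G y = u y *: F y].
  move=> pZ p0 hpF hpG pF0.
  have E : \forall y \near x, G y = (p (G y) / p (F y)) *: F y.
    apply: filterS3 (hol_neq0 hpF pF0) hF hG => y pFy [_ eF] [_ eG].
    have Fy0 : F y != 0 by apply: contra_neq pFy => ->.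
    by have [k ->] := co y eF eG Fy0; rewrite pZ mulfK.
  exists (fun y => p (G y) / p (F y)); split => //.
    by apply: holM => //; exact: holV.
  by apply: contra_neq G0 => h; rewrite (nbhs_singleton E) h scale0r.
have [z0|] := eqVneq (zc (F x)) 0; last by apply: (main zc) => //; [exact: zcZ|exact: zc0].
apply: (main wc) => //; [exact: wcZ|exact: wc0|].
by apply: contra_neq F0 => w0; apply: planeP; rewrite !coordE.
Qed.

Lemma piDl x l : l \in Zspan B -> pi (x + l) = pi x.
Proof. by move=> hl; apply/pi_eq; rewrite addrAC subrr add0r. Qed.

Lemma locrep_shift F x l : l \in Zspan B -> locrep F x -> locrep (fun y => F (y + l)) (x - l).
Proof.
move=> hl hF; have cont : (fun y => y + l) @ (x - l) --> x.
  rewrite -[X in _ --> X](subrK l).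
  exact: (@cvgD _ _ _ (nbhs (x - l)) _ id (fun=> l) (x - l) l cvg_id (cvg_cst l)).
have H : \forall y \near x - l, differentiable F (y + l) /\ f (pi (y + l)) = homog (F (y + l)).
  exact: (cont _ hF).
apply: filterS H => y H; have [dF e] := H; split.
  have d : differentiable (fun y : V => y + l) y by exact: (differentiableD (dfi y) (dfc l y)).
  exact: (@differentiable_comp _ _ _ _ (fun y : V => y + l) F y d dF).
by rewrite -e piDl.
Qed.
End Representatives.

(** * Linear fibers, and linear changes of coordinates *)

Section LinearFibers.
Context {R : realType} {B : 'M[C R]_(2 + 2, 2)}.
Variable f : torus B -> option (P1 R).
Hypothesis hf : meromorphic f.
Let V := 'rV[C R]_2.
Implicit Types (F G : V -> V) (x y p q u v : V) (c : P1 R).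
Let pi : V -> torus B := \pi_(torus B).

(** The points near which [f] misses [c] form an open set, and the projection to the
    torus is open, so that taking the closure adds only indeterminacy points. *)
Lemma fiber_Z c x : fiber f c (pi x) -> level f c x.
Proof.
move=> hx; have [F hF _] := locrep_exists hf x.
apply/(lamZ _ (nbhs_singleton hF).2); apply: contrapT => /eqP l0.
have H : \forall y \near x, ~ level f c y.
  apply: filterS2 (hol_neq0 (hol_lam (rp c) hF) l0) hF => y ly [_ e] /(lamZ _ e) E.
  by rewrite E eqxx in ly.
have N : nbhs (pi x) (pi @` [set y | ~ level f c y]^°).
  apply: open_nbhs_nbhs; split; first by apply: pi_open; exact: open_interior.
  by exists x.
have [z [h [y /nbhs_singleton nZ E]]] := hx _ N.
by apply: nZ; right; rewrite -/pi E.
Qed.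

Lemma Some_fiber c x : f (pi x) = Some c -> fiber f c (pi x).
Proof. by move=> h; apply: subset_closure. Qed.

Lemma linear_line c y : linear_subset (fiber f c) -> fiber f c (pi y) ->
  exists v, [/\ v != 0, is_lattice [set z : 'rV[C R]_1 | z *m v \in Zspan B]
   & forall t : C R, fiber f c (pi (y + t *: v))].
Proof.
move=> [S0 hS E]; rewrite E => -[S S0S Sy].
have [p [T [v [v0 lat ET]] ES]] := hS _ S0S.
exists v; split=> // t; exists S => //; move: Sy; rewrite ES ET => -[_ [z _ <-] Ey].
exists (pi ((z + t%:M) *m v)); first by exists (z + t%:M).
rewrite mulmxDl mul_scalar_mx; apply: (etrans (congr1 (+%R p) (piD _ _))).
by rewrite addrA Ey; exact/esym/piD.
Qed.
End LinearFibers.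

Section Directions.
Context {R : realType}.
Let V := 'rV[C R]_2.
Implicit Types (h : V -> C R) (x y q v : V).

(** If [h] vanished along all lines through [q], it would vanish near [q]. *)
Lemma nz_direction h q : hol h q -> nz h q ->
  exists2 v, v != 0 & nz (fun t : C R => h (q + t *: v)) 0.
Proof.
move=> hh nh; have [q0|q0] := eqVneq (h q) 0; last first.
  have e10 : e1 != 0 :> V by apply/eqP => /(congr1 zc)/eqP; rewrite !coordE oner_eq0.
  exists e1 => //; apply: neq0_nz; by rewrite scale0r addr0.
have [d d0 hd] := nbhs_dist hh.
apply: contrapT => no; apply: nh; apply: (dist_nbhs (d := d / 64%:R)).
  by rewrite divr_gt0// ltr0n.
move=> x hx; have [->//|xq] := eqVneq x q.
apply: contrapT => /eqP hx0; apply: no; exists (x - q); first by rewrite subr_eq0.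
move=> k0; move/eqP: hx0; apply.
have -> : h x = h (q + (1 : C R) *: (x - q)) by rewrite scale1r addrC subrK.
have r0 : 0 < 8%:R :> C R by rewrite ltr0n.
refine (@disc_identity _ (fun t : C R => h (q + t *: (x - q))) _ r0 _ k0 1 _).
  move=> w hw; have dl : differentiable (fun t : C R => q + t *: (x - q)) w by exact: ex_diff.
  apply: (differentiable_comp dl); apply: hd.
  rewrite addrAC subrr add0r normrZ.
  have [n0|n0] := eqVneq `|x - q| 0; first by rewrite n0 mulr0.
  have np : 0 < `|x - q| by rewrite lt_def n0 normr_ge0.
  have : `|w| * `|x - q| < 64%:R * `|x - q| by rewrite ltr_pM2r// (lt_le_trans hw)// -natrM.
  by move/lt_trans; apply; rewrite mulrC -ltr_pdivlMr// ltr0n.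
by rewrite normr1 divff// gt_eqF.
Qed.

Lemma transverse v : v != 0 -> exists w, det2 v w != 0.
Proof.
move=> v0; have [z0|z0] := eqVneq (zc v) 0.
  exists e1; rewrite /det2 !coordE mulr0 mulr1 sub0r oppr_eq0.
  by apply: contra_neq v0 => w0; apply: planeP; rewrite !coordE.
by exists e2; rewrite /det2 !coordE mulr0 mulr1 subr0.
Qed.

(** The linear map sending the standard basis to [v1] and [v2]. *)
Definition comb (v1 v2 : V) x : V := zc x *: v1 + wc x *: v2.
Lemma comb_is_linear v1 v2 : linear (comb v1 v2).
Proof.
move=> a x y; rewrite /comb; apply: planeP; rewrite !coordE; ring.
Qed.
HB.instance Definition _ v1 v2 := GRing.isLinear.Build _ _ _ _ (comb v1 v2) (comb_is_linear v1 v2).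

Lemma comb_continuous v1 v2 : continuous (comb v1 v2).
Proof.
have c (p : V -> C R) v : continuous p -> continuous (fun x => p x *: v).
  by move=> hp x; exact: (@cvgZr_tmp _ _ _ (nbhs x) _ p (p x) v (hp x)).
by move=> x; exact: (cvgD (c zc v1 (@zc_continuous R) x) (c wc v2 (@wc_continuous R) x)).
Qed.

Lemma zc_comb v1 v2 x : zc (comb v1 v2 x) = zc x * zc v1 + wc x * zc v2.
Proof. by rewrite /comb zcD !zcZ. Qed.
Lemma wc_comb v1 v2 x : wc (comb v1 v2 x) = zc x * wc v1 + wc x * wc v2.
Proof. by rewrite /comb wcD !wcZ. Qed.

Lemma comb_inverse v1 v2 : det2 v1 v2 != 0 -> exists w1 w2,
  (forall y, comb v1 v2 (comb w1 w2 y) = y) /\ (forall y, comb w1 w2 (comb v1 v2 y) = y).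
Proof.
move=> D0; pose D := det2 v1 v2.
pose w1 : V := (wc v2 / D) *: e1 - (wc v1 / D) *: e2.
pose w2 : V := (zc v1 / D) *: e2 - (zc v2 / D) *: e1.
have z1 : zc w1 = wc v2 / D by rewrite /w1 zcB !zcZ zce1 zce2 mulr1 mulr0 subr0.
have t1 : wc w1 = - wc v1 / D by rewrite /w1 wcB !wcZ wce1 wce2 mulr1 mulr0 sub0r mulNr.
have z2 : zc w2 = - zc v2 / D by rewrite /w2 zcB !zcZ zce1 zce2 mulr1 mulr0 sub0r mulNr.
have t2 : wc w2 = zc v1 / D by rewrite /w2 wcB !wcZ wce1 wce2 mulr1 mulr0 subr0.
exists w1, w2; clearbody w1 w2.
move: D0 z1 t1 z2 t2; rewrite /D /det2 => D0 z1 t1 z2 t2.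
split => y; apply: planeP; rewrite !(zc_comb, wc_comb) ?z1 ?t1 ?z2 ?t2; move: D0;
  by move: (zc v1) (wc v1) (zc v2) (wc v2) (zc y) (wc y) => ? ? ? ? ? ? ?; field.
Qed.

Lemma comb_e1 v1 v2 t : comb v1 v2 (t *: e1) = t *: v1.
Proof. by rewrite /comb !coordE mulr1 mulr0 scale0r addr0. Qed.
Lemma comb_e2 v1 v2 : comb v1 v2 e2 = v2.
Proof. by rewrite /comb !coordE scale1r scale0r add0r. Qed.
End Directions.

(** * Divisibility of the inflection *)

Section Products.
Context {R : realType} {V : normedModType (C R)} {I : eqType}.
Implicit Types (h : I -> V -> C R) (s : seq I) (x : V).

Lemma hol_prod h s x : (forall i, i \in s -> hol (h i) x) -> hol (fun y => \prod_(i <- s) h i y) x.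
Proof.
elim: s => [|i s IH] H.
  by apply: hol_ext (hol_cst 1 x) => y; rewrite big_nil.
apply: (@hol_ext _ _ (fun y => h i y * \prod_(j <- s) h j y)) => [y|]; first by rewrite big_cons.
apply: holM; first by apply: H; rewrite mem_head.
by apply: IH => j js; apply: H; rewrite in_cons js orbT.
Qed.

Lemma nz_prod h s x : (forall i, i \in s -> hol (h i) x) -> (forall i, i \in s -> nz (h i) x) ->
  nz (fun y => \prod_(i <- s) h i y) x.
Proof.
elim: s => [|i s IH] H N.
  by apply: neq0_nz; rewrite big_nil oner_eq0.
have -> : (fun y => \prod_(j <- i :: s) h j y) = (fun y => h i y * \prod_(j <- s) h j y).
  by apply/funext => y; rewrite big_cons.
have Hs j : j \in s -> hol (h j) x by move=> js; apply: H; rewrite in_cons js orbT.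
apply: nzM; [by apply: H; rewrite mem_head|exact: hol_prod|by apply: N; rewrite mem_head|].
by apply: IH => // j js; apply: N; rewrite in_cons js orbT.
Qed.

Lemma nz_factor h s x i : i \in s -> nz (fun y => \prod_(i <- s) h i y) x -> nz (h i) x.
Proof.
move=> si N h0; apply: N; apply: filterS h0 => y h0.
by rewrite (perm_big _ (perm_to_rem si)) big_cons /= h0 mul0r.
Qed.

Lemma near_all s x (P : I -> V -> Prop) : (forall i, i \in s -> \forall y \near x, P i y) ->
  \forall y \near x, forall i, i \in s -> P i y.
Proof.
elim: s => [|i s IH] H; first by apply: nearW.
have Hs : \forall y \near x, forall j, j \in s -> P j y.
  by apply: IH => j js; apply: H; rewrite in_cons js orbT.
have Hi : \forall y \near x, P i y by apply: H; rewrite mem_head.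
by apply: filterS2 Hi Hs => y Pi Ps j; rewrite in_cons => /orP[/eqP->//|/Ps].
Qed.
End Products.

Section Local.
Context {R : realType} {B : 'M[C R]_(2 + 2, 2)}.
Variable f : torus B -> option (P1 R).
Hypothesis hf : meromorphic f.
Let V := 'rV[C R]_2.
Implicit Types (F G : V -> V) (x y p q u v : V) (c : P1 R).
Let pi : V -> torus B := \pi_(torus B).

Variable cs : seq (P1 R).
Hypothesis ucs : uniq cs.
Hypothesis linear_cs : forall c, c \in cs -> linear_subset (fiber f c).

Definition Infl F x := inflection e1 e2 (fun y => zc (F y)) (fun y => wc (F y)) x.
Definition Plam F x := \prod_(c <- cs) lam (rp c) F x.

(** Except for the isolated zero of [F], the zeros of [lam c F] are points of the fiber
    over [c], each of which lies on a line contained in this fiber. *)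
Lemma lam_zero_lines F q v1 v2 c : det2 v1 v2 != 0 -> c \in cs ->
  locrep f F q -> (\forall x \near q, F x = 0 -> x = q) ->
  zero_lines (fun x => lam (rp c) F (q + comb v1 v2 x)).
Proof.
move=> D hc hF F0.
have [w1 [w2 [W1 W2]]] := comb_inverse D.
have q0 : q + comb v1 v2 0 = q by rewrite linear0 addr0.
have H : \forall x \near (0 : V), (differentiable F (q + comb v1 v2 x) /\
    f (pi (q + comb v1 v2 x)) = homog (F (q + comb v1 v2 x))) /\
   (F (q + comb v1 v2 x) = 0 -> q + comb v1 v2 x = q).
  have H0 : \forall y \near q + comb v1 v2 0, (differentiable F y /\ f (pi y) = homog (F y)) /\ (F y = 0 -> y = q).
    by rewrite q0; exact: filterI hF F0.
  exact: near_pull (@comb_continuous R v1 v2) _ _ H0.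
have [rho rho0 hrho] := nbhs_dist H.
exists rho => // y hy y0 l0; rewrite -(subr0 y) in hy; have [[_ e] Fy0] := hrho _ hy.
have Fy : F (q + comb v1 v2 y) != 0.
  apply/eqP => /Fy0 /(canRL (addKr q)); rewrite addNr => E.
  by move: y0; rewrite -(W2 y) E linear0 eqxx.
have /(lamZ _ e) [E|E] := l0.
  by move/eqP: Fy; case; apply/homog_None; rewrite -e.
have [v [v0 _ hv]] := linear_line (linear_cs hc) (Some_fiber E).
exists (comb w1 w2 v); first by apply/eqP => E'; move: v0; rewrite -(W1 v) E' linear0 eqxx.
move=> t; rewrite -{1}(subr0 (y + _)) => /hrho[[_ e'] _]; apply/(lamZ _ e').
have -> : q + comb v1 v2 (y + t *: comb w1 w2 v) = q + comb v1 v2 y + t *: v.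
  by rewrite linearD linearZ /= W1 addrA.
apply: (fiber_Z hf); exact: hv.
Qed.

(** In coordinates such that the horizontal axis is in none of the fibers, the equations of
    the fibers factor into linear forms, pairwise distinct for distinct fibers, and
    each of them divides the inflection with its multiplicity. *)
Lemma inflection_divisible F q : locrep f F q -> (\forall x \near q, F x = 0 -> x = q) ->
  (forall c, c \in cs -> nz (lam (rp c) F) q) ->
  exists2 K, hol K q & \forall x \near q, Infl F x = Plam F x * K x.
Proof.
move=> hF F0 hnz.
have hl c : hol (lam (rp c) F) q by exact: (hol_lam _ hF).
have [v1 v10 nzv1] := nz_direction (hol_prod (fun c (_ : c \in cs) => hl c)) (nz_prod (fun c _ => hl c) hnz).
have [v2 D] := transverse v10.
have [w1 [w2 [W1 W2]]] := comb_inverse D.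
pose phi : {linear V -> V} := comb v1 v2; pose h c x := lam (rp c) F (q + phi x).
have q0 : q = q + phi 0 by rewrite linear0 addr0.
have phic : continuous phi := @comb_continuous R v1 v2.
have hh c : hol (h c) 0 by apply: (hol_pull (phi := phi) phic); rewrite -q0.
have /choice[S hS] c : exists s, c \in cs -> exists u : V -> C R, [/\ hol u 0, u 0 != 0 & \forall x \near (0:V), h c x = lprod s x * u x].
  have [hc|/negP hc] := boolP (c \in cs); last by exists [::].
  have [||s [u su]] := @zero_lines_factor R _ (hh c); first 2 last.
  - by exists s => _; exists u.
  - have := nz_factor hc nzv1.
    by congr nz; apply/funext => t; rewrite /h /phi /= comb_e1.
  - exact: lam_zero_lines.
have /choice[U hU] c : exists u : V -> C R, c \in cs -> [/\ hol u 0, u 0 != 0 & \forall x \near (0:V), h c x = lprod (S c) x * u x].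
  have [hc|/negP hc] := boolP (c \in cs); last by exists (fun=> 0).
  by have [u hu] := hS c hc; exists u.
(* A line common to two fibers would consist of zeros of [F]. *)
have slopes c c' a : c \in cs -> c' \in cs -> a \in S c -> a \in S c' -> c = c'.
  move=> hc hc' ac ac'; apply: contrapT => cc'.
  have [_ _ Ec] := hU c hc; have [_ _ Ec'] := hU c' hc'.
  have near0 : \forall x \near (0 : V), F (q + phi x) = 0 -> x = 0.
    have H0 : \forall y \near q + phi 0, F y = 0 -> y = q by rewrite -q0.
    apply: filterS (near_pull phic H0) => x H /H /(canRL (addKr q)); rewrite addNr => E.
    by rewrite -(W2 x) [comb v1 v2 x]E linear0.
  have [d d0 hd] := nbhs_dist (filterI near0 (filterI Ec Ec')).
  have dirn : 0 < `|dir a : V| by rewrite normr_gt0; apply/eqP => /(congr1 wc)/eqP; rewrite wc_dir wc0 oner_eq0.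
  pose t := d / 2%:R / `|dir a : V|.
  have t0 : 0 < t by rewrite !divr_gt0// ltr0n.
  have ht : `|t *: dir a - 0| < d.
    by rewrite subr0 normrZ (gtr0_norm t0) divfK ?gt_eqF// ltr_pdivrMr ?ltr0n// ltr_pMr// ltr1n.
  have [n0 [Ea Eb]] := hd _ ht.
  have lz s : a \in s -> lprod s (t *: dir a) = 0.
    move=> sa; rewrite (lprod_count a s) linearZ /= lf_dir subrr scaler0 expr0n.
    have : (0 < count_mem a s)%N by rewrite -has_count has_pred1.
    by rewrite lt0n => /negbTE ->; rewrite mul0r.
  move: Ea Eb; rewrite !lz// !mul0r => Ea Eb.
  have F00 : F (q + phi (t *: dir a)) = 0.
    apply: contrapT => /eqP Fn0; apply: cc'.
    have := Ea; rewrite /h /lam => /(homog_Some _ Fn0) E1.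
    by have := Eb; rewrite /h /lam => /(homog_Some _ Fn0); rewrite E1 => -[].
  move/eqP: (n0 F00); rewrite scaler_eq0 (gt_eqF t0) /= => /eqP E.
  by move: dirn; rewrite E normr0 ltxx.
pose fl := flatten [seq S c | c <- cs].
have count_fl a c : c \in cs -> a \in S c -> count_mem a fl = count_mem a (S c).
  move=> hc ac.
  rewrite count_flatten -map_comp sumnE big_map (bigD1_seq c)//= big1_seq ?addn0// => b /andP[bc hb].
  by apply/count_memPn/negP => ab; move/eqP: bc; apply; exact: slopes ab ac.
have [hz hw] := locrep_hol hF.
pose f0 x := zc (F (q + phi x)); pose g0 x := wc (F (q + phi x)).
have hf0 : hol f0 0 by apply: (@hol_pull _ _ _ q phi phic (fun y => zc (F y))); rewrite -q0.
have hg0 : hol g0 0 by apply: (@hol_pull _ _ _ q phi phic (fun y => wc (F y))); rewrite -q0.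
have hI : hol (inflection e1 e2 f0 g0) 0 by exact: hol_inflection.
have [a|k hk Ek] := lprod_dvd (s := fl) hI.
  have [/flattenP[_ /mapP[c hc ->] ac]|an] := boolP (a \in fl); last first.
    have E0 : \forall x \near (0 : V), inflection e1 e2 f0 g0 x = lf a x ^+ count_mem a fl * inflection e1 e2 f0 g0 x.
      by apply: filterS hI => x _; rewrite (count_memPn an) expr0 mul1r.
    by exists (inflection e1 e2 f0 g0).
  rewrite (count_fl _ _ hc ac); apply: (@inflection_ldvd _ _ _ (zc (rp c)) (wc (rp c))) => //.
    rewrite -negb_and; apply: contra (rp_neq0 c) => /andP[/eqP z0 /eqP w0].
    by apply/eqP; apply: planeP; rewrite !coordE.
  have [hu u0 E] := hU c hc.
  exists (fun x => lprod [seq b <- S c | b != a] x * U c x); first by apply: holM => //; exact: hol_lprod.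
  by apply: filterS E => x; rewrite (lprod_count a (S c)) mulrA => <-.
pose UU x := \prod_(c <- cs) U c x.
have hUU : hol UU 0 by apply: hol_prod => c /hU[].
have UU0 : UU 0 != 0 by rewrite prodf_seq_neq0; apply/allP => c /hU[].
pose K0 x := (det2 v1 v2 ^- 2) * (k x * (UU x)^-1).
have hK0 : hol K0 0.
  by apply: holM; [exact: hol_cst|apply: holM => //; exact: holV].
have E0 : \forall x \near (0 : V), Infl F (q + phi x) = Plam F (q + phi x) * K0 x.
  have HU : \forall x \near (0:V), forall c, c \in cs -> h c x = lprod (S c) x * U c x.
    by apply: near_all => c /hU[].
  have Hz : \forall x \near (0 : V), hol (fun y => zc (F y)) (q + phi x) /\ hol (fun y => wc (F y)) (q + phi x).
    have H0 : \forall y \near q + phi 0, hol (fun y => zc (F y)) y /\ hol (fun y => wc (F y)) y.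
      by rewrite -q0; exact: filterI (hol_near hz) (hol_near hw).
    exact: near_pull phic _ _ H0.
  apply: filterS3 (filterI HU (hol_neq0 hUU UU0)) Hz Ek => x [Hx UUx] [hzx hwx] Ekx.
  have := inflection_pull phic e1 e2 hzx hwx.
  rewrite -/(f0) -/(g0) Ekx.
  have -> : phi e1 = v1 by rewrite -[e1]scale1r /phi /= comb_e1 scale1r.
  have -> : phi e2 = v2 by exact: comb_e2.
  have := inflection_change (zc v1) (wc v1) (zc v2) (wc v2) e1 e2 hzx hwx.
  rewrite -!planeE -/(det2 v1 v2) => -> E.
  have EP : Plam F (q + phi x) = lprod fl x * UU x.
    rewrite /Plam /UU /lprod /fl big_flatten big_map -big_split /=.
    by apply: eq_big_seq => c hc; exact: Hx.
  apply: (mulfI (expf_neq0 2 D)); rewrite /Infl -E EP /K0; move: UUx D.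
  move: (UU x) (lprod fl x) (k x) (det2 v1 v2) => a b e l a0 l0; by field; rewrite l0 a0.
pose psi y := comb w1 w2 (y - q).
have dpsi y : differentiable psi y.
  have d1 : differentiable (fun y : V => y - q) y by exact: (differentiableD (dfi y) (dfc (- q) y)).
  apply: (@differentiable_comp _ _ _ _ (fun y : V => y - q) (comb w1 w2) y d1).
  by apply: linear_differentiable; exact: comb_continuous.
have psiq : psi q = 0 by rewrite /psi subrr linear0.
exists (fun y => K0 (psi y)).
  by apply: (@hol_comp R V V psi K0 q dpsi); rewrite psiq.
have psic : {for q, continuous psi} by exact: differentiable_continuous.
have H1 : \forall y \near q, Infl F (q + phi (psi y)) = Plam F (q + phi (psi y)) * K0 (psi y).
  by rewrite -psiq in E0; exact: (psic _ E0).
apply: filterS H1 => y; suff -> : q + phi (psi y) = y by [].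
by rewrite /phi /psi /= W1 addrC subrK.
Qed.
End Local.

(** * Periodic functions *)

Section Periodic.
Context {R : realType} {B : 'M[C R]_(2 + 2, 2)}.
Hypothesis hB : period_matrix B.
Let V := 'rV[C R]_2.

Lemma mxrc_coord (u : 'rV[R]_(2 + 2)) j : (map_mx (real_complex R : R -> C R) u *m B) 0 j =
  rc ((u *m map_mx re B) 0 j) + ci * rc ((u *m map_mx im B) 0 j).
Proof.
have S (F : 'I_(2 + 2) -> R) : rc (\sum_i F i) = \sum_i rc (F i) by exact: (rmorph_sum (real_complex R)).
rewrite !mxE !S mulr_sumr -big_split /=; apply: eq_bigr => i _.
rewrite !mxE [in LHS](rcE (B i j)) !rcM -/(rc (u 0 i)); ring.
Qed.

(** Four vectors independent over the reals generate a space of real dimension 4. *)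
Lemma real_coordinates (x : V) : exists u : 'rV[R]_(2 + 2),
  x = map_mx (real_complex R : R -> C R) u *m B.
Proof.
pose A : 'M[R]_(2 + 2) := row_mx (map_mx re B) (map_mx im B).
have uA : A \in unitmx.
  rewrite -row_free_unit -kermx_eq0; apply/rowV0P => u /sub_kermxP.
  rewrite mul_mx_row => E.
  have /eq_row_mx[r0 i0] : row_mx (u *m map_mx re B) (u *m map_mx im B) = row_mx 0 0.
    by rewrite row_mx0.
  have := hB (u := u); apply.
  by apply/rowP => j; rewrite mxrc_coord r0 i0 !mxE rc0 mulr0 addr0.
pose u := row_mx (map_mx re x) (map_mx im x) *m invmx A; exists u.
have E : row_mx (map_mx re x) (map_mx im x) = u *m A by rewrite /u mulmxKV.
move: E; rewrite mul_mx_row => /eq_row_mx[Er Ei].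
apply/rowP => j; rewrite mxrc_coord -Er -Ei !mxE; exact: rcE.
Qed.

(** Subtract the integral parts of the real coordinates. *)
Lemma Zspan_reduce : exists M : C R, forall x : V, exists2 l, l \in Zspan B & `|x - l| <= M.
Proof.
exists (\sum_i `|row i B|) => x; have [u ->] := real_coordinates x.
exists (map_mx intr (map_mx Num.floor u) *m B).
  by apply/asboolP; exists (map_mx Num.floor u).
rewrite -mulmxBl mulmx_sum_row; apply: le_trans (ler_norm_sum _ _ _) _.
apply: ler_sum => i _; rewrite normrZ ler_piMl// !mxE.
have -> : (Num.floor (u 0 i))%:~R = rc (Num.floor (u 0 i))%:~R :> C R by exact/esym/(rmorph_int (real_complex R)).
rewrite -/(rc _) -rcB normr_rc -rc1 ler_rc ger0_norm ?subr_ge0 ?ge_floor//.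
by rewrite lerBlDl ltW// -intrD1 floorD1_gt.
Qed.

Lemma plane_disc_compact (M : C R) : compact [set x : V | `|x| <= M].
Proof.
have cK : compact [set x : V | forall i, `|x 0 i| <= M].
  exact: (@rV_compact (C R) 2 (fun=> [set z : C R | `|z| <= M]) (fun=> @cdisc_compact R M)).
have cl : closed [set x : V | `|x| <= M].
  have -> : [set x : V | `|x| <= M] = (fun x : V => `|x|) @^-1` [set z : C R | `|z| <= M].
    by apply/seteqP; split => x /=; rewrite normr_id.
  apply: closed_comp; last exact: closed_normC_le.
  move=> x _; exact: norm_continuous.
apply: (subclosed_compact cl cK) => x /= hx i; apply: le_trans hx; exact: norm_coord.
Qed.

(** A continuous periodic function is bounded by its maximum on a compact set which
    meets all classes modulo the periods. *)
Lemma periodic_constant (h : V -> C R) : (forall x, differentiable h x) ->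
  (forall x l, l \in Zspan B -> h (x + l) = h x) -> forall x, h x = h 0.
Proof.
move=> dh hh; have [M HM] := Zspan_reduce.
have [b hb] := compact_norm_bound (@plane_disc_compact M) (fun x _ => differentiable_continuous (dh x)).
apply: (liouville (B := b)) => // y; have [l hl hy] := HM y.
by rewrite -(subrK l y) hh//; exact: hb.
Qed.

End Periodic.

(** * Vanishing of the inflection *)

Section Nondegenerate.
Context {R : realType} {B : 'M[C R]_(2 + 2, 2)}.
Variable f : torus B -> option (P1 R).
Hypothesis hf : meromorphic f.
Let V := 'rV[C R]_2.
Implicit Types (F G : V -> V) (x y p q u v : V) (c : P1 R).
Let pi : V -> torus B := \pi_(torus B).

(** Otherwise [f] is constant, all other fibers are empty, and the empty set is a
    union of no subtori. *)
Lemma lam_nz : finite_set [set c | linear_subset (fiber f c)] ->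
  forall c q F, locrep f F q -> nz (lam (rp c) F) q.
Proof.
move=> fin c q F hF l0; apply: (@P1_infinite R).
have Zq : \forall x \near q, level f c x.
  by apply: filterS2 l0 (locrep_lamZ c hF) => x lx0 /iffLR; exact.
have Zall := Z_all hf Zq.
have sub : [set: P1 R] `<=` [set c] `|` [set c | linear_subset (fiber f c)].
  move=> c' _; have [->|cc'] := eqVneq c' c; [by left|right].
  exists set0 => //; rewrite bigcup_set0 /fiber.
  have -> : f @^-1` [set Some c'] = set0; last exact: closure0.
  apply/seteqP; split => // t /= ft; have [x tx] := pi_surj t.
  have := Zall x; rewrite /level -tx ft => -[//|[E]].
  by rewrite E eqxx in cc'.
by apply: sub_finite_set sub _; rewrite finite_setU; split.
Qed.
End Nondegenerate.

Section Degenerate.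
Context {R : realType} {B : 'M[C R]_(2 + 2, 2)}.
Hypothesis hB : period_matrix B.
Variable f : torus B -> option (P1 R).
Hypothesis hf : meromorphic f.
Let V := 'rV[C R]_2.
Implicit Types (F G : V -> V) (x y p q u v l : V) (c : P1 R).
Let pi : V -> torus B := \pi_(torus B).

Variable cs : seq (P1 R).
Hypothesis ucs : uniq cs.
Hypothesis linear_cs : forall c, c \in cs -> linear_subset (fiber f c).
Hypothesis fnz : forall c q F, locrep f F q -> nz (lam (rp c) F) q.

Lemma lamM u0 (u : V -> C R) F G x : G x = u x *: F x -> lam u0 G x = u x * lam u0 F x.
Proof. by rewrite /lam => ->; rewrite det2Z. Qed.

Lemma Infl_ratio (u : V -> C R) F G x : locrep f F x -> hol u x ->
  (\forall y \near x, G y = u y *: F y) -> Infl G x = u x ^+ 6 * Infl F x.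
Proof.
move=> /locrep_hol[hz hw] hu E; rewrite /Infl.
rewrite -(inflection_homog e1 e2 hu hz hw).
by apply: inflection_near; apply: filterS E => y ->; rewrite coordE.
Qed.

Lemma Infl_shift F x l : locrep f F (x + l) -> Infl (fun y => F (y + l)) x = Infl F (x + l).
Proof.
move=> /locrep_hol[hz hw]; rewrite /Infl.
have E (p : V -> C R) : (fun y => p (F (y + l))) = (fun y => p (F (l + (idfun : {linear V -> V}) y))).
  by apply/funext => y; rewrite addrC.
rewrite addrC in hz hw *; rewrite (E zc) (E wc).
apply: (inflection_pull (phi := (idfun : {linear V -> V})) _ e1 e2 hz hw).
by move=> y.
Qed.

Hypothesis size_cs : size cs = 7%N.

Lemma PlamM (u : V -> C R) F G x : G x = u x *: F x -> Plam cs G x = u x ^+ 7 * Plam cs F x.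
Proof.
move=> E; rewrite /Plam -size_cs; elim: cs => [|c s IH] /=.
  by rewrite !big_nil expr0 mul1r.
by rewrite !big_cons IH exprS (lamM _ E) mulrACA.
Qed.

Lemma nz_Plam F x : locrep f F x -> nz (Plam cs F) x.
Proof. by move=> hF; apply: nz_prod => c _; [exact: (hol_lam _ hF)|exact: fnz]. Qed.

(** The degree is [1 + 6 - 7].  The factor [Plam] is cancelled where it does not vanish,
    which is enough by density. *)
Lemma degree_zero u0 F G (K L : V -> C R) y : locrep f F y -> locrep f G y -> F y != 0 -> G y != 0 ->
  hol K y -> hol L y -> (\forall x \near y, Infl F x = Plam cs F x * K x) ->
  (\forall x \near y, Infl G x = Plam cs G x * L x) -> lam u0 F y * K y = lam u0 G y * L y.
Proof.
move=> hF hG F0 G0 hK hL EK EL; have [u [hu u0n Eu]] := rep_ratio hF hG F0 G0.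
apply: (dense_eq (f := fun y => lam u0 F y * K y) (g := fun y => lam u0 G y * L y) (nz_Plam hG)).
- by apply: hol_cont; apply: holM => //; exact: (hol_lam _ hF).
- by apply: hol_cont; apply: holM => //; exact: (hol_lam _ hG).
apply: filterS3 (filterI EK EL) (filterI (nbhs_interior Eu) (hol_neq0 hu u0n)) (filterI (locrep_near hF) (hol_near hu)).
move=> x [eK eL] [/= Ex ux] [hFx hux] Px.
have eI := Infl_ratio hFx hux Ex; have ex := nbhs_singleton Ex.
have eP := PlamM ex; have el := lamM u0 ex.
have PF : Plam cs F x != 0 by apply: contra_neq Px; rewrite eP => ->; rewrite mulr0.
have : Plam cs F x * K x = Plam cs F x * (u x * L x).
  apply: (mulfI (expf_neq0 6 ux)); rewrite -eK -eI eL eP; move: (u x) (Plam cs F x) (L x) => a b c; ring.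
by move/(mulfI PF) ->; rewrite el; move: (u x) (lam u0 F x) (L x) => a b c; ring.
Qed.

Lemma locrep_choice : exists F : V -> V -> V, forall q,
  locrep f (F q) q /\ \forall x \near q, F q x = 0 -> x = q.
Proof.
have /choice[F hF] q : exists F, locrep f F q /\ \forall x \near q, F x = 0 -> x = q.
  by have [F h1 h2] := locrep_exists hf q; exists F.
by exists F.
Qed.

Lemma homog_point F x : locrep f F x -> F x != 0 -> exists c, lam (rp c) F x = 0.
Proof.
by move=> hF F0; have [c hc] := homog_is_Some F0; exists c; apply/(homog_Some _ F0).
Qed.

(** The function [lam * Infl / Plam] extends to an entire periodic function because
    [Plam] divides [Infl]; it is thus constant, and 0 for a value [c0] of [f]. *)
Lemma Infl_zero q : exists F, [/\ locrep f F q, \forall x \near q, F x = 0 -> x = q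
  & \forall x \near q, Infl F x = 0].
Proof.
have [F hF] := locrep_choice.
have /choice[K hK] q' : exists K : V -> C R, hol K q' /\ \forall x \near q', Infl (F q') x = Plam cs (F q') x * K x.
  have [h1 h2] := hF q'.
  by have [|K h3 h4] := inflection_divisible hf ucs linear_cs h1 h2; [move=> c _; exact: fnz|exists K].
have good q' : \forall y \near q', [/\ locrep f (F q') y, hol (K q') y, F q' y = 0 -> y = q'
    & \forall x \near y, Infl (F q') x = Plam cs (F q') x * K q' x].
  have [h1 h2] := hF q'; have [h3 h4] := hK q'.
  by apply: filterS3 (filterI (locrep_near h1) h2) (hol_near h3) (nbhs_interior h4) => y [h1' h2'] h3' h4'.
have [x0 [hx0 hK0 hz0 hE0] P0] := nzP (nz_Plam (hF 0).1) (good 0).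
have F00 : F 0 x0 != 0.
  apply: contra_neq P0 => E; rewrite /Plam; case: cs size_cs => // c s _.
  by rewrite big_cons /lam E det20 mul0r.
have [c0 hc0] := homog_point hx0 F00.
(* The function [lam * Infl / Plam], computed at each point in the representative
   chosen there. *)
pose H q' := lam (rp c0) (F q') q' * K q' q'.
have nF y x : F y x != 0 -> locrep f (F y) x -> F x x != 0.
  move=> h1 /nbhs_singleton[_ E]; apply/eqP => h2; move/eqP: h1; apply.
  by apply/homog_None; rewrite -E (nbhs_singleton (hF x).1).2; apply/homog_None.
have Hq q' y : locrep f (F q') y -> hol (K q') y -> (F q' y = 0 -> y = q') ->
    (\forall x \near y, Infl (F q') x = Plam cs (F q') x * K q' x) -> H y = lam (rp c0) (F q') y * K q' y.
  move=> h1 h2 h3 h4.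
  have [/h3->//|Fy] := eqVneq (F q' y) 0.
  exact: (degree_zero (rp c0) (hF y).1 h1 (nF _ _ Fy h1) Fy (hK y).1 h2 (hK y).2 h4).
have Hloc q' : \forall y \near q', H y = lam (rp c0) (F q') y * K q' y.
  by apply: filterS (good q') => y [h1 h2 h3 h4]; exact: Hq.
have hH q' : hol (fun y => lam (rp c0) (F q') y * K q' y) q'.
  by apply: holM; [exact: (hol_lam _ (hF q').1)|exact: (hK q').1].
have dH x : differentiable H x.
  have E : \forall y \near x, lam (rp c0) (F x) y * K x y = H y by apply: filterS (Hloc x) => y ->.
  exact: (near_differentiable E (hol_diff (hH x))).1.
have pH x l : l \in Zspan B -> H (x + l) = H x.
  move=> hl; have gl : {for x, continuous (fun y => y + l)}.
    exact: (@cvgD _ _ _ (nbhs x) _ id (fun=> l) x l cvg_id (cvg_cst l)).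
  have Hl : {for x, continuous (fun y => H (y + l))}.
    exact: (continuous_comp gl (differentiable_continuous (dH (x + l)))).
  refine (dense_eq (@fnz c0 _ _ (hF x).1) Hl (differentiable_continuous (dH x)) _).
  apply: filterS (good x) => y [h1 _ _ _] ly.
  have Fy : F x y != 0 by apply: contra_neq ly => E; rewrite /lam E det20.
  have Fyy := nF _ _ Fy h1.
  have := locrep_shift hl (hF (y + l)).1; rewrite addrK => sh.
  have Fyl : F (y + l) (y + l) != 0.
    apply/eqP => h2; move/eqP: Fyy; apply; apply/homog_None.
    rewrite -(nbhs_singleton (hF y).1).2 -(piDl y hl) (nbhs_singleton (hF (y + l)).1).2.
    exact/homog_None.
  have cl : {for y, continuous (fun y => y + l)}.
    exact: (@cvgD _ _ _ (nbhs y) _ id (fun=> l) y l cvg_id (cvg_cst l)).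
  have sK : hol (fun z => K (y + l) (z + l)) y.
    apply: (@hol_comp R V V (fun z => z + l) (K (y + l)) y _ (hK (y + l)).1) => z.
    exact: (differentiableD (dfi z) (dfc l z)).
  have sE : \forall z \near y, Infl (fun z => F (y + l) (z + l)) z = Plam cs (fun z => F (y + l) (z + l)) z * K (y + l) (z + l).
    have : \forall z \near y, locrep f (F (y + l)) (z + l) /\ Infl (F (y + l)) (z + l) = Plam cs (F (y + l)) (z + l) * K (y + l) (z + l).
      exact: (cl _ (filterI (locrep_near (hF (y + l)).1) (hK (y + l)).2)).
    by apply: filterS => z [h3 h4]; rewrite (Infl_shift h3).
  exact: (degree_zero (rp c0) sh (hF y).1 Fyl Fyy sK (hK y).1 sE (hK y).2).
have H0 x : H x = 0.
  rewrite (periodic_constant hB dH pH x) -(periodic_constant hB dH pH x0).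
  by rewrite (Hq _ _ hx0 hK0 hz0 hE0) hc0 mul0r.
exists (F q); have [h1 h2] := hF q; split=> //; have [h3 h4] := hK q.
have E : \forall x \near q, lam (rp c0) (F q) x * K q x = lam (rp c0) (F q) x * 0.
  by apply: filterS (Hloc q) => x; rewrite H0 mulr0.
have K0 := hol_cancel (hol_lam (rp c0) h1) (@fnz c0 _ _ h1) h3 (hol_cst 0 q) E.
by apply: filterS2 h4 K0 => x -> ->; rewrite mulr0.
Qed.

(** If [c] is not a value of [f], no local equation of the fiber over [c] vanishes,
    even at a point of indeterminacy, where zeros would persist at nearby points.
    So [lam c0 / lam c] is entire and periodic, hence constant, for every [c0]. *)
Lemma value_attained c : exists x, f (pi x) = Some c.
Proof.
apply: contrapT => no; have [F hF] := locrep_choice.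
have lam0 q : \forall x \near q, lam (rp c) (F q) x = 0 -> F q x = 0.
  apply: filterS (hF q).1 => x [_ E] /(lamZ _ E)[|Ec]; first by rewrite E => /homog_None.
  by case: no; exists x.
have Fn0 q : F q q != 0.
  apply/eqP => F0; have hl := hol_lam (rp c) (hF q).1.
  have [v v0 nv] := nz_direction hl (@fnz c _ _ (hF q).1).
  have [w vw] := transverse v0.
  have [d d0 hd] := nbhs_dist (filterI (lam0 q) (hF q).2).
  pose eps := d / 2%:R / (1 + `|v|).
  have v1 : 0 < 1 + `|v| by rewrite ltr_wpDr.
  have eps0 : 0 < eps by rewrite !divr_gt0// ltr0n.
  have l0 : lam (rp c) (F q) q = 0 by rewrite /lam F0 det20.
  have [r r0 hr] := hurwitz eps0 hl nv l0.
  have [m m0 [mr md]] := pos_min2 r0 (divr_gt0 d0 (ltr0Sn _ 1)).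
  have w0 : w != 0 by apply: contra_neq vw => ->; rewrite det20.
  have wn : 0 < `|w| by rewrite normr_gt0.
  pose s := m / 2%:R / `|w|.
  have s0 : 0 < s by rewrite !divr_gt0// ltr0n.
  have sw : `|s *: w| = m / 2%:R by rewrite normrZ (gtr0_norm s0) divfK// gt_eqF.
  have m2 : m / 2%:R < m by rewrite ltr_pdivrMr ?ltr0n// ltr_pMr// ltr1n.
  have [|t ht lt] := hr (s *: w); first by rewrite sw (lt_le_trans m2).
  have : `|q + t *: v + s *: w - q| < d.
    rewrite -(addrA q) addrAC subrr add0r; apply: le_lt_trans (ler_normD _ _) _.
    rewrite sw normrZ (splitr d) ltr_leD//; last by rewrite (le_trans (ltW m2)).
    apply: le_lt_trans (_ : eps * `|v| < _).
      by rewrite ler_wpM2r// ltW.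
    by rewrite /eps mulrAC ltr_pdivrMr// ltr_pM2l ?divr_gt0 ?ltr0n// ltrDr.
  move=> /hd[/(_ lt) Fx /(_ Fx)]; rewrite -(addrA q) => /(canRL (addKr q)); rewrite addNr => E.
  have : det2 v (t *: v + s *: w) = 0 by rewrite E det20.
  have -> : det2 v (t *: v + s *: w) = s * det2 v w by rewrite /det2 !coordE; ring.
  by move/eqP; rewrite mulf_eq0 (gt_eqF s0) (negbTE vw).
have ln0 q : lam (rp c) (F q) q != 0.
  by apply: contra_neq (Fn0 q); exact: nbhs_singleton (lam0 q).
have [c0 hc0] := homog_point (hF 0).1 (Fn0 0).
pose h q := lam (rp c0) (F q) q / lam (rp c) (F q) q.
have indep G q : locrep f G q -> G q != 0 -> h q = lam (rp c0) G q / lam (rp c) G q.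
  move=> hG G0; have [u [_ u0 /nbhs_singleton Eu]] := rep_ratio (hF q).1 hG (Fn0 q) G0.
  by rewrite !(lamM _ Eu) -mulf_div divff// mul1r.
have hloc q : \forall y \near q, h y = lam (rp c0) (F q) y / lam (rp c) (F q) y.
  have hl := hol_lam (rp c) (hF q).1.
  apply: filterS2 (locrep_near (hF q).1) (hol_neq0 hl (ln0 q)) => y h1 ly.
  by apply: indep => //; apply: contra_neq ly => E; rewrite /lam E det20.
have dh x : differentiable h x.
  have E : \forall y \near x, lam (rp c0) (F x) y / lam (rp c) (F x) y = h y by apply: filterS (hloc x) => y ->.
  apply: (near_differentiable E _).1; apply: hol_diff; apply: holM.
    exact: (hol_lam _ (hF x).1).
  by apply: holV => //; exact: (hol_lam _ (hF x).1).
have ph x l : l \in Zspan B -> h (x + l) = h x.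
  move=> hl; have := locrep_shift hl (hF (x + l)).1; rewrite addrK => sh.
  by rewrite (indep _ _ sh (Fn0 _)).
apply: (@fnz c0 _ _ (hF 0).1); apply: filterS2 (hloc 0) (hol_neq0 (hol_lam (rp c) (hF 0).1) (ln0 0)) => y Ey ly.
have : h y = 0 by rewrite (periodic_constant hB dh ph) /h hc0 mul0r.
by rewrite Ey => /eqP; rewrite mulf_eq0 invr_eq0 (negbTE ly) orbF => /eqP.
Qed.
End Degenerate.

(** * Vanishing of a Wronskian along a line *)

Section Colinear.
Context {R : realType}.

(** Two functions with zero Wronskian are proportional: their determinant with
    their values at [0] solves a linear equation. *)
Lemma wron_zero_colinear (a b : C R -> C R) : hol a 0 -> hol b 0 -> (a 0 != 0) \/ (b 0 != 0) ->
  (\forall t \near 0, @wron R (C R) 1 a b t = 0) -> \forall t \near 0, a 0 * b t - b 0 * a t = 0.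
Proof.
move=> ha hb ab0 W; pose e t := a 0 * b t - b 0 * a t.
have he : hol e 0 by apply: holB; apply: holM => //; exact: hol_cst.
have e0 : e 0 = 0 by rewrite /e mulrC subrr.
have De : \forall t \near 0, 'D_1 e t = a 0 * 'D_1 b t - b 0 * 'D_1 a t.
  apply: filterS2 ha hb => t da db.
  apply: (etrans (deB _ (dfM (dfc (a 0) t) db) (dfM (dfc (b 0) t) da))).
  by congr (_ - _); exact: deZ.
have kc (k : C R -> C R) : hol k 0 -> k 0 != 0 -> {for 0, continuous (fun t => 'D_1 k t / k t)}.
  by move=> hk k0; apply: hol_cont; apply: holM; [exact: hol_derive|exact: holV].
case: ab0 => n0.
  apply: (ode_unique he (kc a ha n0) e0).
  apply: filterS3 De W (hol_neq0 ha n0) => t -> Wt at0; apply: (mulfI at0).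
  have {Wt} /eqP : a t * 'D_1 b t - b t * 'D_1 a t = 0 by exact: Wt.
  rewrite subr_eq0 /e; move: ('D_1 a t) ('D_1 b t) (a t) (b t) (a 0) (b 0) at0 => a' b' x y x0 y0 xn /eqP E.
  have -> : x * (x0 * b' - y0 * a') = x0 * (x * b') - x * y0 * a' by ring.
  by rewrite E; field.
apply: (ode_unique he (kc b hb n0) e0).
apply: filterS3 De W (hol_neq0 hb n0) => t -> Wt bt0; apply: (mulfI bt0).
have {Wt} /eqP : a t * 'D_1 b t - b t * 'D_1 a t = 0 by exact: Wt.
rewrite subr_eq0 /e; move: ('D_1 a t) ('D_1 b t) (a t) (b t) (a 0) (b 0) bt0 => a' b' x y x0 y0 yn /eqP E.
have -> : y * (x0 * b' - y0 * a') = x0 * y * b' - y0 * (y * a') by ring.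
by rewrite -E; field.
Qed.

Lemma derive_line (V : normedModType (C R)) (h : V -> C R) (x v : V) (t : C R) :
  differentiable h (x + t *: v) -> 'D_1 (fun s : C R => h (x + s *: v)) t = 'D_v h (x + t *: v).
Proof.
by move=> dh; have [dl E] := diff_line dh; rewrite (deriveE _ dl) (deriveE _ dh).
Qed.
End Colinear.

Section Foliation.
Context {R : realType} {B : 'M[C R]_(2 + 2, 2)}.
Variable f : torus B -> option (P1 R).
Hypothesis hf : meromorphic f.
Let V := 'rV[C R]_2.
Implicit Types (F G : V -> V) (x y p q u v l : V) (c : P1 R).
Let pi : V -> torus B := \pi_(torus B).

Definition Wron d F x := wron d (fun y => zc (F y)) (fun y => wc (F y)) x.

(** The values of [F] along the line remain proportional to [F x]. *)
Lemma wron_zero_line F x v c : locrep f F x -> f (pi x) = Some c ->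
  (\forall t \near (0 : C R), Wron v F (x + t *: v) = 0) -> forall t : C R, level f c (x + t *: v).
Proof.
move=> hF fx W; apply: (Z_line hf).
have [_ Ex] := nbhs_singleton hF.
have F0 : F x != 0 by apply/eqP => /homog_None; rewrite -Ex fx.
have hF0 : locrep f F (x + 0 *: v) by rewrite scale0r addr0.
have near_line P : (\forall y \near x, P y) -> \forall t \near (0 : C R), P (x + t *: v).
  by move=> H; apply: (@line_continuous R V x v 0); rewrite scale0r addr0.
have [hz hw] := locrep_hol hF0.
have haz := hol_line hz; have haw := hol_line hw.
pose a (t : C R) := zc (F (x + t *: v)); pose b (t : C R) := wc (F (x + t *: v)).
have a0E : a 0 = zc (F x) by rewrite /a scale0r addr0.
have b0E : b 0 = wc (F x) by rewrite /b scale0r addr0.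
have ab0 : a 0 != 0 \/ b 0 != 0.
  rewrite a0E b0E; have [z0|] := eqVneq (zc (F x)) 0; last by left.
  by right; apply: contra_neq F0 => w0; apply: planeP; rewrite !coordE.
have Wab : \forall t \near (0 : C R), @wron R (C R) 1 a b t = 0.
  apply: filterS2 W (near_line _ (locrep_near hF)) => t Wt /locrep_hol[hzt hwt].
  rewrite -[RHS]Wt /wron /a /b (derive_line (hol_diff hzt)) (derive_line (hol_diff hwt)) //.
apply: filterS2 (wron_zero_colinear haz haw ab0 Wab) (near_line _ hF) => t; rewrite -/(a 0) -/(b 0) a0E b0E => E [_ Et].
have [Ft|Ft] := eqVneq (F (x + t *: v)) 0.
  by left; rewrite Et; apply/homog_None.
by right; rewrite Et; apply: (homog_det2 F0 Ft _ E); rewrite -Ex.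
Qed.
End Foliation.

(** * Fibers that are unions of parallel lines *)

Lemma near_line (R : realType) (V : normedModType (C R)) (x v : V) (P : V -> Prop) :
  (\forall y \near x, P y) -> \forall t \near (0 : C R), P (x + t *: v).
Proof. by move=> H; apply: (@line_continuous R V x v 0); rewrite scale0r addr0. Qed.

Section LineFibers.
Context {R : realType} {B : 'M[C R]_(2 + 2, 2)}.
Variable f : torus B -> option (P1 R).
Hypothesis hf : meromorphic f.
Let V := 'rV[C R]_2.
Implicit Types (F G : V -> V) (x y p q u l : V) (c : P1 R).
Let pi : V -> torus B := \pi_(torus B).

Lemma fiber_near c x (P : V -> Prop) : fiber f c (pi x) -> (\forall y \near x, P y) ->
  exists2 y, P y & f (pi y) = Some c.
Proof.
move=> hx hP; have N : nbhs (pi x) (pi @` [set y | P y]^°).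
  apply: open_nbhs_nbhs; split; first by apply: pi_open; exact: open_interior.
  by exists x.
have [z [h [y /nbhs_singleton Py E]]] := hx _ N.
by exists y => //; rewrite /pi -/pi E.
Qed.

Lemma notZ_open c x : ~ level f c x -> \forall y \near x, ~ level f c y.
Proof.
move=> nZ; have [F hF _] := locrep_exists hf x.
have l0 : lam (rp c) F x != 0 by apply/eqP => /(lamZ _ (nbhs_singleton hF).2).
apply: filterS2 (hol_neq0 (hol_lam (rp c) hF) l0) hF => y ly [_ e] /(lamZ _ e) E.
by rewrite E eqxx in ly.
Qed.

Variable v : V.
Hypothesis v0 : v != 0.
Hypothesis lat : is_lattice [set z : 'rV[C R]_1 | z *m v \in Zspan B].
Hypothesis lines : forall x c, f (pi x) = Some c -> forall t : C R, level f c (x + t *: v).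

Lemma fiber_line c x (t : C R) : fiber f c (pi x) -> level f c (x + t *: v).
Proof.
move=> hx; apply: contrapT => /notZ_open H.
have cl : {for x, continuous (fun y => y + t *: v)}.
  exact: (@cvgD _ _ _ (nbhs x) _ id (fun=> t *: v) x (t *: v) cvg_id (cvg_cst _)).
have H' : \forall y \near x, ~ level f c (y + t *: v) by exact: (cl _ H).
by have [y nZ /lines/(_ t)] := fiber_near hx H'.
Qed.

Lemma line_fiber c x : (forall t : C R, level f c (x + t *: v)) -> fiber f c (pi x).
Proof.
move=> hZ; have [E|] := hZ 0; last by rewrite scale0r addr0; exact: Some_fiber.
move=> N hN; have Nx : \forall y \near x, N (pi y) by exact: (@torus_projection_continuous R B x N hN).
have H : \forall t \near (0 : C R), N (pi (x + t *: v)) /\ (f (pi (x + t *: v)) = None -> x + t *: v = x).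
  have H : \forall y \near x, N (pi y) /\ (f (pi y) = None -> y = x).
    exact: filterI Nx (indet_isolated hf x).
  exact: near_line H.
have [d d0 hd] := @nbhs_dist _ (C R) 0 _ H.
have d2 : 0 < d / 2%:R by rewrite divr_gt0// ltr0n.
have [|Nt it] := hd (d / 2%:R).
  by rewrite subr0 gtr0_norm// ltr_pdivrMr ?ltr0n// ltr_pMr// ltr1n.
exists (pi (x + (d / 2%:R) *: v)); split => //=.
have [/it/(canRL (addKr x))|//] := hZ (d / 2%:R).
by rewrite addNr => /eqP; rewrite scaler_eq0 (negbTE v0) (gt_eqF d2).
Qed.

(** Each fiber is invariant by translations along [v]: a line through a point of the
    closure is a limit of lines through nearby points. *)
Lemma all_linear c : linear_subset (fiber f c).
Proof.
pose T : set (torus B) := [set pi (z *m v) | z in [set: 'rV[C R]_1]].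
exists [set S | exists2 x, fiber f c (pi x) & S = [set pi x + y | y in T]].
  by move=> S [x _ ->]; exists (pi x); exists T => //; exists v.
apply/seteqP; split => [t ft|t [S [x fx ->] [_ [z _ <-] <-]]].
  have [x tx] := pi_surj t; rewrite tx in ft *.
  exists [set pi x + y | y in T]; first by exists x.
  exists (pi 0); last by rewrite -(piD x 0) addr0.
  by exists 0 => //; rewrite mul0mx.
have -> : z *m v = (z 0 0) *: v by rewrite [z]mx11_scalar mul_scalar_mx !mxE mulr1n.
have <- : pi (x + z 0 0 *: v) = pi x + pi (z 0 0 *: v) by exact: piD.
apply: line_fiber => r; rewrite -addrA -scalerDl; exact: fiber_line.
Qed.
End LineFibers.

Section Tangents.
Context {R : realType} {B : 'M[C R]_(2 + 2, 2)}.
Hypothesis hB : period_matrix B.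
Variable f : torus B -> option (P1 R).
Hypothesis hf : meromorphic f.
Let V := 'rV[C R]_2.
Implicit Types (F G : V -> V) (x y p q u l : V) (c : P1 R).
Let pi : V -> torus B := \pi_(torus B).

Lemma det2D u x y : det2 u (x + y) = det2 u x + det2 u y.
Proof. by rewrite /det2 !coordE; ring. Qed.

(** The rows of a period matrix generate the plane over the reals, hence they do not lie
    in one complex line. *)
Lemma Zspan_transverse (v : V) : v != 0 -> exists2 l, l \in Zspan B & det2 v l != 0.
Proof.
move=> v0; have [w vw] := transverse v0.
apply: contrapT => no; move/eqP: vw; apply; have [u ->] := real_coordinates hB w.
rewrite mulmx_sum_row.
have row0 i : det2 v (row i B) = 0.
  apply: contrapT => /eqP n; apply: no; exists (row i B) => //.
  apply/asboolP; exists (delta_mx 0 i); rewrite map_delta_mx; exact: rowE.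
elim/big_rec: _ => [|i x _ IH]; first by rewrite det20.
by rewrite det2D IH addr0 det2Z row0 mulr0.
Qed.

Lemma Z_period c x l : l \in Zspan B -> level f c x -> level f c (x + l).
Proof. by move=> hl; rewrite /level piDl. Qed.

Lemma slope_algebra (sx sy w w2 sv s2 a11 a21 a12 a22 : C R) : w != 0 -> w * sv = a12 - sy * a11 ->
  w * s2 = a22 - sy * a21 -> w2 = sy * w -> qform w w2 a11 a21 a12 a22 = 0 ->
  s2 - sx * sv = (sy - sx) * sv.
Proof.
move=> wn E1 E2 -> E3; rewrite mulrBl; congr (_ - _).
apply: (mulfI (expf_neq0 3 wn)); apply/eqP; rewrite -subr_eq0 -E3 /qform; apply/eqP.
have -> : w ^+ 3 * s2 - w ^+ 3 * (sy * sv) = w ^+ 2 * (w * s2) - w ^+ 2 * sy * (w * sv) by ring.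
by rewrite E1 E2; ring.
Qed.

(** The vanishing of the quadratic form says that [s] satisfies [D_v2 s = s * D_v s], so
    that, along the line through [x] in the direction [v2 - s x *: v], the
    function [s - s x] solves a homogeneous linear equation. *)
Lemma slope_constant (w1 w2 s : V -> C R) (v v2 : V) x :
  hol w1 x -> hol s x -> w1 x != 0 -> (\forall y \near x, w2 y = s y * w1 y) ->
  (\forall y \near x, qform (w1 y) (w2 y) ('D_v w1 y) ('D_v2 w1 y) ('D_v w2 y) ('D_v2 w2 y) = 0) ->
  \forall t \near (0 : C R), s (x + t *: (v2 - s x *: v)) = s x.
Proof.
move=> h1 hs w0 ws I0; pose u := v2 - s x *: v.
have Ds : \forall y \near x, 'D_u s y = (s y - s x) * 'D_v s y.
  apply: filterS3 (filterI I0 (hol_neq0 h1 w0)) (filterI h1 hs) (nbhs_interior ws) => y [Iy wy] [d1 ds] wsy.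
  have Du : 'D_u s y = 'D_v2 s y - s x * 'D_v s y.
    by have := derive_comb 1 (- s x) v2 v ds; rewrite scale1r scaleNr mul1r mulNr; exact.
  have D d : w1 y * 'D_d s y = 'D_d w2 y - s y * 'D_d w1 y.
    have := etrans (near_eq_derive d wsy) (deM d ds d1).
    by move: ('D_d s y) ('D_d w1 y) ('D_d w2 y) (w1 y) (s y) => a b k m n ->; ring.
  rewrite Du; exact: (slope_algebra (s x) wy (D v) (D v2) (nbhs_singleton wsy) Iy).
pose e (t : C R) := s (x + t *: u) - s x.
have hl : hol (fun t : C R => s (x + t *: u)) 0 by apply: hol_line; rewrite scale0r addr0.
have he : hol e 0 by apply: holB => //; exact: hol_cst.
have e0 : e 0 = 0 by rewrite /e scale0r addr0 subrr.
have kc : {for 0, continuous (fun t : C R => 'D_v s (x + t *: u))}.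
  have H : hol (fun y => 'D_v s y) (x + 0 *: u) by rewrite scale0r addr0; exact: hol_derive.
  exact: hol_cont (hol_line H).
have De : \forall t \near (0 : C R), 'D_1 e t = 'D_v s (x + t *: u) * e t.
  have H : \forall t \near (0 : C R), 'D_u s (x + t *: u) = (s (x + t *: u) - s x) * 'D_v s (x + t *: u) /\ differentiable s (x + t *: u).
    have H : \forall y \near x, 'D_u s y = (s y - s x) * 'D_v s y /\ differentiable s y.
    exact: filterI Ds hs.
  exact: near_line H.
  apply: filterS2 H hl => t [Et dt] dlt.
  apply: (etrans (deB _ dlt (dfc (s x) t))); rewrite de_cst subr0.
  by apply: (etrans (derive_line dt)); rewrite Et mulrC.
by apply: filterS (ode_unique he kc e0 De) => t /eqP; rewrite subr_eq0 => /eqP.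
Unshelve. all: by end_near. Qed.
End Tangents.

(** * All fibers are parallel to a linear one *)

Section Tangency.
Context {R : realType} {B : 'M[C R]_(2 + 2, 2)}.
Hypothesis hB : period_matrix B.
Variable f : torus B -> option (P1 R).
Hypothesis hf : meromorphic f.
Let V := 'rV[C R]_2.
Implicit Types (F G : V -> V) (x y p q u l : V) (c : P1 R).
Let pi : V -> torus B := \pi_(torus B).
Hypothesis fnz : forall c q F, locrep f F q -> nz (lam (rp c) F) q.

Variables (c1 : P1 R) (v p1 : V).
Hypothesis v0 : v != 0.
Hypothesis line_c1 : forall t : C R, level f c1 (p1 + t *: v).

Lemma Wron_direction F x u w (a : C R) : locrep f F x ->
  Wron (u - a *: w) F x = Wron u F x - a * Wron w F x.
Proof.
move=> /locrep_hol[/hol_diff hz /hol_diff hw]; rewrite /Wron /wron.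
have E (h : V -> C R) : differentiable h x -> 'D_(u - a *: w) h x = 'D_u h x - a * 'D_w h x.
  by move=> dh; have := derive_comb 1 (- a) u w dh; rewrite scale1r scaleNr mul1r mulNr; exact.
rewrite (E _ hz) (E _ hw); move: ('D_u _ _) ('D_u _ _) ('D_w _ _) ('D_w _ _) (zc _) (wc _) => *; ring.
Qed.

Lemma Infl_change F x u w : locrep f F x -> inflection u w (fun y => zc (F y)) (fun y => wc (F y)) x =
  det2 u w ^+ 2 * Infl F x.
Proof.
move=> /locrep_hol[hz hw]; rewrite {1}(planeE u) {1}(planeE w).
exact: (inflection_change (zc u) (wc u) (zc w) (wc w) e1 e2 hz hw).
Qed.

Lemma cvg_scale_at (h : V -> C R) (x u : V) : {for x, continuous h} -> {for x, continuous (fun y => h y *: u)}.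
Proof. by move=> hh; exact: (@cvgZr_tmp _ _ _ (nbhs x) _ h (h x) u hh). Qed.

Lemma det2_continuous u : continuous (det2 u).
Proof.
by move=> x; exact: (cvgB (cvgM (cvg_cst (zc u)) (@wc_continuous R x)) (cvgM (cvg_cst (wc u)) (@zc_continuous R x))).
Qed.

(** Otherwise the tangent lines of the fibers near some point [x0] all pass through the
    same two indeterminacy points, one on the line of direction [v] in the fiber over
    [c1] and one on its translate by a period. *)
Lemma Wron_zero F q : locrep f F q -> (\forall x \near q, Infl F x = 0) ->
  \forall x \near q, Wron v F x = 0.
Proof.
move=> hF IF; apply: contrapT => nW.
have [hz hw] := locrep_hol hF.
have nzp := nzM (hol_wron v hz hw) (hol_lam (rp c1) hF) nW (@fnz c1 _ _ hF).
have [x0 [hF0 IF0] P0] := nzP nzp (filterI (locrep_near hF) (nbhs_interior IF)).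
move: P0; rewrite mulf_eq0 negb_or => /andP[W0 l0].
have [v2 D] := transverse v0.
have [hz0 hw0] := locrep_hol hF0.
pose w1 := Wron v F; pose w2 := Wron v2 F; pose s x := w2 x / w1 x.
have hw1 : hol w1 x0 by exact: hol_wron.
have hw2 : hol w2 x0 by exact: hol_wron.
have hs : hol s x0 by apply: holM => //; exact: holV.
pose u x := v2 - s x *: v.
pose good x := [/\ locrep f F x, w1 x != 0, lam (rp c1) F x != 0 & \forall y \near x, Infl F y = 0].
have near_good : \forall x \near x0, good x.
  by apply: filterS3 (filterI (locrep_near hF0) (nbhs_interior IF0)) (hol_neq0 hw1 W0) (hol_neq0 (hol_lam (rp c1) hF0) l0) => x [? ?] ? ?; split.
have tangent x c : good x -> f (pi x) = Some c -> forall t : C R, level f c (x + t *: u x).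
  move=> [hx wx _ Ix] fx; apply: (wron_zero_line hf hx fx).
  have [hzx hwx] := locrep_hol hx.
  have h1 : hol w1 x by exact: hol_wron.
  have hsx : hol s x by apply: holM; [exact: hol_wron|exact: holV].
  have ws : \forall y \near x, w2 y = s y * w1 y.
    by apply: filterS (hol_neq0 h1 wx) => y wy; rewrite /s divfK.
  have Q : \forall y \near x, qform (w1 y) (w2 y) ('D_v w1 y) ('D_v2 w1 y) ('D_v w2 y) ('D_v2 w2 y) = 0.
    apply: filterS2 Ix (locrep_near hx) => y Iy hy.
    by apply: (etrans (Infl_change v v2 hy)); rewrite Iy mulr0.
  have S := slope_constant h1 hsx wx ws Q.
  apply: filterS3 S (near_line (u x) ws) (near_line (u x) (locrep_near hx)) => t St wt ht.
  rewrite /u (Wron_direction v2 v (s x) ht) -[X in X - _]/(w2 _) wt -/(u x).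
  by rewrite St subrr.
(* The coordinate along [v2], constant on the lines of direction [v]. *)
pose b x := det2 v x / det2 v v2.
have bD x y : b (x + y) = b x + b y by rewrite /b det2D mulrDl.
have bZ t x : b (t *: x) = t * b x by rewrite /b det2Z mulrA.
have bv : b v = 0 by rewrite /b det2xx mul0r.
have bv2 : b v2 = 1 by rewrite /b divff.
have bu x : b (u x) = 1 by rewrite /u bD -scaleNr bZ bv bv2 mulr0 addr0.
(* The point where the tangent line at [x] meets the line through [p]. *)
pose Y p x := x + (b p - b x) *: u x.
have indet p x : (forall t : C R, level f c1 (p + t *: v)) -> good x -> f (pi (Y p x)) = None.
  move=> hp gx; have [hx _ lx _] := gx; have [_ ex] := nbhs_singleton hx.
  have Fx : F x != 0 by apply: contra_neq lx => E; rewrite /lam E det20.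
  have [c hc] := homog_is_Some Fx.
  have [//|E] := tangent x c gx (etrans ex hc) (b p - b x).
  have dY : det2 v (Y p x - p) = 0.
    apply: (mulIf (invr_neq0 D)); rewrite mul0r -/(b _) -[- p]scaleN1r bD bZ /Y bD bZ bu; ring.
  have [k Ek] := det2_colinear v0 dY.
  have Yk : Y p x = p + k *: v by rewrite -Ek addrC subrK.
  have [|E1] := hp k; first by rewrite -Yk.
  move: E; rewrite -/(Y p x) Yk E1 => -[cc].
  by move/eqP: lx; case; apply/(homog_Some _ Fx); rewrite cc.
have Yc p : {for x0, continuous (Y p)}.
  have sc := hol_cont hs.
  have uc : {for x0, continuous (fun x => (b p - b x) *: v2 - ((b p - b x) * s x) *: v)}.
    have bc : {for x0, continuous (fun x => b p - b x)}.
      exact: (cvgB (cvg_cst (b p)) (cvgM (@det2_continuous v x0) (cvg_cst (det2 v v2)^-1))).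
    have mc : {for x0, continuous (fun x => (b p - b x) * s x)} by exact: (cvgM bc sc).
    have c2 : {for x0, continuous (fun x => (b p - b x) *: v2)} := cvg_scale_at bc.
    have c3 : {for x0, continuous (fun x => ((b p - b x) * s x) *: v)} := cvg_scale_at mc.
    exact: (cvgB c2 c3).
  have -> : Y p = (fun x => x + ((b p - b x) *: v2 - ((b p - b x) * s x) *: v)).
    by apply/funext => x; rewrite /Y /u scalerBr scalerA.
  exact: (cvgD cvg_id uc).
have Yconst p : (forall t : C R, level f c1 (p + t *: v)) -> \forall x \near x0, Y p x = Y p x0.
  move=> hp; have H : \forall x \near x0, f (pi (Y p x)) = None -> Y p x = Y p x0.
    exact: (Yc p _ (indet_isolated hf (Y p x0))).
  by apply: filterS2 H near_good => x Hx gx; apply: Hx; exact: indet.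
have [l lB dl] := Zspan_transverse hB v0.
have bl : b l != 0 by rewrite mulf_neq0 ?invr_eq0.
have hl (t : C R) : level f c1 (p1 + l + t *: v).
  by rewrite addrAC; exact: Z_period.
have E : \forall x \near x0, Y p1 x = Y p1 x0 /\ Y (p1 + l) x = Y (p1 + l) x0.
  exact: filterI (Yconst _ line_c1) (Yconst _ hl).
(* The two meeting points determine the direction [u x]. *)
have YD x : Y (p1 + l) x = Y p1 x + b l *: u x.
  by rewrite /Y bD [b p1 + b l - _]addrAC (scalerDl _ _ (b l)) addrA.
have [d d0 hd] := @nbhs_dist _ (C R) 0 _ (near_line v E).
have d2 : 0 < d / 2%:R by rewrite divr_gt0// ltr0n.
have [|E1 E2] := hd (d / 2%:R).
  by rewrite subr0 gtr0_norm// ltr_pdivrMr ?ltr0n// ltr_pMr// ltr1n.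
set x := x0 + _ in E1 E2.
have ux : u x = u x0.
  by move: E2; rewrite !YD E1 => /addrI /(scalerI bl).
(* Moving [x] along [v] moves the meeting point, which is constant. *)
have bx : b x = b x0 by rewrite /x bD bZ bv mulr0 addr0.
move: E1; rewrite /Y ux bx => /addIr.
rewrite /x -[RHS]addr0 => /addrI /eqP.
by rewrite scaler_eq0 (negbTE v0) (gt_eqF d2).
Qed.
End Tangency.

Lemma finite_few_linear (R : realType) (B : 'M[C R]_(2 + 2, 2)) (hB : period_matrix B)
    (f : torus B -> option (P1 R)) (hf : meromorphic f) (cs : seq (P1 R)) :
  finite_set [set c : P1 R | linear_subset (fiber f c)] -> uniq cs -> size cs = 7%N ->
  (forall c, c \in cs -> linear_subset (fiber f c)) -> False.
Proof.
move=> fin ucs scs hcs; have fnz := lam_nz hf fin.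
have [c1 c1s] : exists c, c \in cs by case: cs scs {ucs hcs} => // c s _; exists c; rewrite mem_head.
have [p1 fp1] := value_attained hB hf fnz c1.
have [v [v0 lat hv]] := linear_line (hcs _ c1s) (Some_fiber fp1).
have lines x c : f (\pi_(torus B) x) = Some c -> forall t : C R, level f c (x + t *: v).
  move=> fx; have [F [hF _ IF]] := Infl_zero hB hf ucs hcs fnz scs x.
  have W := Wron_zero hB hf fnz v0 (fun t => fiber_Z hf (hv t)) hF IF.
  exact: (wron_zero_line hf hF fx (near_line v W)).
apply: (@P1_infinite R); apply: sub_finite_set fin => c _ /=.
exact: (all_linear hf v0 lat lines).
Qed.

Local Open Scope card_scope.

Theorem theorem4 (R : realType) (B : 'M[C R]_(2 + 2, 2)) (hB : period_matrix B)
    (f : torus B -> option (P1 R)) (hf : meromorphic f) :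
  finite_set [set c : P1 R | linear_subset (fiber f c)] ->
  [set c : P1 R | linear_subset (fiber f c)] #<= `I_6.
Proof.
set A := [set c | _] => fin; have /finite_setP[n An] := fin.
have [n6|n7] := leqP n 6; first by rewrite (card_le_eql An) card_le_II.
have En := card_fset_set An.
case: (@finite_few_linear R B hB f hf (take 7 (finmap.enum_fset (fset_set A))) fin).
- by rewrite take_uniq// finmap.fset_uniq.
- by rewrite size_takel// -[X in (_ <= X)%N]/(size (finmap.enum_fset (fset_set A))) En.
move=> c /mem_take; rewrite in_fset_set// => /set_mem; exact.
Qed.
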